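(* Let $\Omega\subset\mathbb{R}^d$ be compact and convex, let $\mathsf{G}=(\mathsf{V},\mathsf{E},l)$ be a metric graph embedded into $\Omega$, let $(\mu_0,\rho_0),(\mu_1,\rho_1)\in\mathcal{P}_{\rm adm}(\mathsf{G})$ be given initial and final data, let $m_\Omega,m_{\mathsf{G}}$ be admissible mobilities, let $\alpha_1,\alpha_2,\alpha_3>0$, and let $\lambda_\Omega$, $(\lambda_e)_{e\in\mathsf{E}}$, $(\lambda_v)_{v\in\mathsf{V}_{\rm out}}$ be fixed reference measures. Suppose that $$\inf_{(\mu_t,J_t,\rho_t,V_t,f_t,G_t)\in\mathsf{CE}(\mathsf{G})}\int_0^1\mathcal{A}_{\mathsf{G}}(\mu_t,J_t,\rho_t,V_t,f_t,G_t)\,dt<+\infty .$$ Then there exists $(\mu_t,J_t,\rho_t,V_t,f_t,G_t)\in\mathsf{CE}(\mathsf{G})$ attaining this infimum.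
   Context: **Graphs.** $\mathsf{V}$ is a finite set of nodes and $\mathsf{E}$ a finite set of oriented edges $e=(v,w)$, $v,w\in\mathsf{V}$. A metric graph $(\mathsf{V},\mathsf{E},l)$ carries lengths $l_e>0$, $e\in\mathsf{E}$. $\mathsf{E}(v)$ is the set of edges containing $v$, and $\mathsf{V}_{\rm out}=\{v\in\mathsf{V}: |\mathsf{E}(v)|=1\}$. For $e=(v,w)$ put $n_e^v=-1$, $n_e^w=+1$ (and $n_e^u=0$ if $u\notin e$). The metric graph is embedded into $\Omega$ if distinct points $x_v\in\Omega$, $v\in\mathsf{V}$, are given such that the straight segments $[x_v,x_w]$, $e=(v,w)\in\mathsf{E}$, do not intersect (other than at common vertices) and $|x_w-x_v|=l_e$. We identify $e$ with $[x_v,x_w]$, and put $\tau_e=(x_w-x_v)/l_e$, $\gamma_e:[0,1]\to e$, $\gamma_e(s)=x_v+s\,l_e\tau_e$, $\tilde\gamma_e=\gamma_e^{-1}$. $\Omega_{\mathsf{E}}$ is the disjoint union of the edges, $\Omega_{\mathsf{G}}$ is its quotient identifying copies of the same vertex, and $\Omega_{\mathsf{V}}=\bigsqcup_{v\in\mathsf{V}_{\rm out}}\{x_v\}$. **Measures.** $\mathcal{M}(U,\mathbb{R}^N)$ denotes the (finite) $\mathbb{R}^N$-valued Radon measures on $U$, $\mathcal{M}(U)=\mathcal M(U,\mathbb R)$, $\mathcal{M}_+$ the non-negative ones, and $\mathcal{M}_{[0,1]}(U,\mathbb{R}^N)$ Borel measurable families indexed by $t\in[0,1]$. A measure $\rho$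 on $\Omega_{\mathsf{G}}$ is identified with a family $(\rho^e)_{e\in\mathsf{E}}$ of measures on the edges whose sum, after identification of vertices, is $\rho$. $\mathcal{D}_{\rm adm}(\mathsf{G})$ is the set of tuples $(\mu_t,J_t,\rho_t,V_t,f_t,G_t)$ with $\mu_t\in\mathcal{M}_{[0,1]}(\Omega,\mathbb{R})$, $J_t\in\mathcal{M}_{[0,1]}(\Omega,\mathbb{R}^d)$, $\rho_t\in\mathcal{M}_{[0,1]}(\Omega_{\mathsf{G}},\mathbb{R})$, $V_t=(V_t^e)_{e}$ on $\Omega_{\mathsf{E}}$ with $V^e_t=\tau_e\mathcal{V}^e_t$, $\mathcal{V}^e_t$ real valued, $f_t=(f_t^e)_e\in\mathcal{M}_{[0,1]}(\Omega_{\mathsf{E}},\mathbb{R})$, and $G_t$ on $\Omega_{\mathsf{V}}$ with $G_t^e(x_v)=\tau_e\mathcal{G}_t^e(x_v)$, $\mathcal{G}^e_t(x_v)\in\mathcal{M}(\{x_v\},\mathbb{R})$, for $v\in\mathsf{V}_{\rm out}$, $e\in\mathsf{E}(v)$; the total variations are assumed integrable in $t$ so that the integrals below make sense. $\mathcal{P}_{\rm adm}(\mathsf{G})=\{(\mu,\rho)\in\mathcal{M}_+(\Omega)\times\mathcal{M}_+(\Omega_{\mathsf{G}}):\mu(\Omega)+\rho(\Omega_{\mathsf{G}})=1\}$. A tilde on a measure on an edge $e$ denotes its push-forward to $[0,1]$ under $\tilde\gamma_e$. **Continuity equation.** $\mathsf{CE}(\mathsf{G})$ (for the given data $(\mu_0,\rho_0),(\mu_1,\rho_1)$)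 is the set of tuples in $\mathcal{D}_{\rm adm}(\mathsf{G})$ such that $$\int_0^1\!\!\int_\Omega\partial_t\phi_t\,d\mu_t\,dt+\int_0^1\!\!\int_\Omega\nabla\phi_t\cdot dJ_t\,dt-\sum_{e\in\mathsf{E}}\int_0^1\!\!\int_0^1\phi_t(\gamma_e(s))\,d\tilde f_t^e\,dt+\sum_{v\in\mathsf{V}_{\rm out}}\sum_{e\in\mathsf{E}(v)}\int_0^1\!\!\int_{\{x_v\}}\phi_t(x_v)n_e^v\,d\mathcal{G}_t^e(x_v)\,dt=\int_\Omega\phi_1\,d\mu_1-\int_\Omega\phi_0\,d\mu_0$$ for all $\phi\in C^1([0,1]\times\Omega)$, and $$\sum_{e\in\mathsf{E}}\Big(\int_0^1\!\!\int_0^1\partial_t\psi_t^e\,d\tilde\rho_t^e\,dt+\int_0^1\!\!\int_0^1 l_e^{-1}\partial_s\psi_t^e\,d\tilde{\mathcal{V}}_t^e\,dt+\int_0^1\!\!\int_0^1\psi_t^e\,d\tilde f_t^e\,dt\Big)-\sum_{v\in\mathsf{V}_{\rm out}}\sum_{e\in\mathsf{E}(v)}\int_0^1\!\!\int_{\{x_v\}}\psi_t^e(\tilde\gamma_e(x_v))n_e^v\,d\mathcal{G}_t^e(x_v)\,dt=\sum_{e\in\mathsf{E}}\Big(\int_0^1\psi_1^e\,d\tilde\rho_1^e-\int_0^1\psi_0^e\,d\tilde\rho_0^e\Big)$$ for all $\psi=(\psi^e)_{e\in\mathsf{E}}$ with $\psi^e\in C^1([0,1]\times[0,1])$ (variables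 $(t,s)$) that are continuous over vertices, i.e. $\psi_t^e(\tilde\gamma_e(x_v))$ is the same for all $e\in\mathsf{E}(v)$, for each $v\in\mathsf{V}$. **Action.** An admissible mobility is an upper semicontinuous concave function $m:[0,+\infty)\to[0,+\infty)\cup\{-\infty\}$ with $\operatorname{int}(\operatorname{dom}(m))=(a,b)$ for real numbers $0\le a<b$ and $m>0$ on $(a,b)$; set $m=-\infty$ on $(-\infty,0)$. For $m_\Omega$ put $\Psi_\Omega(u,v)=|v|^2/m_\Omega(u)$ if $m_\Omega(u)>0$, $\Psi_\Omega(u,v)=0$ if $m_\Omega(u)=0$ and $v=0$, and $+\infty$ otherwise; $\Psi_{\mathsf{G}}$ is defined in the same way from $m_{\mathsf{G}}$. Reference measures are $\lambda_\Omega\in\mathcal{M}_+(\Omega)$, $\lambda_e\in\mathcal{M}_+(e)$, $\lambda_v\in\mathcal{M}_+(\{x_v\})$. If $\mu_t,J_t\ll\lambda_\Omega$, $\rho_t^e,\mathcal{V}_t^e,f_t^e\ll\lambda_e$, $\rho_t^e|_{x_v},\mathcal{G}_t^e(x_v)\ll\lambda_v$, then $$\mathcal{A}_{\mathsf{G}}=\int_\Omega\Psi_\Omega\Big(\tfrac{d\mu_t}{d\lambda_\Omega},\tfrac{dJ_t}{d\lambda_\Omega}\Big)d\lambda_\Omega+\sum_{e\in\mathsf{E}}\int_e\Big[\alpha_1\Psi_{\mathsf{G}}\Big(\tfrac{d\rho_t^e}{d\lambda_e},\tfrac{d\mathcal{V}_t^e}{d\lambda_e}\Big)+\alpha_2\Psi_{\mathsf{G}}\Big(\tfrac{d\rho_t^e}{d\lambda_e},\tfrac{df_t^e}{d\lambda_e}\Big)\Big]d\lambda_e+\alpha_3\sum_{v\in\mathsf{V}_{\rm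 out}}\sum_{e\in\mathsf{E}(v)}\int_{\{x_v\}}\Psi_{\mathsf{G}}\Big(\tfrac{d\rho_t^e|_{x_v}}{d\lambda_v},\tfrac{d\mathcal{G}_t^e(x_v)}{d\lambda_v}\Big)d\lambda_v,$$ where $\rho_t^e|_{x_v}$ is the restriction of $\rho_t^e$ to $\{x_v\}$; if the absolute continuity fails, $\mathcal{A}_{\mathsf{G}}=+\infty$ (so finite time-integrated action requires it for a.e. $t$). *)

(* Defs.v *)
From HB Require Import structures.
From mathcomp Require Import all_boot all_order all_algebra.
From mathcomp Require Import all_classical all_reals all_analysis.
From mathcomp Require Import measurable_realfun ring.

Set Implicit Arguments.
Unset Strict Implicit.
Unset Printing Implicit Defensive.
Import Order.TTheory GRing.Theory Num.Theory.
Import numFieldNormedType.Exports.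
Local Open Scope classical_set_scope.
Local Open Scope ring_scope.
Local Open Scope charge_scope.

(* The norm that the library puts on 'rV[R]_d is the sup norm; it only serves
   for the topology and for differentiability. *)
Section euclidean.
Context {R : realType} {d : nat}.
Implicit Types u v : 'rV[R]_d.

Definition edot u v : R := \sum_(i < d) u 0 i * v 0 i.

Definition enorm u : R := Num.sqrt (edot u u).

Definition segment u v : set 'rV[R]_d :=
  [set u + s *: (v - u) | s in `[0, 1]%classic].

Lemma edot_continuous v : continuous (edot^~ v).
Proof.
rewrite /edot; apply: continuous_big => [|i _]; first exact: add_continuous.
move=> u; apply: cvgMr_tmp.
  exact: nbhs_filter.
exact: coord_continuous.
Qed.

End euclidean.

(* R^d with its Borel sigma-algebra. *)
Definition borel_rV (R : realType) (d : nat) :=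
  g_sigma_algebraType (@open 'rV[R]_d).

Section borel.
Context {R : realType} {d : nat}.

Lemma measurable_point (x : 'rV[R]_d) :
  measurable ([set x] : set (borel_rV R d)).
Proof.
rewrite -[X in measurable X]setCK; apply: measurableC.
apply: sub_sigma_algebra; apply: closed_openC.
exact: (accessible_closed_set1 (hausdorff_accessible (@norm_hausdorff R _))).
Qed.

Lemma continuous_borel_measurable (g : 'rV[R]_d -> R) : continuous g ->
  measurable_fun [set: borel_rV R d] (g : borel_rV R d -> R).
Proof.
move=> cg; apply: (measurability _ (RGenOpens.measurableE R)).
move=> _ [_ [a [b ->]] <-]; rewrite setTI; apply: sub_sigma_algebra.
by apply: open_comp => // x _; exact: cg.
Qed.

End borel.

(* Finite signed Borel measures are charges.  A measure on a Borel subset U of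
   R^d is encoded as a measure on R^d vanishing off U, and an R^N-valued
   measure as the family of its N components. *)
Section signed_measures.
Context {R : realType} {disp : measure_display} {T : measurableType disp}.
Implicit Types nu : {charge set T -> \bar R}.

Definition concentrated (U : set T) (nu : set T -> \bar R) : Prop :=
  forall A, measurable A -> A `&` U = set0 -> nu A = 0%E.

Definition hahn nu : {PN : set T * set T | hahn_decomposition nu PN.1 PN.2}.
Proof.
apply: cid; have [P [N PN]] := Hahn_decomposition nu.
by exists (P, N).
Qed.

(* The Jordan decomposition, hence everything below, does not depend on the
   Hahn decomposition that is chosen. *)
Definition charge_pos nu := jordan_pos (svalP (hahn nu)).
Definition charge_neg nu := jordan_neg (svalP (hahn nu)).

Definition total_variation nu : \bar R :=
  charge_variation (svalP (hahn nu)) setT.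

Definition charge_integral nu (D : set T) (g : T -> R) : R :=
  \int[charge_pos nu]_(x in D) g x - \int[charge_neg nu]_(x in D) g x.

(* Borel families of measures on U indexed by [0,1], with integrable total
   variation. *)
Definition measure_path (U : set T) (nu : R -> {charge set T -> \bar R}) :
    Prop :=
  [/\ forall t, t \in `[0, 1] -> concentrated U (nu t),
      forall A : set T, measurable A ->
        measurable_fun (`[0, 1]%classic : set R) (fun t => nu t A) &
      (@lebesgue_measure R).-integrable `[0, 1]%classic
        (fun t => total_variation (nu t))].

End signed_measures.

Notation "\cint [ nu ]_ ( x 'in' D ) f" := (charge_integral nu D (fun x => f))
  (at level 36, f at level 36, nu at level 10, x, D at level 50,
   format "'[' \cint [ nu ]_ ( x  'in'  D ) '/  '  f ']'") : ring_scope.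

Section graphs.
Context {R : realType}.

Record metric_graph := MetricGraph {
  vertex : finType;
  edges : {set vertex * vertex};
  len : {e : vertex * vertex | e \in edges} -> R;
  len_gt0 : forall e, 0 < len e }.

Definition edge (G : metric_graph) : finType :=
  {e : vertex G * vertex G | e \in edges G}.

Context {G : metric_graph}.
Implicit Types (v : vertex G) (e : edge G).

Definition src e : vertex G := (val e).1.
Definition tgt e : vertex G := (val e).2.

Definition incident v : {set edge G} :=
  [set e : edge G | (v == src e) || (v == tgt e)]%SET.

Definition vout : {set vertex G} := [set v | #|incident v| == 1%N]%SET.

Definition edge_normal e v : R :=
  if v == src e then -1 else if v == tgt e then 1 else 0.

End graphs.
Arguments metric_graph : clear implicits.

Section embedding.
Context {R : realType} {d : nat} {G : metric_graph R}.
Variable x : vertex G -> 'rV[R]_d.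
Implicit Types (v : vertex G) (e : edge G).

Definition seg e : set 'rV[R]_d := segment (x (src e)) (x (tgt e)).

Definition embedded (Omega : set 'rV[R]_d) : Prop :=
  [/\ injective x,
      forall v, Omega (x v),
      forall e e', e != e' -> forall z, seg e z -> seg e' z ->
        exists v, [/\ e \in incident v, e' \in incident v & z = x v] &
      forall e, enorm (x (tgt e) - x (src e)) = len e].

Definition tau e : 'rV[R]_d := (len e)^-1 *: (x (tgt e) - x (src e)).

Definition gamma e (s : R) : 'rV[R]_d := x (src e) + (s * len e) *: tau e.

(* The inverse of [gamma e], extended from the edge to R^d by orthogonal
   projection onto the line that carries it. *)
Definition gamma_inv e (y : borel_rV R d) : R :=
  edot (y - x (src e)) (tau e) / len e.

Lemma gammaK Omega e : embedded Omega -> cancel (gamma e) (gamma_inv e).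
Proof.
case=> _ _ _ /(_ e) le s; have l0 := len_gt0 e.
have lN0 : len e != 0 by rewrite gt_eqF.
rewrite /gamma_inv /gamma addrAC subrr add0r.
have -> : edot ((s * len e) *: tau e) (tau e) =
    s / len e * edot (x (tgt e) - x (src e)) (x (tgt e) - x (src e)).
  rewrite /edot !mulr_sumr; apply: eq_bigr => i _; rewrite !mxE.
  by field.
have dot0 : 0 <= edot (x (tgt e) - x (src e)) (x (tgt e) - x (src e)).
  by apply: sumr_ge0 => i _; rewrite -expr2 sqr_ge0.
by rewrite -(sqr_sqrtr dot0) -/(enorm _) le; field.
Qed.

Lemma gamma_segment e : gamma e @` `[0, 1]%classic = seg e.
Proof.
have lN0 : len e != 0 by rewrite gt_eqF// len_gt0.
by congr (_ @` _); apply/funext => s; rewrite /gamma /tau scalerA mulfK.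
Qed.

Lemma measurable_gamma_inv e : measurable_fun setT (gamma_inv e).
Proof.
apply: continuous_borel_measurable => y.
apply: cvgMr_tmp; first exact: nbhs_filter.
apply: (@continuous_comp _ _ _ (fun y : 'rV[R]_d => y - x (src e))
  (edot^~ (tau e))); last exact: edot_continuous.
by apply: cvgB; [exact: nbhs_filter|exact: cvg_id|exact: cst_continuous].
Qed.

(* [pushforward nu (gamma_inv e)], with its charge structure. *)
Definition tilde e (nu : {charge set (borel_rV R d) -> \bar R}) :
    {charge set R -> \bar R} :=
  measure_function_pushforward__canonical__charge_Charge nu
    (measurable_gamma_inv e).

End embedding.

(* The members of C^1([0,1] x K) are taken to be the restrictions of the C^1
   functions of the ambient space; [0,1] x K need not have interior points. *)
Definition C1 (R : realType) (V : normedModType R) (f : V -> R) : Prop :=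
  (forall p, differentiable f p) /\ (forall v, continuous ('D_v f)).

Section measures_on_graphs.
Context {R : realType} {d : nat} {G : metric_graph R}.

Local Notation signed := (charge (borel_rV R d) R).
Local Notation finite := (FiniteMeasure.type (borel_rV R d) R).

(* The measure rho on the metric space associated with the graph is given by
   the family of the rho^e.  That space is homeomorphic to the union of the
   segments, so that rho is the sum of the rho^e in R^d. *)
Record datum := Datum {
  dmu : finite;
  drho : edge G -> signed }.

(* Vector-valued measures V^e and G^e(x_v), together with the real-valued
   ones (calligraphic letters in the literature) of which they are the
   multiples by tau_e.  The fields [stG] and [stGs] are only meaningful at
   (v, e) with v in [vout] and e in [incident v]. *)
Record state := State {
  stmu : signed;
  stJ : 'I_d -> signed;
  strho : edge G -> signed;
  stV : edge G -> 'I_d -> signed;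
  stVs : edge G -> signed;
  stf : edge G -> signed;
  stG : vertex G -> edge G -> 'I_d -> signed;
  stGs : vertex G -> edge G -> signed }.

Variables (Omega : set 'rV[R]_d) (x : vertex G -> 'rV[R]_d).

Definition Padm (z : datum) : Prop :=
  [/\ concentrated (Omega : set (borel_rV R d)) (dmu z),
      forall e, concentrated (seg x e : set (borel_rV R d)) (drho z e),
      forall A : set (borel_rV R d), measurable A ->
        (0 <= \sum_(e : edge G) drho z e A)%E &
      (dmu z Omega + \sum_(e : edge G) drho z e (seg x e) = 1)%E].

Definition Dadm (p : R -> state) : Prop :=
  [/\ measure_path (Omega : set (borel_rV R d)) (fun t => stmu (p t)) /\
        (forall i, measure_path (Omega : set (borel_rV R d))
                     (fun t => stJ (p t) i)),
      forall e,
        [/\ measure_path (seg x e : set (borel_rV R d))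
              (fun t => strho (p t) e),
            measure_path (seg x e : set (borel_rV R d))
              (fun t => stVs (p t) e) &
            measure_path (seg x e : set (borel_rV R d))
              (fun t => stf (p t) e)],
      forall v e, v \in vout -> e \in incident v ->
        measure_path ([set x v] : set (borel_rV R d))
          (fun t => stGs (p t) v e),
      forall t, t \in `[0, 1] -> forall e i (A : set (borel_rV R d)),
        measurable A ->
        stV (p t) e i A = ((tau x e 0 i)%:E * stVs (p t) e A)%E &
      forall t, t \in `[0, 1] -> forall v e, v \in vout -> e \in incident v ->
        forall i (A : set (borel_rV R d)), measurable A ->
        stG (p t) v e i A = ((tau x e 0 i)%:E * stGs (p t) v e A)%E].

Local Notation "\int01_ t f" :=
  (\int[@lebesgue_measure R]_(t in `[0, 1]%classic) f)
  (at level 36, f at level 36, t at level 0).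

Definition CE_bulk (z0 z1 : datum) (p : R -> state) : Prop :=
  forall phi : R * 'rV[R]_d -> R, C1 phi ->
    \int01_t (\cint[stmu (p t)]_(y in Omega) 'D_(1, 0) phi (t, y))
    + \int01_t (\sum_(i < d)
        \cint[stJ (p t) i]_(y in Omega) 'D_(0, delta_mx 0 i) phi (t, y))
    - \sum_(e : edge G) \int01_t
        (\cint[tilde x e (stf (p t) e)]_(s in `[0, 1]%classic)
           phi (t, gamma x e s))
    + \sum_(v in vout) \sum_(e in incident v) \int01_t
        (\cint[stGs (p t) v e]_(y in [set x v])
           (phi (t, x v) * edge_normal e v))
    = \int[dmu z1]_(y in Omega) phi (1, y)
      - \int[dmu z0]_(y in Omega) phi (0, y).

Definition continuous_over_vertices (psi : edge G -> R * R -> R) : Prop :=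
  forall v e e', e \in incident v -> e' \in incident v ->
  forall t, t \in `[0, 1] ->
    psi e (t, gamma_inv x e (x v)) = psi e' (t, gamma_inv x e' (x v)).

Definition CE_graph (z0 z1 : datum) (p : R -> state) : Prop :=
  forall psi : edge G -> R * R -> R, (forall e, C1 (psi e)) ->
  continuous_over_vertices psi ->
    \sum_(e : edge G)
      (\int01_t (\cint[tilde x e (strho (p t) e)]_(s in `[0, 1]%classic)
                   'D_(1, 0) (psi e) (t, s))
       + \int01_t (\cint[tilde x e (stVs (p t) e)]_(s in `[0, 1]%classic)
                   ((len e)^-1 * 'D_(0, 1) (psi e) (t, s)))
       + \int01_t (\cint[tilde x e (stf (p t) e)]_(s in `[0, 1]%classic)
                   psi e (t, s)))
    - \sum_(v in vout) \sum_(e in incident v) \int01_t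
        (\cint[stGs (p t) v e]_(y in [set x v])
           (psi e (t, gamma_inv x e (x v)) * edge_normal e v))
    = \sum_(e : edge G)
        (\cint[tilde x e (drho z1 e)]_(s in `[0, 1]%classic) psi e (1, s)
         - \cint[tilde x e (drho z0 e)]_(s in `[0, 1]%classic) psi e (0, s)).

Definition CE (z0 z1 : datum) (p : R -> state) : Prop :=
  [/\ Dadm p, CE_bulk z0 z1 p & CE_graph z0 z1 p].

End measures_on_graphs.
Arguments datum R d G : clear implicits.
Arguments state R d G : clear implicits.

(* A mobility is extended by -oo to the negative half-line.  Given that
   extension, upper semicontinuity on R and on [0, +oo[ agree. *)
Definition admissible_mobility (R : realType) (m : R -> \bar R) : Prop :=
  [/\ forall u, u < 0 -> m u = -oo%E,
      forall u, 0 <= u -> m u = -oo%E \/ exists2 r, 0 <= r & m u = r%:E,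
      lower_semicontinuous (fun u => - m u)%E,
      forall u v s, 0 <= u -> 0 <= v -> 0 < s < 1 ->
        (s%:E * m u + (1 - s)%:E * m v <= m (s * u + (1 - s) * v)%R)%E &
      exists a b, [/\ 0 <= a, a < b,
        interior [set u | m u != -oo%E] = `]a, b[%classic &
        forall u, a < u < b -> (0 < m u)%E]].

Section action.
Context {R : realType} {d : nat} {G : metric_graph R}.

Local Notation finite := (FiniteMeasure.type (borel_rV R d) R).

(* Psi(u, w) as a function of u and |w|. *)
Definition Psi (m : R -> \bar R) (u absw : R) : \bar R :=
  if (0 < m u)%E then (absw ^+ 2 / fine (m u))%:E
  else if (m u == 0%E) && (absw == 0) then 0%E else +oo%E.

Variables (mO mG : R -> \bar R) (a1 a2 a3 : R) (x : vertex G -> 'rV[R]_d).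
Variables (Omega : set 'rV[R]_d).
Variables (lO : finite) (lE : edge G -> finite) (lV : vertex G -> finite).

Definition restr_vertex (z : state R d G) (v : vertex G) (e : edge G) :
    {charge set (borel_rV R d) -> \bar R} :=
  crestr0 (strho z e) (measurable_point (x v)).

Definition abs_continuous (z : state R d G) : Prop :=
  [/\ stmu z `<< lO,
      forall i, stJ z i `<< lO,
      forall e, [/\ strho z e `<< lE e, stVs z e `<< lE e & stf z e `<< lE e] &
      forall v e, v \in vout -> e \in incident v ->
        restr_vertex z v e `<< lV v /\ stGs z v e `<< lV v].

Local Notation density nu l y := (fine ('d nu '/d l y)).

Definition graph_action (z : state R d G) : \bar R :=
  if `[< abs_continuous z >] then
    (\int[lO]_(y in Omega)
       Psi mO (density (stmu z) lO y)
         (enorm (\row_(i < d) density (stJ z i) lO y))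
     + \sum_(e : edge G) \int[lE e]_(y in seg x e)
         (a1%:E * Psi mG (density (strho z e) (lE e) y)
                    `|density (stVs z e) (lE e) y|%R
          + a2%:E * Psi mG (density (strho z e) (lE e) y)
                      `|density (stf z e) (lE e) y|%R)
     + a3%:E * \sum_(v in vout) \sum_(e in incident v)
         \int[lV v]_(y in [set x v])
           Psi mG (density (restr_vertex z v e) (lV v) y)
             `|density (stGs z v e) (lV v) y|%R)%E
  else +oo%E.

Definition total_action (p : R -> state R d G) : \bar R :=
  (\int[@lebesgue_measure R]_(t in `[0%R, 1%R]%classic) graph_action (p t))%E.

End action.

(* Main.v *)
(* No weak compactness is used.  The action is convex, and it is coercive: as the
   domains of the mobilities are bounded, it controls the squared L^2 norms, with
   respect to the reference measures, of the densities of all components.  Take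
   S_n, the admissible tuples with action at most inf + 1/(n+1); it is
   midpoint-convex.  By the parallelogram identity, elements of S_n whose energy
   (the sum of these squared norms) is almost minimal in S_n form a Cauchy
   sequence, hence converge in total variation, integrated over time.  The
   continuity equations are continuous linear conditions for that convergence, and
   the action is lower semicontinuous by Fatou's lemma.  Measurability in t, and
   lower semicontinuity for fixed t, hold because the action of a tuple of measures
   is the supremum of its discretizations on the finite partitions generated by a
   countable family of Borel sets. *)

From HB Require Import structures.
Require Import Defs.
From mathcomp Require Import all_boot all_order all_algebra.
From mathcomp Require Import all_classical all_reals all_analysis.
From mathcomp Require Import measurable_realfun ring lra.
Import Order.TTheory GRing.Theory Num.Theory.
Import numFieldNormedType.Exports HBSimple.
Set Implicit Arguments.
Unset Strict Implicit.
Unset Printing Implicit Defensive.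
Local Open Scope classical_set_scope.
Local Open Scope ring_scope.

(** * Partitions generated by a countable family of sets *)

(** The action alone does not make minimising sequences converge: its integrands are convex, but
    nothing makes them uniformly convex. The energy supplies the uniform convexity, the action only
    a bound on it. The energy level that is approached is the supremum over n of the infima over
    S_n, finite by coercivity.

    A state is a family of set functions indexed by t, and Radon-Nikodym densities are chosen for
    each t separately, so that nothing is known about them as functions of (t, y). Every dependence
    on t therefore goes through values on countably many cells: the action, the energy, the total
    variation and the integrals of test functions are suprema or limits of expressions in finitely
    many such values. For the same reason distances are time integrals of total variations and not
    norms of densities on a product space; the limit can then be built separately at almost every
    t. *)

Definition countably_generates {d} {T : measurableType d} (B : nat -> set T) :=
  (forall i, measurable (B i)) /\
  (forall A : set T, measurable A -> <<s range B >> A).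

Section cells.
Context {d} {T : measurableType d} {R : realType}.
Variable B : nat -> set T.
Hypothesis cgB : countably_generates B.

(** Preimages under [code n] form the finite algebra generated by the first n sets of the family;
    its atoms are the nonempty cells. Longer codes refine shorter ones. *)
Definition code n (y : T) : {ffun 'I_n -> bool} := [ffun i : 'I_n => `[< B i y >]].

Definition cell n (s : {ffun 'I_n -> bool}) : set T := [set y | code n y = s].

Lemma measurable_cell n (s : {ffun 'I_n -> bool}) : measurable (cell s).
Proof.
have [mB _] := cgB.
have -> : cell s = \bigcap_(i in [set: 'I_n]) (if s i then B i else ~` B i).
  apply/seteqP; split => y /=.
    move=> <- i _; rewrite ffunE; case: asboolP => //.
  move=> h; apply/ffunP => i; rewrite ffunE; have := h i I.
  by case: (s i) => ?; [exact/asboolP|exact/asboolPn].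
apply: fin_bigcap_measurable => // i _.
by case: (s i) => //; exact: measurableC.
Qed.

Lemma measurable_code n (W : set {ffun 'I_n -> bool}) :
  measurable (code n @^-1` W).
Proof.
have -> : code n @^-1` W = \bigcup_(s in W) cell s.
  apply/seteqP; split => y /=; first by move=> Wy; exists (code n y).
  by case=> s Ws ys; rewrite ys.
by apply: fin_bigcup_measurable => // s _; exact: measurable_cell.
Qed.

Lemma code_widen n m (W : set {ffun 'I_n -> bool}) : (n <= m)%N ->
  exists W' : set {ffun 'I_m -> bool}, code n @^-1` W = code m @^-1` W'.
Proof.
move=> nm; exists [set s | W [ffun i : 'I_n => s (widen_ord nm i)]].
apply/seteqP; split => y /=; congr (W _); apply/ffunP => i;
  by rewrite !ffunE.
Qed.

Lemma code_setI_closed :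
  setI_closed [set C | exists n (W : set {ffun 'I_n -> bool}), C = code n @^-1` W].
Proof.
move=> _ _ [n [W ->]] [m [V ->]].
have [W' ->] := code_widen W (leq_maxl n m).
have [V' ->] := code_widen V (leq_maxr n m).
by exists (maxn n m), (W' `&` V'); rewrite preimage_setI.
Qed.

(** Dynkin's theorem: the preimages under codes are stable under intersection and generate the
    sigma-algebra, and the sets that can be approximated by them form a lambda-system. *)
Lemma code_approx (k : {finite_measure set T -> \bar R}) A : measurable A ->
  forall e : R, 0 < e -> exists n (W : set {ffun 'I_n -> bool}),
    (k (A `+` code n @^-1` W) < e%:E)%E.
Proof.
have [mB gB] := cgB.
pose G := [set C | exists n (W : set {ffun 'I_n -> bool}), C = code n @^-1` W].
pose H := [set A | measurable A /\ forall e : R, 0 < e ->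
  exists n (W : set {ffun 'I_n -> bool}), (k (A `+` code n @^-1` W) < e%:E)%E].
have mY (X Y : set T) : measurable X -> measurable Y -> measurable (X `+` Y).
  by move=> mX mY; apply: measurableU; exact: measurableD.
have GH : G `<=` H.
  move=> _ [n [W ->]]; split; first exact: measurable_code.
  by move=> e e0; exists n, W; rewrite setYK measure0 lte_fin.
have fink X : measurable X -> k X \is a fin_num by exact: fin_num_measure.
suff lamH : lambda_system setT H.
  move=> mA; suff [] : H A by [].
  apply: (lambda_system_subset code_setI_closed lamH GH) => //.
  have /sub_sigma_algebra2 : range B `<=` G; last by apply; exact: gB.
  move=> _ [i _ <-].
  exists i.+1, [set s : {ffun 'I_i.+1 -> bool} | s ord_max].
  by apply/seteqP; split => y /=; rewrite ffunE => /asboolP.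
split => //.
- by apply: GH; exists 0%N, setT; rewrite preimage_setT.
- move=> X Y YX [mX hX] [mY' hY]; split; first exact: measurableD.
  move=> e e0; have e20 : 0 < e / 2 by rewrite divr_gt0.
  have [n [W hW]] := hX _ e20; have [m [V hV]] := hY _ e20.
  have [W' EW] := code_widen W (leq_maxl n m).
  have [V' EV] := code_widen V (leq_maxr n m).
  rewrite EW in hW; rewrite EV in hV.
  exists (maxn n m), (W' `\` V').
  rewrite (_ : code (maxn n m) @^-1` _ =
    code (maxn n m) @^-1` W' `\` code (maxn n m) @^-1` V')//.
  have mW := measurable_code W'; have mV := measurable_code V'.
  apply: (@le_lt_trans _ _ (k ((X `+` code (maxn n m) @^-1` W') `|`
      (Y `+` code (maxn n m) @^-1` V')))%E).
    apply: le_measure; rewrite ?inE.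
    + by apply: mY; exact: measurableD.
    + by apply: measurableU; exact: mY.
    + rewrite /setY => y /= [[[h1 h2] h3]|[[h1 h2] h3]].
      * have [?|?] := pselect (V' (code (maxn n m) y)); last first.
          by left; left; split=> // ?; apply: h3.
        by right; right.
      * have [?|?] := pselect (X y); last by left; right.
        have [?|?] := pselect (Y y); first by right; left.
        by exfalso; apply: h3.
  apply: (@le_lt_trans _ _ (k (X `+` code (maxn n m) @^-1` W') +
      k (Y `+` code (maxn n m) @^-1` V'))%E).
    by apply: measureU2; exact: mY.
  by rewrite [e in (_ < e%:E)%E](splitr e) EFinD; exact: lteD.
(* For an increasing union, continuity from below reduces to a single [F n], at the cost of half of
   the error. *)
- move=> F ndF hF; have mF i : measurable (F i) by have [] := hF i.
  have mUF : measurable (\bigcup_i F i) by exact: bigcupT_measurable.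
  split => // e e0; have e20 : 0 < e / 2 by rewrite divr_gt0.
  have := nondecreasing_cvg_mu mF mUF ndF (mu := k).
  rewrite -[X in _ --> X](fineK (fink _ mUF)) => /fine_cvgP[_].
  move=> /cvgrPdist_lt /(_ _ e20) [n _ /(_ n (leqnn n))] /= hn.
  have [_ /(_ _ e20) [m [W hW]]] := hF n.
  exists m, W.
  have FU : F n `<=` \bigcup_i F i by exact: bigcup_sup.
  have mW := measurable_code W.
  apply: (@le_lt_trans _ _ (k ((\bigcup_i F i `\` F n) `|`
      (F n `+` code m @^-1` W)))%E).
    apply: le_measure; rewrite ?inE.
    + exact: mY.
    + by apply: measurableU; [exact: measurableD|exact: mY].
    + move=> y [[h1 h2]|[h1 h2]].
        by have [?|?] := pselect (F n y); [right; left|left].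
      by right; right; split => // ?; apply: h2; exact: FU.
  apply: (@le_lt_trans _ _ (k (\bigcup_i F i `\` F n) +
      k (F n `+` code m @^-1` W))%E).
    by apply: measureU2; [exact: measurableD|exact: mY].
  rewrite [e in (_ < e%:E)%E](splitr e) EFinD; apply: lteD => //.
  rewrite measureD//; last by rewrite ltey_eq fink.
  have := le_lt_trans (ler_norm _) hn.
  by rewrite setIidr// -lte_fin EFinB !fineK// fink.
Qed.

End cells.

(** * Charges *)

Section charges.
Context {d} {T : measurableType d} {R : realType}.
Implicit Types (nu : {charge set T -> \bar R}) (C : R).

(** The variation measure |nu|, under a name of its own so that it can carry the structure of a
    finite measure. *)
Definition cvar nu : set T -> \bar R := charge_variation (svalP (hahn nu)).

HB.instance Definition _ nu := Measure.on (cvar nu).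

Let cvar_fin nu : fin_num_fun (cvar nu).
Proof. by move=> A mA; rewrite /cvar fin_numD !fin_num_measure. Qed.

HB.instance Definition _ nu := Measure_isFinite.Build _ _ _ (cvar nu) (@cvar_fin nu).

Lemma total_variationE nu : Defs.total_variation nu = cvar nu setT.
Proof. by []. Qed.

Definition cpos nu : {finite_measure set T -> \bar R} := charge_pos nu.
Definition cneg nu : {finite_measure set T -> \bar R} := charge_neg nu.

Lemma charge_jordan nu A : measurable A -> nu A = (cpos nu A - cneg nu A)%E.
Proof.
move=> mA; rewrite (jordan_decomp (svalP (hahn nu)) mA).
by have := cscaleN1 (cneg nu) => /(congr1 (fun f => f A)) <-.
Qed.

Lemma cpos_lty nu : (cpos nu setT < +oo)%E.
Proof. by rewrite ltey_eq fin_num_measure. Qed.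

Lemma cneg_lty nu : (cneg nu setT < +oo)%E.
Proof. by rewrite ltey_eq fin_num_measure. Qed.

Lemma cintE nu D (g : T -> R) : charge_integral nu D g =
  \int[cpos nu]_(y in D) g y - \int[cneg nu]_(y in D) g y.
Proof. by []. Qed.

Lemma abse_le_cvar nu A : measurable A -> (`|nu A| <= cvar nu A)%E.
Proof. exact: abse_charge_variation. Qed.

Lemma cvarE nu A : measurable A ->
  cvar nu A = (cpos nu A + cneg nu A)%E.
Proof. by []. Qed.

Arguments cpos : simpl never.
Arguments cneg : simpl never.
Arguments cvar : simpl never.

Lemma cvar_hahn nu : exists P N, [/\ measurable P, measurable N, P `|` N = setT,
  P `&` N = set0 & forall A, measurable A ->
   cvar nu A = (nu (A `&` P) - nu (A `&` N))%E].
Proof.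
rewrite /cvar; case: (hahn nu) => -[P N] /= h; exists P, N.
have [[mP _] [mN _] PN PN0] := h; split => // A mA.
rewrite /charge_variation jordan_posE cjordan_posE jordan_negE cjordan_negE.
by rewrite /crestr0 mem_set.
Qed.

(** Minimality of |nu|: on the two halves of a Hahn decomposition it is nu and -nu, and k is
    additive over these halves. *)
Lemma cvar_le nu (k : {measure set T -> \bar R}) :
  (forall A, measurable A -> (`|nu A| <= k A)%E) ->
  forall A, measurable A -> (cvar nu A <= k A)%E.
Proof.
move=> h A mA; have [P [N [mP mN PN PN0 ->]]] := cvar_hahn nu => //.
have -> : k A = (k (A `&` P) + k (A `&` N))%E.
  rewrite -measureU//; [|exact: measurableI|exact: measurableI|].
    by rewrite -setIUr PN setIT.
  by rewrite setIACA PN0 setI0.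
have h1 := h _ (measurableI _ _ mA mP); have h2 := h _ (measurableI _ _ mA mN).
apply: leeD; first exact: le_trans (lee_abs _) h1.
by apply: le_trans h2; rewrite -abseN lee_abs.
Qed.

Lemma integrable_bounded (k : {measure set T -> \bar R}) D (g : T -> R) C :
  (k setT < +oo)%E -> measurable D -> measurable_fun D g ->
  (forall y, D y -> `|g y| <= C) -> k.-integrable D (EFin \o g).
Proof.
move=> kf mD mg gC; apply: measurable_bounded_integrable => //.
  by apply: le_lt_trans kf; apply: le_measure; rewrite ?inE.
by exists C; split; [exact: num_real|move=> M CM x Dx; exact: le_trans (gC _ Dx) (ltW CM)].
Qed.

Lemma Rintegral_measure_add (a b : {measure set T -> \bar R}) D (g : T -> R) :
  measurable D -> a.-integrable D (EFin \o g) -> b.-integrable D (EFin \o g) ->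
  \int[measure_add a b]_(y in D) g y =
  \int[a]_(y in D) g y + \int[b]_(y in D) g y.
Proof.
move=> mD ia ib; rewrite /Rintegral -fineD ?integrable_fin_num//.
by rewrite -(integral_measure_add mD ia ib).
Qed.

Lemma Rintegral_mscale (a : {measure set T -> \bar R}) (r : {nonneg R}) D
    (g : T -> R) : measurable D -> a.-integrable D (EFin \o g) ->
  \int[mscale r a]_(y in D) g y = r%:num * \int[a]_(y in D) g y.
Proof.
move=> mD ia; have mg := measurable_int _ ia.
rewrite /Rintegral -[X in X * _]/(fine r%:num%:E) -fineM// ?integrable_fin_num//.
rewrite integralE ge0_integral_mscale//; last exact: measurable_funepos.
rewrite ge0_integral_mscale//; last exact: measurable_funeneg.
have E := integralE a D (fun y => (g y)%:E).
rewrite E [in RHS]muleBr//.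
exact: (@integrable_add_def _ _ _ a D mD (EFin \o g)).
Qed.

(** Any decomposition a - b may replace the Jordan one, because [cpos nu] + b and a + [cneg nu] are
    the same measure. Linearity in nu rests on this, since sums of Jordan decompositions are in
    general not Jordan. *)
Lemma cint_decomp nu (a b : {measure set T -> \bar R}) D (g : T -> R) C :
  (a setT < +oo)%E -> (b setT < +oo)%E ->
  (forall A, measurable A -> nu A = a A - b A)%E ->
  measurable D -> measurable_fun D g -> (forall y, D y -> `|g y| <= C) ->
  charge_integral nu D g = \int[a]_(y in D) g y - \int[b]_(y in D) g y.
Proof.
move=> af bf nuE mD mg gC; rewrite cintE.
have pf := cpos_lty nu; have nf := cneg_lty nu.
have ia := integrable_bounded af mD mg gC; have ib := integrable_bounded bf mD mg gC.
have ip := integrable_bounded pf mD mg gC; have inn := integrable_bounded nf mD mg gC.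
have fa A : measurable A -> a A \is a fin_num.
  by move=> mA; rewrite ge0_fin_numE// (le_lt_trans _ af)// le_measure ?inE.
have fb A : measurable A -> b A \is a fin_num.
  by move=> mA; rewrite ge0_fin_numE// (le_lt_trans _ bf)// le_measure ?inE.
have E : (\int[measure_add (cpos nu) b]_(y in D) (EFin \o g) y =
    \int[measure_add a (cneg nu)]_(y in D) (EFin \o g) y)%E.
  apply: eq_measure_integral => A mA _.
  change (measure_add (cpos nu) b A = measure_add a (cneg nu) A).
  rewrite !measure_addE.
  have swap (p n u v : \bar R) : p \is a fin_num -> n \is a fin_num ->
      u \is a fin_num -> v \is a fin_num -> (u - v = p - n -> p + v = u + n)%E.
    move: p n u v => [p| |] [n| |] [u| |] [v| |]//.
    move=> _ _ _ _ /eqP; rewrite -!EFinB eqe => /eqP pn.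
    by rewrite -!EFinD; congr (_%:E); lra.
  by apply: swap; rewrite ?fin_num_measure ?fa ?fb// -nuE// charge_jordan.
have /(congr1 fine) := E; rewrite -!/(Rintegral _ _ _).
by rewrite !Rintegral_measure_add//; lra.
Qed.

Definition clin (r s : R) nu nu' : {charge set T -> \bar R} :=
  cadd (cscale r nu) (cscale s nu').

Lemma clinE r s nu nu' A : clin r s nu nu' A = (r%:E * nu A + s%:E * nu' A)%E.
Proof. by []. Qed.

Lemma cintD nu nu' D (g : T -> R) C :
  measurable D -> measurable_fun D g -> (forall y, D y -> `|g y| <= C) ->
  charge_integral (cadd nu nu') D g =
  charge_integral nu D g + charge_integral nu' D g.
Proof.
move=> mD mg gC.
have pf (n : {charge set T -> \bar R}) : (cpos n setT < +oo)%E by exact: cpos_lty.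
have nf (n : {charge set T -> \bar R}) : (cneg n setT < +oo)%E by exact: cneg_lty.
have ip n := integrable_bounded (pf n) mD mg gC.
have inn n := integrable_bounded (nf n) mD mg gC.
rewrite (@cint_decomp _ (measure_add (cpos nu) (cpos nu'))
  (measure_add (cneg nu) (cneg nu')) D g C) //.
- by rewrite !Rintegral_measure_add// !cintE; ring.
- by have := lte_add_pinfty (pf nu) (pf nu'); rewrite -measure_addE.
- by have := lte_add_pinfty (nf nu) (nf nu'); rewrite -measure_addE.
- move=> A mA.
  transitivity ((cpos nu A + cpos nu' A) - (cneg nu A + cneg nu' A))%E;
    last by rewrite -!measure_addE.
  transitivity ((cpos nu A - cneg nu A) + (cpos nu' A - cneg nu' A))%E.
    by rewrite -!charge_jordan.
  rewrite fin_num_oppeD ?fin_num_measure//.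
  by rewrite addeACA.
Qed.

Lemma cintZ_ge0 nu (r : R) D (g : T -> R) C : 0 <= r ->
  measurable D -> measurable_fun D g -> (forall y, D y -> `|g y| <= C) ->
  charge_integral (cscale r nu) D g = r * charge_integral nu D g /\
  charge_integral (cscale (- r) nu) D g = - r * charge_integral nu D g.
Proof.
move=> r0 mD mg gC.
have pf (n : {charge set T -> \bar R}) : (cpos n setT < +oo)%E by exact: cpos_lty.
have nf (n : {charge set T -> \bar R}) : (cneg n setT < +oo)%E by exact: cneg_lty.
have ip n := integrable_bounded (pf n) mD mg gC.
have inn n := integrable_bounded (nf n) mD mg gC.
pose p := mscale (NngNum r0) (cpos nu).
pose n := mscale (NngNum r0) (cneg nu).
have pT : (p setT < +oo)%E by rewrite /p /mscale /= lte_mul_pinfty ?ltey_eq ?fin_num_measure.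
have nT : (n setT < +oo)%E by rewrite /n /mscale /= lte_mul_pinfty ?ltey_eq ?fin_num_measure.
have Ip : \int[p]_(y in D) g y = r * \int[cpos nu]_(y in D) g y.
  exact: (Rintegral_mscale (NngNum r0) mD (ip nu)).
have In : \int[n]_(y in D) g y = r * \int[cneg nu]_(y in D) g y.
  exact: (Rintegral_mscale (NngNum r0) mD (inn nu)).
split.
- rewrite (@cint_decomp _ p n D g C) //; first by rewrite Ip In !cintE; ring.
  move=> A mA.
  transitivity (r%:E * (cpos nu A - cneg nu A))%E.
    by rewrite -charge_jordan.
  rewrite muleBr//.
  by rewrite fin_num_adde_defl// fin_numN fin_num_measure.
(* A negative factor exchanges the two measures of the decomposition. *)
- rewrite (@cint_decomp _ n p D g C) //; first by rewrite Ip In !cintE; ring.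
  move=> A mA.
  transitivity ((- r)%:E * (cpos nu A - cneg nu A))%E.
    by rewrite -charge_jordan.
  rewrite EFinN mulNe muleBr//; last first.
    by rewrite fin_num_adde_defl// fin_numN fin_num_measure.
  rewrite fin_num_oppeB// ?fin_numM ?fin_num_measure// addeC.
  by [].
Qed.

Lemma cint_lin r s nu nu' D (g : T -> R) C :
  measurable D -> measurable_fun D g -> (forall y, D y -> `|g y| <= C) ->
  charge_integral (clin r s nu nu') D g =
  r * charge_integral nu D g + s * charge_integral nu' D g.
Proof.
move=> mD mg gC; rewrite (cintD _ _ mD mg gC).
have Z q n : charge_integral (cscale q n) D g = q * charge_integral n D g.
  have [q0|q0] := leP 0 q; first by have [] := cintZ_ge0 n q0 mD mg gC.
  have q0' : 0 <= - q by rewrite oppr_ge0 ltW.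
  by have [_] := cintZ_ge0 n q0' mD mg gC; rewrite opprK.
by rewrite !Z.
Qed.

Lemma cint_le nu D (g : T -> R) C :
  measurable D -> measurable_fun D g -> (forall y, D y -> `|g y| <= C) -> 0 <= C ->
  `|charge_integral nu D g| <= C * fine (Defs.total_variation nu).
Proof.
move=> mD mg gC C0; rewrite total_variationE cvarE//.
have H (k : {finite_measure set T -> \bar R}) :
    `|\int[k]_(y in D) g y| <= C * fine (k setT).
  have kf : (k setT < +oo)%E by rewrite ltey_eq fin_num_measure.
  have ik := integrable_bounded kf mD mg gC.
  apply: le_trans (le_normr_Rintegral mD ik) _.
  apply: (@le_trans _ _ (\int[k]_(y in D) C)).
    apply: le_Rintegral => //; first exact: integrable_norm.
    exact: finite_measure_integrable_cst.
  rewrite Rintegral_cst// ler_wpM2l// fine_le ?fin_num_measure//.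
  by apply: le_measure; rewrite ?inE.
rewrite cintE fineD ?fin_num_measure// mulrDr.
by apply: le_trans (ler_normB _ _) _; apply: lerD; exact: H.
Qed.

End charges.

(** * Total variation as a supremum over the generated partitions *)

Section cell_sums.
Context {d} {T : measurableType d} {R : realType}.
Implicit Types nu : {charge set T -> \bar R}.

Lemma charge_bigsetU (I : choiceType) nu (s : seq I) (F : I -> set T) :
  uniq s -> (forall i, measurable (F i)) -> trivIset setT F ->
  nu (\big[setU/set0]_(i <- s) F i) = (\sum_(i <- s) nu (F i))%E.
Proof.
move=> + mF tF; elim: s => [|i s ih]; first by rewrite !big_nil charge0.
rewrite cons_uniq => /andP[si us]; rewrite !big_cons chargeU ?ih//.
  by apply: bigsetU_measurable => *; exact: mF.
rewrite -bigcup_seq; apply/seteqP; split => // y [Fi [j /= js Fj]].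
suff ij : i = j by rewrite ij js in si.
by apply: tF => //; exists y.
Qed.

Variable B : nat -> set T.
Hypothesis cgB : countably_generates B.

Lemma cell_sum nu n A : measurable A ->
  nu A = (\sum_(s : {ffun 'I_n -> bool}) nu (A `&` cell B s))%E.
Proof.
move=> mA.
rewrite -charge_bigsetU//.
- congr (nu _); rewrite -bigcup_seq; apply/seteqP; split => y /=.
    by move=> Ay; exists (code B n y) => //=; rewrite mem_index_enum.
  by case=> s _ [].
- exact: index_enum_uniq.
- by move=> s; apply: measurableI => //; exact: measurable_cell.
- by move=> s t _ _ [y [[_ ys] [_ yt]]]; rewrite -ys -yt.
Qed.

Lemma measure_cell_sum (k : {finite_measure set T -> \bar R}) n A :
  measurable A ->
  k A = (\sum_(s : {ffun 'I_n -> bool}) k (A `&` cell B s))%E.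
Proof. exact: (cell_sum (charge_of_finite_measure k)). Qed.

(** For the nontrivial inequality, the positive Hahn set P is approximated by a union V of cells, up
    to a set of small variation; then nu V - nu (T \ V) almost attains the total variation. *)
Lemma total_variation_sup nu : Defs.total_variation nu =
  ereal_sup (range (fun n =>
    (\sum_(s : {ffun 'I_n -> bool}) `|nu (cell B s)|)%E)).
Proof.
rewrite total_variationE; apply/eqP; rewrite eq_le; apply/andP; split; last first.
  apply: ge_ereal_sup => _ [n _ <-].
  rewrite (measure_cell_sum _ n)//; apply: lee_sum => s _; rewrite setTI.
  by apply: abse_le_cvar; exact: measurable_cell.
apply/lee_addgt0Pr => e e0.
have [P [N [mP mN PN PN0 H]]] := cvar_hahn nu.
(* Half of e, because the error nu (P \ V) - nu (V \ P) enters twice: once through V and once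
   through its complement. *)
have e20 : 0 < e / 2 by rewrite divr_gt0.
have [n [W hW]] := code_approx cgB (cvar nu) mP e20.
set V := code B n @^-1` W in hW.
have mV : measurable V by exact: measurable_code.
apply: (@le_trans _ _ ((`|nu V| + `|nu (~` V)|) + e%:E)%E); last first.
  rewrite leeD2r//; apply: (@le_trans _ _
    (\sum_(s : {ffun 'I_n -> bool}) `|nu (cell B s)|)%E); last first.
    by apply: ereal_sup_ubound; exists n.
  have hc (A : set T) : measurable A -> (`|nu A| <=
      \sum_(s : {ffun 'I_n -> bool}) `|nu (A `&` cell B s)|)%E.
    by move=> mA; rewrite (cell_sum _ n mA); exact: lee_abs_sum.
  apply: le_trans (leeD (hc _ mV) (hc _ (measurableC mV))) _.
  rewrite -big_split/=; apply: lee_sum => s _.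
  have [Ws|Ws] := pselect (W s).
    have -> : V `&` cell B s = cell B s.
      by apply/seteqP; split => y //=; [case|move=> ys; split => //; rewrite /V/= ys].
    have -> : ~` V `&` cell B s = set0.
      by apply/seteqP; split => y //= [+ ys]; rewrite /V/= ys.
    by rewrite charge0 abse0 adde0.
  have -> : V `&` cell B s = set0.
    by apply/seteqP; split => y //= [+ ys]; rewrite /V/= ys.
  have -> : ~` V `&` cell B s = cell B s.
    by apply/seteqP; split => y //=; [case|move=> ys; split => //; rewrite /V/= ys].
  by rewrite charge0 abse0 add0e.
have NP : N = ~` P.
  apply/seteqP; split => y; first by move=> Ny Py; suff : set0 y by []; rewrite -PN0.
  by have : setT y by []; rewrite -PN => -[].
have fc (A : set T) : measurable A -> nu A \is a fin_num by move=> mA; exact: fin_num_measure.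
have hV : (nu (P `\` V) - nu (V `\` P) <= (e / 2)%:E)%E.
  apply: le_trans (ltW hW).
  rewrite (measureU (cvar nu)) ?setDD_eq0//; [|exact: measurableD|exact: measurableD|].
    apply: leeD.
      by apply: le_trans (lee_abs _) _; apply: abse_le_cvar; exact: measurableD.
    by apply: le_trans (lee_abs _) _; rewrite abseN; apply: abse_le_cvar; exact: measurableD.
  by apply/seteqP; split => y //= [[? ?] [? ?]].
rewrite H// !setTI.
have E1 : nu P = (nu (P `&` V) + nu (P `\` V))%E.
  by rewrite (chargeDI nu mP mV) addeC.
have E2 : nu V = (nu (P `&` V) + nu (V `\` P))%E.
  by rewrite (chargeDI nu mV mP) addeC setIC.
have E3 : nu N = (nu (~` V) + nu (V `\` P) - nu (P `\` V))%E.
  rewrite (chargeDI nu mN mV) NP.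
  have -> : ~` P `&` V = V `\` P by rewrite setIC.
  have -> : nu (~` V) = (nu (~` P `\` V) + nu (P `\` V))%E.
    rewrite (chargeDI nu (measurableC mV) mP) addeC setIC [X in (_ = X)%E]addeC.
    congr (nu _ + nu _)%E; apply/seteqP; split => y /= [? ?] //.
  rewrite -!addeA; congr (_ + _)%E.
  by rewrite addeCA subee ?adde0// fc//; exact: measurableD.
have h1 := hV.
have h2 := lee_abs (nu V).
have h3 : (- nu (~` V) <= `|nu (~` V)|)%E by rewrite -abseN lee_abs.
have f1 : nu (P `&` V) \is a fin_num by apply: fc; exact: measurableI.
have f2 : nu (P `\` V) \is a fin_num by apply: fc; exact: measurableD.
have f3 : nu (V `\` P) \is a fin_num by apply: fc; exact: measurableD.
move: E1 E2 E3 h1 h2 h3.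
move: (fc _ mP) (fc _ mV) (fc _ mN) (fc _ (measurableC mV)) f1 f2 f3.
move: (nu P) (nu V) (nu N) (nu (~` V)) (nu (P `&` V)) (nu (P `\` V)) (nu (V `\` P)).
move=> p v n' c x y z; case: p => [p| |]// _; case: v => [v| |]// _.
case: n' => [n'| |]// _; case: c => [c| |]// _; case: x => [x| |]// _.
case: y => [y| |]// _; case: z => [z| |]// _.
rewrite /= -!(EFinD, EFinB, EFinN) => -[pE] [vE] [nE].
by rewrite !lee_fin => h1 h2 h3; lra.
Qed.

End cell_sums.

Section finite_measure_charge.
Context {d} {T : measurableType d} {R : realType}.
Variable k : {measure set T -> \bar R}.
Hypothesis kT : (k setT < +oo)%E.

(** Here finiteness is a hypothesis and not a structure, as for the series [mseries] below, whose
    mass is only bounded in the course of a proof. *)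
Definition finite_charge : set T -> \bar R := k.

Let fin A : measurable A -> finite_charge A \is a fin_num.
Proof.
move=> mA; rewrite /finite_charge ge0_fin_numE//.
by apply: le_lt_trans kT; apply: le_measure; rewrite ?inE.
Qed.

HB.instance Definition _ := isCharge.Build _ _ _ finite_charge
  (measure0 k) fin (@measure_semi_sigma_additive _ _ _ k).

Lemma finite_measure_charge :
  exists nu : {charge set T -> \bar R}, forall A, nu A = k A.
Proof. by exists (finite_charge : {charge set T -> \bar R}). Qed.

End finite_measure_charge.

Section charge_series.
Context {d} {T : measurableType d} {R : realType}.
Variable nu : nat -> {charge set T -> \bar R}.
Let delta k := clin 1 (-1) (nu k.+1) (nu k).

(** Completeness for the total variation norm. The positive and the negative parts of the increments
    are summed separately into two finite measures p and n, and the limit is [nu 0] + p - n. The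
    bound is stated set by set because its right-hand side is a measure, which [cvar_le] turns into
    a bound on the variation. *)
Lemma charge_series_limit :
  (\sum_(k <oo) Defs.total_variation (delta k) < +oo)%E ->
  exists nu' : {charge set T -> \bar R}, forall k A, measurable A ->
    (`|clin 1 (-1) nu' (nu k) A| <= \sum_(k <= j <oo) cvar (delta j) A)%E.
Proof.
move=> sf.
pose p := mseries (fun j => cpos (delta j)) 0.
pose n := mseries (fun j => cneg (delta j)) 0.
have pT : (p setT < +oo)%E.
  apply: le_lt_trans sf; apply: lee_nneseries => j _ //.
  by rewrite total_variationE cvarE// leeDl.
have nT : (n setT < +oo)%E.
  apply: le_lt_trans sf; apply: lee_nneseries => j _ //.
  by rewrite total_variationE cvarE// leeDr.
have [pc pE] := finite_measure_charge pT; have [nc nE] := finite_measure_charge nT.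
have {}pE X : pc X = p X by exact: pE.
have {}nE X : nc X = n X by exact: nE.
exists (cadd (nu 0) (clin 1 (-1) pc nc)) => k A mA.
have E : nu k A = (nu 0 A + (\sum_(0 <= j < k) cpos (delta j) A
    - \sum_(0 <= j < k) cneg (delta j) A))%E.
  elim: k => [|k ih]; first by rewrite !big_nil subee// !adde0.
  have : delta k A = (cpos (delta k) A - cneg (delta k) A)%E by exact: charge_jordan.
  rewrite clinE mul1e EFinN mulN1e ih.
  have f1 : (\sum_(0 <= j < k) cpos (delta j) A)%E \is a fin_num.
    by rewrite sum_fin_num; apply/allP => _ /mapP[j _ ->]; exact: fin_num_measure.
  have f2 : (\sum_(0 <= j < k) cneg (delta j) A)%E \is a fin_num.
    by rewrite sum_fin_num; apply/allP => _ /mapP[j _ ->]; exact: fin_num_measure.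
  rewrite !big_nat_recr//.
  have : nu 0 A \is a fin_num by exact: fin_num_measure.
  have : nu k.+1 A \is a fin_num by exact: fin_num_measure.
  have : cpos (delta k) A \is a fin_num by exact: fin_num_measure.
  have : cneg (delta k) A \is a fin_num by exact: fin_num_measure.
  move: f1 f2.
  move: (cneg (delta k) A) (cpos (delta k) A) (nu k.+1 A) (nu 0 A).
  move: (\sum_(0 <= j < k) cpos (delta j) A)%E (\sum_(0 <= j < k) cneg (delta j) A)%E.
  move=> a b c f g h; case: a => [a| |]// _; case: b => [b| |]// _.
  case: c => [c| |]// _; case: f => [f| |]// _; case: g => [g| |]// _.
  case: h => [h| |]// _.
  rewrite -!(EFinD, EFinB) => -[H]; congr EFin; lra.
have Ep : p A = (\sum_(0 <= j < k) cpos (delta j) A +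
    \sum_(k <= j <oo) cpos (delta j) A)%E.
  by rewrite /p /mseries (nneseries_split _ k)//.
have En : n A = (\sum_(0 <= j < k) cneg (delta j) A +
    \sum_(k <= j <oo) cneg (delta j) A)%E.
  by rewrite /n /mseries (nneseries_split _ k)//.
have -> : (\sum_(k <= j <oo) cvar (delta j) A)%E =
   (\sum_(k <= j <oo) cpos (delta j) A + \sum_(k <= j <oo) cneg (delta j) A)%E.
  by rewrite -nneseriesD.
have fp : p A \is a fin_num by rewrite -pE fin_num_measure.
have fn : n A \is a fin_num by rewrite -nE fin_num_measure.
have f0 : nu 0 A \is a fin_num by exact: fin_num_measure.
have p0 : (0 <= \sum_(k <= j <oo) cpos (delta j) A)%E by exact: nneseries_ge0.
have n0 : (0 <= \sum_(k <= j <oo) cneg (delta j) A)%E by exact: nneseries_ge0.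
have -> : clin 1 (-1) (cadd (nu 0) (clin 1 (-1) pc nc)) (nu k) A =
   ((nu 0 A + (p A - n A)) - nu k A)%E.
  rewrite clinE !mul1e EFinN !mulN1e; congr (_ - _)%E.
  transitivity (nu 0 A + clin 1 (-1) pc nc A)%E => //.
  by rewrite clinE !mul1e EFinN !mulN1e pE nE.
have fk : nu k A \is a fin_num by exact: fin_num_measure.
have f1 : (\sum_(0 <= j < k) cpos (delta j) A)%E \is a fin_num.
  by rewrite sum_fin_num; apply/allP => _ /mapP[j _ ->]; exact: fin_num_measure.
have f2 : (\sum_(0 <= j < k) cneg (delta j) A)%E \is a fin_num.
  by rewrite sum_fin_num; apply/allP => _ /mapP[j _ ->]; exact: fin_num_measure.
move: E Ep En p0 n0; move: fk f0 fp fn f1 f2.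
move: (nu k A) (nu 0 A) (p A) (n A).
move: (\sum_(0 <= j < k) cpos (delta j) A)%E (\sum_(0 <= j < k) cneg (delta j) A)%E.
move: (\sum_(k <= j <oo) cpos (delta j) A)%E (\sum_(k <= j <oo) cneg (delta j) A)%E.
move=> a b c f g h i l; case: g => [g| |]// _; case: h => [h| |]// _.
case: i => [i| |]// _; case: l => [l| |]// _; case: c => [c| |]// _.
case: f => [f| |]// _; case: a => [a| |]//; case: b => [b| |]//.
rewrite -!(EFinD, EFinB) => -[E1] [E2] [E3].
rewrite !lee_fin => a0 b0; rewrite E1 E2 E3.
have -> : h + (c + a - (f + b)) - (h + (c - f)) = a - b by lra.
by rewrite (le_trans (ler_normB _ _))// !ger0_norm.
Qed.

End charge_series.

Section cint_pushforward.
Context {d1 d2} {T1 : measurableType d1} {T2 : measurableType d2} {R : realType}.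

(** The images of the two Jordan parts decompose the image charge, but need not be its Jordan parts;
    hence the appeal to [cint_decomp]. *)
Lemma cint_pushforward (f : {mfun T1 >-> T2}) (mf : measurable_fun setT f)
    (nu : {charge set T1 -> \bar R}) D (g : T2 -> R) (C : R) :
  measurable D -> measurable_fun setT g -> (forall y, D y -> `|g y| <= C) ->
  charge_integral (measure_function_pushforward__canonical__charge_Charge nu mf) D g =
  charge_integral nu (f @^-1` D) (g \o f).
Proof.
move=> mD mg gC.
have mfD : measurable (f @^-1` D) by rewrite -[X in measurable X]setTI; exact: mf.
have ib (k : {finite_measure set T1 -> \bar R}) :
    k.-integrable (f @^-1` D) (EFin \o (g \o f)).
  apply: (@integrable_bounded _ _ _ _ _ _ C) => //.
  - by rewrite ltey_eq fin_num_measure.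
  - by apply: measurable_funTS; exact: measurableT_comp.
  - by move=> y; exact: gC.
rewrite (@cint_decomp _ _ _ _ (pushforward (cpos nu) f) (pushforward (cneg nu) f) D g C) //.
- have E (k : {finite_measure set T1 -> \bar R}) :
      \int[pushforward k f]_(y in D) g y = \int[k]_(y in f @^-1` D) g (f y).
    rewrite /Rintegral; congr fine.
    apply: (@integral_pushforward _ _ _ _ _ _ _ _ _ (EFin \o g)) => //.
    + exact/measurable_EFinP.
    + exact: ib.
  by rewrite !E.
- exact: (cpos_lty nu).
- exact: (cneg_lty nu).
- move=> A mA; apply: (@charge_jordan _ _ _ nu (f @^-1` A)).
  by rewrite -[X in measurable X]setTI; exact: mf.
- exact: measurable_funTS.
Qed.

End cint_pushforward.

(** * Convex integrands of densities *)

Section cell_averages.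
Context {d} {T : measurableType d} {R : realType}.
Variable B : nat -> set T.
Hypothesis cgB : countably_generates B.

Lemma measurable_code_fun {d'} {T' : measurableType d'} n
    (h : {ffun 'I_n -> bool} -> T') : measurable_fun setT (h \o code B n).
Proof. by move=> _ Y mY; rewrite setTI; exact: (measurable_code cgB (h @^-1` Y)). Qed.

Lemma ge0_integral_cells (k : {measure set T -> \bar R}) n (H : T -> \bar R) :
  measurable_fun setT H -> (forall y, (0 <= H y)%E) ->
  (\int[k]_y H y =
   \sum_(s : {ffun 'I_n -> bool}) \int[k]_(y in cell B s) H y)%E.
Proof.
move=> mH H0.
have E : [set: T] = \big[setU/set0]_(s : {ffun 'I_n -> bool}) cell B s.
  rewrite -bigcup_seq; apply/seteqP; split => y //= _.
  by exists (code B n y) => //=; rewrite mem_index_enum.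
rewrite E ge0_integral_bigsetU//.
- by move=> s; exact: measurable_cell.
- exact: index_enum_uniq.
- by move=> s t _ _ [y [<- <-]].
- exact: measurable_funTS.
Qed.

Lemma integral_cell_cst (k : {measure set T -> \bar R}) n
    (s : {ffun 'I_n -> bool}) (h : {ffun 'I_n -> bool} -> \bar R) :
  (\int[k]_(y in cell B s) h (code B n y) = h s * k (cell B s))%E.
Proof.
rewrite -integral_cst; last exact: measurable_cell.
by apply: eq_integral => y; rewrite inE => /= ->.
Qed.

Variable l : {finite_measure set T -> \bar R}.
Implicit Types f g : T -> R.

(** The conditional expectation of f given the n-th partition. On cells of mass zero the quotient is
    0 by convention. *)
Definition cell_avg f n y : R :=
  (\int[l]_(z in cell B (code B n y)) f z) / fine (l (cell B (code B n y))).

Lemma measurable_cell_avg f n : measurable_fun setT (cell_avg f n).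
Proof.
exact: (@measurable_code_fun _ _ n (fun s : {ffun 'I_n -> bool} =>
  (\int[l]_(z in cell B s) f z) / fine (l (cell B s)))).
Qed.

Local Notation L1 f := (l.-integrable setT (EFin \o f)).

Lemma measurable_normE (u : T -> R) : measurable_fun setT u ->
  measurable_fun setT (fun y => `|u y|%:E).
Proof. by move=> mu; apply/measurable_EFinP; exact: measurableT_comp. Qed.

Lemma integrable_lin D f g c : measurable D -> l.-integrable D (EFin \o f) ->
  l.-integrable D (EFin \o g) ->
  l.-integrable D (EFin \o (fun y => f y + c * g y)).
Proof.
move=> mD lf lg.
rewrite (_ : EFin \o _ = (EFin \o f) \+ (fun y => c%:E * (EFin \o g) y))%E.
  by apply: integrableD => //; exact: integrableZl.
by apply/funext.
Qed.

Lemma integrable_cell f n (s : {ffun 'I_n -> bool}) :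
  L1 f -> l.-integrable (cell B s) (EFin \o f).
Proof. by apply: integrableS => //; exact: measurable_cell. Qed.

Lemma cell_avgD f g c n y : L1 f -> L1 g ->
  cell_avg (fun z => f z + c * g z) n y = cell_avg f n y + c * cell_avg g n y.
Proof.
move=> lf lg; rewrite /cell_avg.
have mc := measurable_cell cgB (code B n y).
rewrite RintegralD//; [|exact: integrable_cell|]; last first.
  rewrite (_ : EFin \o _ = (fun y => c%:E * (EFin \o g) y))%E; last exact/funext.
  by apply: integrableZl => //; exact: integrable_cell.
rewrite RintegralZl//; last exact: integrable_cell.
by rewrite mulrDl mulrA.
Qed.

(** On each cell, the norm of an integral is at most the integral of the norm; null cells contribute
    0. *)
Lemma cell_avg_contr f n : L1 f ->
  (\int[l]_y `|cell_avg f n y|%:E <= \int[l]_y `|f y|%:E)%E.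
Proof.
move=> lf.
have mf : measurable_fun setT f by apply/measurable_EFinP; exact: measurable_int lf.
rewrite (ge0_integral_cells l n)//; last first.
  by apply: measurable_normE; exact: measurable_cell_avg.
rewrite (ge0_integral_cells l n (H := fun y => `|f y|%:E))//; last first.
  exact: measurable_normE.
apply: lee_sum => s _.
rewrite (integral_cell_cst l s (fun s => `|(\int[l]_(z in cell B s) f z) /
  fine (l (cell B s))|%:E)).
have mc := measurable_cell cgB s.
have fl : l (cell B s) \is a fin_num by exact: fin_num_measure.
have [l0|l0] := eqVneq (fine (l (cell B s))) 0.
  rewrite l0 invr0 mulr0 normr0 mul0e; apply: integral_ge0 => y _.
  by rewrite lee_fin.
have lp : 0 < fine (l (cell B s)) by rewrite lt_neqAle eq_sym l0 fine_ge0.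
rewrite -[X in (_ * X)%E](fineK fl) -EFinM normrM normrV ?unitfE//.
rewrite [X in _ / X]gtr0_norm// mulfVK//.
have := le_normr_Rintegral mc (integrable_cell s lf).
rewrite -lee_fin => /le_trans; apply.
by rewrite /Rintegral fineK//; apply: integrable_fin_num => //; exact/integrable_norm/integrable_cell.
Qed.

Definition avg_cvg f := forall e : R, 0 < e -> exists n0, forall n, (n0 <= n)%N ->
  (\int[l]_y `|cell_avg f n y - f y|%:E <= e%:E)%E.

Lemma L1B f g : L1 f -> L1 g -> L1 (fun y => f y + (-1) * g y).
Proof. exact: integrable_lin. Qed.

Lemma L1_triangle f g h : L1 f -> L1 g -> L1 h ->
  (\int[l]_y `|f y - g y|%:E <=
   \int[l]_y `|f y - h y|%:E + \int[l]_y `|h y - g y|%:E)%E.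
Proof.
have m (u : T -> R) : L1 u -> measurable_fun setT u.
  by move=> lu; apply/measurable_EFinP; exact: measurable_int lu.
move=> /m mf /m mg /m mh.
have mB (u v : T -> R) : measurable_fun setT u -> measurable_fun setT v ->
    measurable_fun setT (fun y => `|u y - v y|%:E).
  by move=> mu mv; apply: measurable_normE; exact: measurable_funB.
rewrite -ge0_integralD//; [|exact: mB|exact: mB].
apply: ge0_le_integral => //.
- exact: mB.
- by apply: emeasurable_funD; exact: mB.
- move=> y _; rewrite -EFinD lee_fin.
  by rewrite -[f y - g y](subrKA (h y)) ler_normD.
Qed.

Lemma L1_cell_avg f n : L1 f -> L1 (cell_avg f n).
Proof.
move=> lf; apply/integrableP; split.
  by apply/measurable_EFinP; exact: measurable_cell_avg.
apply: le_lt_trans (cell_avg_contr n lf) _.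
by have /integrableP[] := lf.
Qed.

(** Three errors of e / 3: f against g, g against its averages, and the averages of g against those
    of f, which the contraction bounds by the first error. *)
Lemma avg_cvg_close f : L1 f ->
  (forall e : R, 0 < e -> exists g, [/\ L1 g, avg_cvg g &
    (\int[l]_y `|f y - g y|%:E <= e%:E)%E]) ->
  avg_cvg f.
Proof.
move=> lf h e e0; have e30 : 0 < e / 3 by rewrite divr_gt0.
have [g [lg cg fg]] := h _ e30; have [n0 hn0] := cg _ e30.
exists n0 => n n0n.
apply: le_trans (L1_triangle (L1_cell_avg n lf) lf lg) _.
apply: (@le_trans _ _ ((e / 3)%:E + (e / 3)%:E + (e / 3)%:E)%E); last first.
  by rewrite -!EFinD lee_fin; lra.
apply: leeD; last first.
  by under eq_integral do rewrite distrC.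
apply: le_trans (L1_triangle (L1_cell_avg n lf) lg (L1_cell_avg n lg)) _.
apply: leeD; last exact: hn0.
apply: le_trans fg.
have := cell_avg_contr n (L1B lf lg).
under eq_integral do rewrite cell_avgD// mulN1r.
by under [X in (_ <= X)%E -> _]eq_integral do rewrite mulN1r.
Qed.

Lemma avg_cvg_lin f g c : L1 f -> L1 g -> avg_cvg f -> avg_cvg g ->
  avg_cvg (fun y => f y + c * g y).
Proof.
move=> lf lg cf cg e e0; have e20 : 0 < e / 2 by rewrite divr_gt0.
have [n1 h1] := cf _ e20.
have c0 : 0 < `|c| + 1 by rewrite ltr_wpDl.
have ec0 : 0 < e / 2 / (`|c| + 1) by rewrite divr_gt0.
have [n2 h2] := cg _ ec0.
exists (maxn n1 n2) => n; rewrite geq_max => /andP[hn1 hn2].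
have m (u : T -> R) : L1 u -> measurable_fun setT u.
  by move=> lu; apply/measurable_EFinP; exact: measurable_int lu.
have mA u : L1 u -> measurable_fun setT (fun y => `|cell_avg u n y - u y|%:E).
  move=> /m mu; apply: measurable_normE.
  by apply: measurable_funB => //; exact: measurable_cell_avg.
apply: (@le_trans _ _ (\int[l]_y (`|cell_avg f n y - f y|%:E +
    `|c|%:E * `|cell_avg g n y - g y|%:E))%E).
  apply: ge0_le_integral => //.
  - by apply: mA; exact: integrable_lin.
  - by apply: emeasurable_funD; [exact: mA|apply: measurable_funeM; exact: mA].
  - move=> y _; rewrite cell_avgD// -EFinM -EFinD lee_fin -normrM.
    apply: le_trans (ler_normD _ _); rewrite le_eqVlt; apply/orP; left; apply/eqP.
    by congr `|_|; ring.
rewrite ge0_integralD//; [|exact: mA|by apply: measurable_funeM; exact: mA].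
rewrite ge0_integralZl//; last exact: mA.
rewrite (splitr e) EFinD; apply: leeD; first exact: h1.
apply: (@le_trans _ _ (`|c|%:E * (e / 2 / (`|c| + 1))%:E)%E).
  by apply: lee_wpmul2l; rewrite ?lee_fin//; exact: h2.
rewrite -EFinM lee_fin mulrCA ler_piMr ?divr_ge0// ?ltW//.
by rewrite ?ltr_pdivrMr ?ler_pdivrMr// mul1r ?ltrDl ?lerDl.
Qed.

(** A function that is constant on the cells of level N equals its own averages from level N on,
    except on null cells. *)
Lemma avg_cvg_code N (h : {ffun 'I_N -> bool} -> R) :
  avg_cvg (h \o code B N).
Proof.
move=> e e0; exists N => n Nn; rewrite (_ : integral _ _ _ = 0%E) ?lee_fin ?ltW//.
pose r (s : {ffun 'I_n -> bool}) : {ffun 'I_N -> bool} := [ffun i => s (widen_ord Nn i)].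
have rE y : code B N y = r (code B n y) by apply/ffunP => i; rewrite !ffunE.
rewrite (ge0_integral_cells l n); last 2 first.
- apply: measurable_normE.
  by apply: measurable_funB; [exact: measurable_cell_avg|exact: measurable_code_fun].
- by move=> y; rewrite lee_fin.
rewrite big1// => s _.
have mc := measurable_cell cgB s.
have fl : l (cell B s) \is a fin_num by exact: fin_num_measure.
pose H s : \bar R := `|(\int[l]_(z in cell B s) (h (r s))) / fine (l (cell B s)) - h (r s)|%:E.
rewrite (_ : (\int[l]_(y in _) _)%E = \int[l]_(y in cell B s) H (code B n y))%E.
  rewrite integral_cell_cst /H Rintegral_cst//.
  have [l0|l0] := eqVneq (fine (l (cell B s))) 0.
    by rewrite -[X in (_ * X)%E](fineK fl) l0 mule0.
  by rewrite mulfK// subrr normr0 mul0e.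
apply: eq_integral => y; rewrite inE /= => ys; rewrite /H /cell_avg ys /= rE ys.
have -> // : \int[l]_(z in cell B s) h (code B N z) =
    \int[l]_(z in cell B s) h (r s).
by apply: eq_Rintegral => z; rewrite inE /= rE => ->.
Qed.

Lemma L1_code N (h : {ffun 'I_N -> bool} -> R) : L1 (h \o code B N).
Proof.
apply: (@integrable_bounded _ _ _ _ _ _ (\sum_s `|h s|)) => //.
- by rewrite ltey_eq fin_num_measure.
- exact: measurable_code_fun.
- move=> y _; rewrite /= (bigD1 (code B N y))//= lerDl.
  by apply: sumr_ge0.
Qed.

(** The L1 distance between the indicators of A and of a union of cells is the mass of the symmetric
    difference, which [code_approx] makes small. *)
Lemma avg_cvg_indic A : measurable A -> avg_cvg (\1_A : T -> R).
Proof.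
move=> mA; apply: avg_cvg_close; first exact: integrable_indic.
move=> e e0; have [n [W hW]] := code_approx cgB l mA e0.
exists ((fun s => (`[< W s >])%:R) \o code B n); split.
- exact: L1_code.
- exact: avg_cvg_code.
- have mV := measurable_code cgB W; have mY : measurable (A `+` code B n @^-1` W).
    by apply: measurableU; exact: measurableD.
  apply: le_trans (ltW hW); rewrite -[X in (_ <= l X)%E]setIT -integral_indic//.
  rewrite le_eqVlt; apply/orP; left; apply/eqP; apply: eq_integral => y _.
  congr EFin; rewrite !indicE /=.
  have -> : (y \in A `+` code B n @^-1` W) = ((y \in A) (+) `[< W (code B n y) >]).
    apply/idP/idP.
      rewrite inE => -[] /= [h1 h2].
        by rewrite mem_set//=; apply/asboolPn.
      by rewrite memNset//=; apply/asboolP.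
    have [Ay|Ay] := boolP (y \in A); rewrite /= ?inE.
      by move/asboolPn => ?; left; split => //; rewrite inE in Ay.
    by move=> Wy; right; split => //= A'; move/negP: Ay; apply; rewrite inE.
  by case: (y \in A); case: `[< _ >]; rewrite /= ?subrr ?subr0 ?sub0r ?normrN ?normr0 ?normr1.
Qed.

Lemma avg_cvg_sum (I : Type) (s : seq I) (A : I -> set T) (c : I -> R) :
  (forall i, measurable (A i)) ->
  L1 (fun y => \sum_(i <- s) c i * \1_(A i) y) /\
  avg_cvg (fun y => \sum_(i <- s) c i * \1_(A i) y).
Proof.
move=> mA; elim: s => [|i s [ih1 ih2]].
  under eq_fun do rewrite big_nil; split; first exact: integrable0.
  exact: (@avg_cvg_code 0 (fun=> 0)).
rewrite (_ : (fun y => _) = (fun y => \sum_(j <- s) c j * \1_(A j) y + c i * \1_(A i) y)).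
  have i1 : L1 (\1_(A i)) by exact: integrable_indic.
  split; last exact: (avg_cvg_lin _ ih1 i1 ih2 (avg_cvg_indic (mA i))).
  exact: integrable_lin.
by apply/funext => y; rewrite big_cons addrC.
Qed.

(** Martingale convergence in L1 by density: it holds for indicators, hence for simple functions,
    and passes to L1 limits. *)
Lemma avg_cvgL1 f : L1 f -> avg_cvg f.
Proof.
move=> lf; apply: avg_cvg_close => // e e0.
have [g [lg _ cg]] := approximation_sfun_integrable (measurableT) lf.
have /fine_cvgP[fin /cvgrPdist_lt /(_ _ e0)] := cg.
move=> /(filterI fin)[n _ /(_ n (leqnn n))] /= [fn hn].
have E : (g n : T -> R) = (fun y =>
    \sum_(r <- finmap.enum_fset (fset_set (range (g n)))) r * \1_(g n @^-1` [set r]) y).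
  by apply/funext => y; rewrite [LHS]fimfunE fsbig_finite.
exists (g n); split; first exact: lg.
  rewrite E; apply: (avg_cvg_sum (finmap.enum_fset (fset_set (range (g n)))) (fun r => r) _).2 => r.
  exact: measurable_funPTI.
rewrite sub0r normrN in hn.
apply: le_trans (_ : `|fine (\int[l]_z `|(f z)%:E - (g n z)%:E|)|%:E <= _)%E; last first.
  by rewrite lee_fin ltW.
by rewrite -(fineK fn); apply: le_trans (ler_norm _).
Qed.

End cell_averages.

(** * Eventual bounds and Fatou's lemma *)

Section fatou_eventually.
Context {d} {T : measurableType d} {R : realType}.

(** A lower bound x for lim inf u, expressed through real levels below x, so that an infinite x
    needs no separate treatment. Its companion [ev_le] bounds lim sup u from above when x is
    finite. *)
Definition ev_ge (u : nat -> \bar R) (x : \bar R) :=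
  forall c : R, (c%:E < x)%E -> exists n0, forall n, (n0 <= n)%N -> (c%:E <= u n)%E.

Definition ev_le (u : nat -> \bar R) (x : \bar R) :=
  forall e : R, 0 < e -> exists n0, forall n, (n0 <= n)%N -> (u n <= x + e%:E)%E.

Lemma limn_einf_ereal_sup (u : nat -> \bar R) :
  limn_einf u = ereal_sup (range (einfs u)).
Proof. by rewrite limn_einf_lim; apply/cvg_lim => //; exact: cvg_einfs_sup. Qed.

Lemma ev_ge_limn_einf u x : ev_ge u x -> (x <= limn_einf u)%E.
Proof.
rewrite limn_einf_ereal_sup => h.
have H c : (c%:E < x)%E -> (c%:E <= ereal_sup (range (einfs u)))%E.
  move=> /h[n0 hn0]; apply: (@le_trans _ _ (einfs u n0)).
    by apply/ereal_infP => _ [n /= n0n <-]; exact: hn0.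
  by apply: ereal_sup_ubound; exists n0.
case: x h H => [r| |] h H.
- apply/lee_subgt0Pr => e e0; rewrite -EFinB; apply: H.
  by rewrite lte_fin ltrBlDr ltrDl.
- have /eqyP -> // : forall c : R, 0 < c -> (c%:E <= ereal_sup (range (einfs u)))%E.
  by move=> c _; apply: H; rewrite ltry.
- by rewrite leNye.
Qed.

Lemma ev_le_limn_einf u x : ev_le u x -> (limn_einf u <= x)%E.
Proof.
move=> h; apply/lee_addgt0Pr => e /h[n0 hn0].
rewrite limn_einf_ereal_sup; apply/ereal_supP => _ [n _ <-].
apply: (@le_trans _ _ (u (maxn n n0))); last by apply: hn0; exact: leq_maxr.
by apply: ereal_inf_lbound; exists (maxn n n0) => //=; exact: leq_maxl.
Qed.

(** Fatou's lemma in the form shared by both limit passages: in space for averaged densities, and in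
    time for the actions of a minimising sequence. *)
Lemma fatou_ev (k : {measure set T -> \bar R}) D (u : nat -> T -> \bar R)
    (v : T -> \bar R) (S : \bar R) : measurable D ->
  (forall n, measurable_fun D (u n)) -> (forall n y, D y -> (0 <= u n y)%E) ->
  measurable_fun D v -> (forall y, D y -> (0 <= v y)%E) ->
  {ae k, forall y, D y -> ev_ge (u ^~ y) (v y)} ->
  ev_le (fun n => \int[k]_(y in D) u n y)%E S ->
  (\int[k]_(y in D) v y <= S)%E.
Proof.
move=> mD mu u0 mv v0 hv hu.
apply: (@le_trans _ _ (limn_einf (fun n => \int[k]_(y in D) u n y))%E);
  last exact: ev_le_limn_einf.
apply: le_trans (fatou _ mD mu u0).
apply: ae_ge0_le_integral => //.
- move=> y Dy; apply: ev_ge_limn_einf => c c0; exists 0%N => n _.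
  by apply: le_trans (u0 n y Dy); exact: ltW.
- rewrite /limn_einf; apply: measurableT_comp => //.
  apply: measurable_fun_limn_esup => n; exact: measurableT_comp.
- by apply: filterS hv => y h Dy; apply: ev_ge_limn_einf; exact: h.
Qed.

(** A summable sequence of integrals gives almost everywhere a summable sequence of values; in
    particular the values tend to 0 there. *)
Lemma ae_summable (k : {measure set T -> \bar R}) D (u : nat -> T -> \bar R) :
  measurable D ->
  (forall n, measurable_fun D (u n)) -> (forall n y, D y -> (0 <= u n y)%E) ->
  (\sum_(n <oo) \int[k]_(y in D) u n y < +oo)%E ->
  {ae k, forall y, D y -> (\sum_(n <oo) u n y < +oo)%E}.
Proof.
move=> mD mu u0; rewrite -integral_nneseries// => h.
have : k.-integrable D (fun y => \sum_(n <oo) u n y)%E.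
  apply/integrableP; split.
    by apply: ge0_emeasurable_sum => // n y Dy _; exact: u0.
  under eq_integral => y yD do
    (rewrite gee0_abs; last by (apply: nneseries_ge0 => n _ _; apply: u0; rewrite inE in yD)).
  by [].
move=> /(integrable_ae mD); apply: filterS => y hy Dy.
by have := hy Dy; rewrite fin_numE => /andP[_]; rewrite ltey.
Qed.

Lemma nneseries_tail_ev (u : nat -> \bar R) :
  (forall n, (0 <= u n)%E) -> (\sum_(0 <= k <oo) u k < +oo)%E ->
  ev_le (fun n => \sum_(n <= k <oo) u k)%E 0%E.
Proof.
move=> u0 su e e0.
have /(_ [set x | (x < e%:E)%E]) := @nneseries_tail_cvg _ u xpredT su (fun k _ => u0 k).
case.
  apply: open_nbhs_nbhs; split; first exact: open_ereal_lt_ereal.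
  by rewrite /= lte_fin.
by move=> n0 _ h; exists n0 => n /h /= /ltW; rewrite add0e.
Qed.

Lemma nneseries_lty_ev0 (u : nat -> \bar R) : (forall n, (0 <= u n)%E) ->
  (\sum_(0 <= n <oo) u n < +oo)%E -> ev_le u 0%E.
Proof.
move=> u0 su e e0; have [n0 h] := nneseries_tail_ev u0 su e0.
exists n0 => n /h; apply: le_trans.
have := @nneseries_lim_ge _ u xpredT n n.+1 (fun n _ _ => u0 n).
by rewrite big_nat1.
Qed.

End fatou_eventually.

(** Convexity and lower semicontinuity are contained in [integrand_affine]: F is the supremum of its
    affine minorants. Measurability is stated for compositions, which avoids a sigma-algebra on the
    functions ['I_N -> R]. Coercivity is quadratic in each coordinate. *)
Record integrand (R : realType) N (F : ('I_N -> R) -> \bar R) : Prop := Integrand {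
  integrand_ge0 : forall z, (0 <= F z)%E ;
  integrand_affine : forall z c, (c%:E < F z)%E -> exists a (b : 'I_N -> R),
    (forall z', ((a + \sum_i b i * z' i)%:E <= F z')%E) /\
    c < a + \sum_i b i * z i ;
  integrand_measurable : forall d (T : measurableType d) (D : set T)
    (f : 'I_N -> T -> R), (forall i, measurable_fun D (f i)) ->
    measurable_fun D (fun y => F (f ^~ y)) ;
  integrand_coercive : exists2 C, 0 <= C &
    forall z i, ((z i ^+ 2)%:E <= C%:E + C%:E * F z)%E }.

(** * The action of a tuple of charges and its discretisations *)

Section action_cells.
Context {d} {T : measurableType d} {R : realType}.
Variable B : nat -> set T.
Hypothesis cgB : countably_generates B.
Context {N : nat}.
Variable F : ('I_N -> R) -> \bar R.
Hypothesis HF : integrand F.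
Variable l : {finite_measure set T -> \bar R}.
Implicit Types nu : {charge set T -> \bar R}.
Implicit Types v : 'I_N -> {charge set T -> \bar R}.

Lemma integrand_lsc (h : nat -> 'I_N -> R) z :
  (forall i (e : R), 0 < e -> exists n0, forall n, (n0 <= n)%N -> `|h n i - z i| <= e) ->
  ev_ge (fun n => F (h n)) (F z).
Proof.
move=> hz c /(integrand_affine HF)[a [b [le lt]]].
pose K := \sum_i `|b i|.
have K0 : 0 <= K by apply: sumr_ge0.
pose e := (a + \sum_i b i * z i - c) / (K + 1).
have e0 : 0 < e by rewrite divr_gt0 ?subr_gt0// ltr_wpDl.
have [n0 hn0] : exists n0, forall n, (n0 <= n)%N -> forall i, `|h n i - z i| <= e.
  have /choice[m hm] : forall i, exists n0, forall n, (n0 <= n)%N -> `|h n i - z i| <= e.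
    by move=> i; exact: hz.
  exists (\max_i m i)%N => n hn i; apply: hm; apply: leq_trans hn.
  exact: leq_bigmax.
exists n0 => n n0n; apply: le_trans (le (h n)); rewrite lee_fin.
have : `|\sum_i b i * h n i - \sum_i b i * z i| <= K * e.
  rewrite -sumrB /K mulr_suml; apply: le_trans (ler_norm_sum _ _ _) _.
  apply: ler_sum => i _; rewrite -mulrBr normrM ler_wpM2l//; exact: hn0.
have : K * e <= (a + \sum_i b i * z i - c).
  rewrite /e mulrCA ler_piMr ?subr_ge0 ?(ltW lt)// ler_pdivrMr ?ltr_wpDl//.
  by rewrite mul1r lerDl.
by move=> h1 h2; have := le_trans h2 h1; rewrite ler_norml => /andP[]; lra.
Qed.

Definition density nu (y : T) : R := fine (Radon_Nikodym nu l y).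

Lemma density_L1 nu : nu `<< l -> l.-integrable setT (EFin \o density nu).
Proof.
move=> nul; rewrite (_ : EFin \o _ = Radon_Nikodym nu l).
  exact: Radon_Nikodym_integrable.
by apply/funext => y; rewrite /= fineK// Radon_Nikodym_fin_num.
Qed.

Lemma density_integral nu A : nu `<< l -> measurable A ->
  fine (nu A) = \int[l]_(y in A) density nu y.
Proof.
move=> nul mA; rewrite (Radon_Nikodym_integral nul mA); congr fine.
by apply: eq_integral => y _; rewrite fineK// Radon_Nikodym_fin_num.
Qed.

Lemma measurable_density nu : measurable_fun setT (density nu).
Proof.
have [nul|nul] := pselect (nu `<< l).
  by apply/measurable_EFinP; apply: measurable_int; exact: density_L1.
(* Without domination the derivative falls back on a constant function. *)
rewrite /density /Radon_Nikodym; by case: pselect.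
Qed.

Lemma density_ae nu (f : T -> R) : nu `<< l -> l.-integrable setT (EFin \o f) ->
  (forall A, measurable A -> nu A = (\int[l]_(y in A) (f y)%:E)%E) ->
  {ae l, forall y, density nu y = f y}.
Proof.
move=> nul lf nuf.
have := @integral_ae_eq _ _ _ l setT measurableT _ _ (density_L1 nul)
  (measurable_int _ lf).
move=> h; have /h : forall E, E `<=` setT -> measurable E ->
    (\int[l]_(y in E) (EFin \o density nu) y = \int[l]_(y in E) (EFin \o f) y)%E.
  move=> A _ mA; rewrite -nuf// (Radon_Nikodym_integral nul mA).
  by apply: eq_integral => y _; rewrite /= fineK// Radon_Nikodym_fin_num.
by apply: filterS => y /(_ I) []; case.
Qed.

(* At [L = 0] this is the recession function of F, infinite off 0 because F is
   coercive. *)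
Definition perspective (L : R) (w : 'I_N -> R) : \bar R :=
  if L == 0 then (if `[< forall i, w i = 0 >] then 0%E else +oo%E)
  else (L%:E * F (fun i => (w i / L)%R))%E.

Lemma perspective_ge0 L w : 0 <= L -> (0 <= perspective L w)%E.
Proof.
move=> L0; rewrite /perspective; case: ifP => _; first by case: ifP.
by apply: mule_ge0 => //; exact: (integrand_ge0 HF).
Qed.

Definition cell_action v n : \bar R :=
  (\sum_(s : {ffun 'I_n -> bool})
    perspective (fine (l (cell B s))) (fun i => fine (v i (cell B s))))%E.

Definition total_density_action v : \bar R :=
  if `[< forall i, v i `<< l >] then (\int[l]_y F (fun i => density (v i) y))%E
  else +oo%E.

Lemma Rintegral_affine (I : Type) (s : seq I) (f : I -> T -> R) a (b : I -> R) A :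
  measurable A -> (forall i, l.-integrable setT (EFin \o f i)) ->
  l.-integrable A (EFin \o (fun y => a + \sum_(i <- s) b i * f i y)) /\
  \int[l]_(y in A) (a + \sum_(i <- s) b i * f i y) =
  a * fine (l A) + \sum_(i <- s) b i * \int[l]_(y in A) f i y.
Proof.
move=> mA lf; have lfA i : l.-integrable A (EFin \o f i) by exact: integrableS (lf i).
elim: s => [|i s [ih1 ih2]].
  rewrite big_nil addr0; under eq_fun do rewrite big_nil addr0.
  split; first exact: finite_measure_integrable_cst.
  by rewrite Rintegral_cst.
have E y : a + \sum_(j <- i :: s) b j * f j y =
    (a + \sum_(j <- s) b j * f j y) + b i * f i y.
  by rewrite big_cons addrCA addrC.
under eq_fun do rewrite E; split; first exact: integrable_lin.
rewrite RintegralD//; last first.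
  rewrite (_ : EFin \o _ = (fun y => (b i)%:E * (EFin \o f i) y))%E; last exact/funext.
  exact: integrableZl.
by rewrite RintegralZl// ih2 big_cons; lra.
Qed.

(** If Jensen's inequality failed on A, the mean of the integral would be a level below the value of
    F at the averages. Some affine minorant exceeds this level there; integrated over A, it would
    exceed the integral of F. When A is null, the dominated charges vanish on it. *)
Lemma perspective_le_integral v A : (forall i, v i `<< l) -> measurable A ->
  (perspective (fine (l A)) (fun i => fine (v i A)) <=
   \int[l]_(y in A) F (fun i => density (v i) y))%E.
Proof.
move=> vl mA; have F0 y : (0 <= F (fun i => density (v i) y))%E.
  exact: (integrand_ge0 HF).
have fl : l A \is a fin_num by exact: fin_num_measure.
rewrite /perspective; case: ifPn => [/eqP l0|l0].
  rewrite ifT; first exact: integral_ge0.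
  apply/asboolP => i; have /null_content_dominatesP -> // := vl i.
  by rewrite -[LHS](fineK fl) l0.
have L0 : 0 < fine (l A) by rewrite lt_neqAle eq_sym l0 fine_ge0.
rewrite leNgt; apply/negP => h.
have mF : measurable_fun A (fun y => F (fun i => density (v i) y)).
  by apply: (integrand_measurable HF) => i; apply: measurable_funTS; exact: measurable_density.
have Ifin : (\int[l]_(y in A) F (fun i => density (v i) y))%E \is a fin_num.
  by rewrite ge0_fin_numE ?integral_ge0//; apply: lt_le_trans h _; rewrite leey.
have iF : l.-integrable A (fun y => F (fun i => density (v i) y)).
  apply/integrableP; split => //.
  by under eq_integral do rewrite gee0_abs//; rewrite -ge0_fin_numE ?integral_ge0.
move: h; rewrite -(fineK Ifin); set r := fine _ => h.
have : ((r / fine (l A))%:E < F (fun i => (fine (v i A) / fine (l A))%R))%E.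
  by rewrite mulrC EFinM lte_pdivrMl.
move=> /(integrand_affine HF)[a [b [le]]].
have [iA EA] := Rintegral_affine (index_enum 'I_N) a b mA (fun i => density_L1 (vl i)).
have : (\int[l]_(y in A) (a + \sum_i b i * density (v i) y)%:E <= r%:E)%E.
  by rewrite /r fineK//; apply: le_integral => // y _; exact: le.
have -> : (\int[l]_(y in A) (a + \sum_i b i * density (v i) y)%:E)%E =
    (\int[l]_(y in A) (a + \sum_i b i * density (v i) y))%:E.
  by rewrite /Rintegral fineK// integrable_fin_num.
rewrite EA lee_fin => h1; rewrite ltr_pdivrMr// mulrDl => h2.
have : \sum_i b i * (fine (v i A) / fine (l A)) * fine (l A) =
    \sum_i b i * \int[l]_(x in A) density (v i) x.
  by apply: eq_bigr => i _; rewrite mulrA mulfVK// density_integral.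
by rewrite -mulr_suml => E; rewrite E in h2; lra.
Qed.

Lemma cell_action_le v n : (cell_action v n <= total_density_action v)%E.
Proof.
rewrite /total_density_action; case: asboolP => [vl|_]; last by rewrite leey.
rewrite (ge0_integral_cells cgB l n)//; last 2 first.
- by apply: (integrand_measurable HF) => i; exact: measurable_density.
- by move=> y; exact: (integrand_ge0 HF).
by apply: lee_sum => s _; apply: perspective_le_integral => //; exact: measurable_cell.
Qed.


(** Coercivity of F at w / L, multiplied by L ^ 2. It has the shape of the Cauchy-Schwarz inequality
    on a cell of mass L. *)
Lemma perspective_coercive : exists2 C, 0 <= C & forall L w i (p : R), 0 <= L ->
  perspective L w = p%:E -> w i ^+ 2 <= L * (C * L + C * p).
Proof.
have [C C0 hC] := integrand_coercive HF; exists C => // L w i p L0.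
rewrite /perspective; case: ifPn => [/eqP ->|Ln0].
  by case: asboolP => // h _; rewrite h mul0r expr0n.
have {}L0 : 0 < L by rewrite lt_neqAle eq_sym Ln0.
have := hC (fun i => w i / L) i; have := integrand_ge0 HF (fun i => w i / L).
case: (F _) => [f| |]//; last first.
  by move=> _ _; rewrite mulry gtr0_sg// mul1e.
move=> f0; rewrite -EFinM -EFinM -EFinD lee_fin => h [<-].
have -> : w i ^+ 2 = (w i / L) ^+ 2 * L ^+ 2 by rewrite -exprMn mulfVK ?gt_eqF.
have -> : L * (C * L + C * (L * f)) = (C + C * f) * L ^+ 2 by ring.
by rewrite ler_wpM2r// sqr_ge0.
Qed.

(** The arithmetic-geometric mean inequality with a weight h. The bound is linear in X and L and can
    therefore be summed over cells. *)
Lemma norm_le_amgm (w L X h : R) : 0 < h -> 0 <= L -> 0 <= X -> w ^+ 2 <= L * X ->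
  `|w| <= h * X + L / h.
Proof.
move=> h0 L0 X0 wLX.
have h0' := ltW h0.
have t0 : 0 <= h * X + L / h by apply: addr_ge0; [exact: mulr_ge0|exact: divr_ge0].
rewrite -(ger0_norm t0) -ler_sqr ?nnegrE// !real_normK ?num_real//.
apply: le_trans wLX _.
have -> : (h * X + L / h) ^+ 2 = (h * X - L / h) ^+ 2 + 4 * (L * X).
  by field; rewrite gt_eqF.
have := sqr_ge0 (h * X - L / h); have : 0 <= L * X by exact: mulr_ge0.
lra.
Qed.

(** Quadratic growth forces absolute continuity. On a union V of cells, the norm of [v i V] is at
    most h K + l(V) / h for every h > 0. A null set A is approximated by such a V, both for l and
    for the variation of [v i]; first h is taken small, then the approximation fine. *)
Lemma cell_action_bound_dominates v (S : R) :
  (forall n, (cell_action v n <= S%:E)%E) -> forall i, v i `<< l.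
Proof.
move=> hS i; apply/null_content_dominatesP => A mA lA0.
have [C C0 hC] := perspective_coercive.
have S0 : 0 <= S.
  rewrite -lee_fin; apply: le_trans (hS 0%N); apply: sume_ge0 => s _.
  by apply: perspective_ge0; exact: fine_ge0.
have fl (A' : set T) : measurable A' -> l A' \is a fin_num by move=> ?; exact: fin_num_measure.
set K := C * fine (l setT) + C * S.
have K0 : 0 <= K by rewrite addr_ge0// mulr_ge0// fine_ge0.
have key n (W : set {ffun 'I_n -> bool}) h : 0 < h ->
    (`|v i (code B n @^-1` W)| <= (h * K)%:E + (h^-1)%:E * l (code B n @^-1` W))%E.
  move=> h0; set V := code B n @^-1` W.
  have mV : measurable V by exact: measurable_code.
  have P0 s : (0 <= perspective (fine (l (cell B s)))
      (fun i => fine (v i (cell B s))))%E.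
    by apply: perspective_ge0; exact: fine_ge0.
  pose P (s : {ffun 'I_n -> bool}) := fine (perspective (fine (l (cell B s)))
      (fun i => fine (v i (cell B s)))).
  have PE s : perspective (fine (l (cell B s))) (fun i => fine (v i (cell B s))) = (P s)%:E.
    rewrite /P fineK// ge0_fin_numE//; apply: le_lt_trans (ltry S).
    apply: le_trans (hS n); rewrite /cell_action (bigD1 s)//= leeDl//.
    exact: sume_ge0.
  have Pge0 s : 0 <= P s by rewrite -lee_fin -PE.
  have sP : \sum_s P s <= S.
    rewrite -lee_fin -sumEFin; apply: le_trans (hS n).
    by rewrite /cell_action; under [X in (_ <= X)%E]eq_bigr do rewrite PE.
  have sl : \sum_(s : {ffun 'I_n -> bool}) fine (l (cell B s)) = fine (l setT).
    apply: EFin_inj; rewrite fineK ?fl// (measure_cell_sum cgB l n measurableT).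
    rewrite -sumEFin; apply: eq_bigr => s _.
    by rewrite setTI fineK// fl//; exact: measurable_cell.
  (* K is distributed over the cells; the remainder, a multiple of S - sum of P, is nonnegative. *)
  have -> : K = \sum_s (C * fine (l (cell B s)) + C * P s) + C * (S - \sum_s P s).
    by rewrite big_split/= -!mulr_sumr sl /K; ring.
  apply: (@le_trans _ _ (\sum_(s : {ffun 'I_n -> bool})
      ((h * (C * fine (l (cell B s)) + C * P s))%:E +
       (h^-1)%:E * l (V `&` cell B s)))%E).
    rewrite (cell_sum cgB (v i) n mV); apply: le_trans (lee_abs_sum _ _ _) _.
    apply: lee_sum => s _; have mc := measurable_cell cgB s.
    have X0 : 0 <= C * fine (l (cell B s)) + C * P s.
      by rewrite addr_ge0// mulr_ge0// fine_ge0.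
    have [Ws|Ws] := pselect (W s); last first.
      rewrite (_ : V `&` cell B s = set0); last first.
        by apply/seteqP; split => y //= [+ ys]; rewrite /V/= ys.
      by rewrite charge0 abse0 measure0 mule0 adde0 lee_fin mulr_ge0// ltW.
    have -> : V `&` cell B s = cell B s.
      by apply/seteqP; split => y //=; [case|move=> ys; split => //; rewrite /V/= ys].
    have fv : v i (cell B s) \is a fin_num by exact: fin_num_measure.
    rewrite -(fineK fv) -(fineK (fl _ mc)) -EFinM -EFinD lee_fin [h^-1 * _]mulrC.
    apply: norm_le_amgm => //; first exact: fine_ge0.
    by apply: (hC _ (fun i => fine (v i (cell B s))) i _ _ (PE s)); exact: fine_ge0.
  rewrite big_split/= sumEFin -mulr_sumr.
  apply: leeD.
    by rewrite lee_fin ler_wpM2l ?(ltW h0)// lerDl mulr_ge0// subr_ge0.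
  by rewrite -ge0_sume_distrr// -measure_cell_sum.
(* A single finite measure above both l and the variation of [v i], so that one V serves for the two
   approximations. *)
pose k := cvar (clin 1 1 (charge_of_finite_measure (cvar (v i))) (charge_of_finite_measure l)).
have kE (A' : set T) : measurable A' -> (cvar (v i) A' + l A' <= k A')%E.
  move=> mA'; apply: le_trans (abse_le_cvar _ mA').
  by rewrite clinE !mul1e; exact: lee_abs.
suff H (e : R) : 0 < e -> (`|v i A| <= e%:E)%E.
  apply/eqP; rewrite -abse_eq0 eq_le abse_ge0 andbT; apply/lee_addgt0Pr => e e0.
  by rewrite add0e; exact: H.
(* The choice of h makes h K at most e / 3; that of [dl] makes both [dl] and [dl] / h at most e /
   3. *)
move=> e0; pose h := e / 3 / (K + 1).
have h0 : 0 < h by rewrite !divr_gt0// ltr_wpDl.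
pose dl := Num.min (e / 3) (e / 3 * h).
have dl0 : 0 < dl by rewrite lt_min; apply/andP; split; [|apply: mulr_gt0 => //]; exact: divr_gt0.
have [n [W hW]] := code_approx cgB k mA dl0.
set V := code B n @^-1` W in hW.
have mV : measurable V by exact: measurable_code.
have mAV : measurable (A `\` V) by exact: measurableD.
have mVA : measurable (V `\` A) by exact: measurableD.
have mY : measurable (A `+` V) by exact: measurableU.
have {}hW : (cvar (v i) (A `+` V) + l (A `+` V) < dl%:E)%E.
  by apply: le_lt_trans hW; exact: kE.
have hc : (cvar (v i) (A `+` V) < dl%:E)%E by apply: le_lt_trans hW; rewrite leeDl.
have hl : (l (A `+` V) < dl%:E)%E by apply: le_lt_trans hW; rewrite leeDr.
have lV : (l V <= dl%:E)%E.
  apply: le_trans (ltW hl); rewrite -[X in (_ <= X)%E]add0e -lA0.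
  apply: (@le_trans _ _ (l (A `|` (A `+` V)))); last exact: measureU2.
  apply: le_measure; rewrite ?inE//; first exact: measurableU.
  by move=> y Vy; have [?|?] := pselect (A y); [left|right; right].
have E : v i A = (v i V + (v i (A `\` V) - v i (V `\` A)))%E.
  rewrite (chargeDI (v i) mA mV) (chargeDI (v i) mV mA) (setIC V).
  have : v i (A `\` V) \is a fin_num by exact: fin_num_measure.
  have : v i (V `\` A) \is a fin_num by exact: fin_num_measure.
  have : v i (A `&` V) \is a fin_num by apply: fin_num_measure; exact: measurableI.
  move: (v i (A `&` V)) (v i (V `\` A)) (v i (A `\` V)) => a b c.
  case: a => [a| |]// _; case: b => [b| |]// _; case: c => [c| |]// _.
  by rewrite -!(EFinD, EFinB); congr EFin; lra.
rewrite E; apply: le_trans (lee_abs_add _ _) _.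
apply: (@le_trans _ _ ((h * K)%:E + (h^-1)%:E * dl%:E + dl%:E)%E); last first.
  rewrite -EFinM -!EFinD lee_fin.
  have : h * K <= e / 3.
    by rewrite /h -mulrA ler_piMr ?divr_ge0 ?(ltW e0)// mulrC ler_pdivrMr ?ltr_wpDl// mul1r lerDl.
  have : h^-1 * dl <= e / 3.
    by rewrite mulrC ler_pdivrMr// /dl ge_min lexx orbT.
  have : dl <= e / 3 by rewrite /dl ge_min lexx.
  lra.
apply: leeD.
  apply: le_trans (key n W h h0) _; rewrite leeD2l//.
  by apply: lee_wpmul2l => //; rewrite lee_fin invr_ge0 ltW.
apply: le_trans (ltW hc); apply: le_trans (lee_abs_sub _ _) _.
rewrite (measureU (cvar (v i)) mAV mVA).
  by apply: leeD; exact: abse_le_cvar.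
by apply/seteqP; split => y //= [[? ?] [? ?]].
Qed.

(** On cells of positive mass the two sides agree; on a null cell the left side vanishes. *)
Lemma integral_cell_avg_le v n : (forall i, v i `<< l) ->
  (\int[l]_y F (fun i => cell_avg B l (density (v i)) n y) <=
   cell_action v n)%E.
Proof.
move=> vl; rewrite (ge0_integral_cells cgB l n)//; last 2 first.
- by apply: (integrand_measurable HF) => i; exact: measurable_cell_avg.
- by move=> y; exact: (integrand_ge0 HF).
apply: lee_sum => s _.
rewrite (integral_cell_cst cgB l s (fun s => F (fun i =>
  (\int[l]_(z in cell B s) density (v i) z) / fine (l (cell B s))))).
have mc := measurable_cell cgB s.
have fl : l (cell B s) \is a fin_num by exact: fin_num_measure.
have [l0|l0] := eqVneq (fine (l (cell B s))) 0.
  rewrite -[X in (_ * X)%E](fineK fl) l0 mule0; apply: perspective_ge0.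
  by [].
rewrite /perspective (negbTE l0) muleC fineK// le_eqVlt; apply/orP; left.
apply/eqP; congr (_ * F _)%E; apply/funext => i.
by rewrite density_integral.
Qed.

(* One inequality is Jensen's on every cell.  For the other one, cell averages of
   densities converge almost everywhere along a subsequence, and Fatou's lemma
   applies. *)
Lemma total_density_action_sup v :
  total_density_action v = ereal_sup (range (cell_action v)).
Proof.
apply/eqP; rewrite eq_le; apply/andP; split; last first.
  by apply/ereal_supP => _ [n _ <-]; exact: cell_action_le.
set S := ereal_sup _.
have S0 : (0 <= S)%E.
  apply: (@le_trans _ _ (cell_action v 0)); last by apply: ereal_sup_ubound; exists 0%N.
  by apply: sume_ge0 => s _; apply: perspective_ge0; exact: fine_ge0.
have hS n : (cell_action v n <= S)%E by apply: ereal_sup_ubound; exists n.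
have [/eqP ->|Sy] := boolP (S == +oo%E); first by rewrite leey.
have Sf : S \is a fin_num by rewrite ge0_fin_numE// ltey.
(* A finite supremum excludes the branch where the action is +oo by definition. *)
have vl : forall i, v i `<< l.
  by apply: (@cell_action_bound_dominates v (fine S)) => n; rewrite fineK.
rewrite /total_density_action asboolT//.
pose f i := density (v i).
have lf i : l.-integrable setT (EFin \o f i) by exact: density_L1.
have ex k : exists n, forall i,
    (\int[l]_y `|cell_avg B l (f i) n y - f i y|%:E <= (1 / (2 ^ k.+1)%:R)%:E)%E.
  have e0 : 0 < 1 / (2 ^ k.+1)%:R :> R by rewrite divr_gt0// ltr0n expn_gt0.
  have /choice[m hm] : forall i, exists n0, forall n, (n0 <= n)%N ->
      (\int[l]_y `|cell_avg B l (f i) n y - f i y|%:E <= (1 / (2 ^ k.+1)%:R)%:E)%E.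
    by move=> i; exact: (avg_cvgL1 cgB (lf i) e0).
  by exists (\max_i m i)%N => i; apply: hm; exact: leq_bigmax.
have [n hn] := choice ex.
have mav i k : measurable_fun setT (cell_avg B l (f i) k) by exact: measurable_cell_avg.
have mf i : measurable_fun setT (f i) by exact: measurable_density.
apply: (@fatou_ev _ _ _ l setT (fun k y => F (fun i => cell_avg B l (f i) (n k) y))) => //.
- by move=> k; apply: (integrand_measurable HF).
- by move=> k y _; exact: (integrand_ge0 HF).
- exact: (integrand_measurable HF).
- by move=> y _; exact: (integrand_ge0 HF).
- have H i : {ae l, forall y, setT y ->
      (\sum_(k <oo) `|cell_avg B l (f i) (n k) y - f i y|%:E < +oo)%E}.
    apply: ae_summable => //.
    + move=> k; apply: measurable_normE; exact: measurable_funB.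
    + apply: (@le_lt_trans _ _ (\sum_(k <oo) (1 / (2 ^ k.+1)%:R)%:E)%E).
        apply: lee_nneseries => k _; last exact: hn.
        by move=> _; apply: integral_ge0 => y _; rewrite lee_fin.
      by apply: le_lt_trans (epsilon_trick0 _ _) _; rewrite ?ltry.
  have := @filter_forall T 'I_N (fun i => [set y | setT y ->
      (\sum_(k <oo) `|cell_avg B l (f i) (n k) y - f i y|%:E < +oo)%E])
    (almost_everywhere l) (ae_filter_ringOfSetsType l) H.
  apply: filterS => y hy _.
  apply: integrand_lsc => i e e0.
  have u0 k : (0 <= `|cell_avg B l (f i) (n k) y - f i y|%:E)%E by rewrite lee_fin.
  have [n0 hn0] := nneseries_lty_ev0 u0 (hy i I) e0.
  by exists n0 => k /hn0; rewrite add0e lee_fin.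
- move=> e e0; exists 0%N => k _.
  apply: le_trans (integral_cell_avg_le (n k) vl) _.
  by apply: le_trans (hS (n k)) _; rewrite leeDl// lee_fin ltW.
Qed.

End action_cells.

(** * Mobilities *)

Lemma divr_lt01 (R : realFieldType) (x y : R) : 0 < x -> x < y -> 0 < x / y < 1.
Proof.
by move=> x0 xy; have y0 := lt_trans x0 xy; rewrite divr_gt0//= ltr_pdivrMr// mul1r.
Qed.

Section mobility.
Context {R : realType}.
Variable m : R -> \bar R.
Hypothesis m_adm : admissible_mobility m.

Lemma mobility_ge0 u : m u != -oo%E -> exists2 r, 0 <= r & m u = r%:E.
Proof.
move=> mu; have [neg pos _ _ _] := m_adm.
have [u0|u0] := ltP u 0; first by rewrite neg in mu.
by have [h|//] := pos u u0; rewrite h in mu.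
Qed.

Lemma mobility_dom_ge0 u : m u != -oo%E -> 0 <= u.
Proof.
by have [neg _ _ _ _] := m_adm; case: (ltP u 0) => // /neg ->.
Qed.

Lemma mobility_concave u v p q s : m u = p%:E -> m v = q%:E -> 0 < s < 1 ->
  exists2 r, m (s * u + (1 - s) * v) = r%:E & s * p + (1 - s) * q <= r.
Proof.
move=> mu mv s01; have [_ _ _ conc _] := m_adm.
have u0 : 0 <= u by apply: mobility_dom_ge0; rewrite mu.
have v0 : 0 <= v by apply: mobility_dom_ge0; rewrite mv.
have := conc _ _ _ u0 v0 s01; rewrite mu mv -!EFinM -EFinD => h.
have : m (s * u + (1 - s) * v) != -oo%E.
  by rewrite gt_eqF//; apply: lt_le_trans h; exact: ltNyr.
by move=> /mobility_ge0[r _ rE]; exists r => //; rewrite -lee_fin -rE.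
Qed.

(** By concavity the domain contains the segment between any two of its points. A point u > b in it
    would place ]c, u[, with c the midpoint of ]a, b[, in the interior of the domain; but b is not
    in that interior. *)
Lemma mobility_dom_bounded : exists2 b, 0 <= b &
  forall u, m u != -oo%E -> 0 <= u <= b.
Proof.
have [_ _ _ _ [a [b [a0 ab intE mpos]]]] := m_adm.
exists b; first exact: le_trans a0 (ltW ab).
move=> u mu; rewrite mobility_dom_ge0//=.
rewrite leNgt; apply/negP => bu.
pose c := (a + b) / 2.
have c_in : a < c < b by rewrite /c midf_lt//= midf_lt.
have [q _ mc] : exists2 q, 0 <= q & m c = q%:E.
  by apply: mobility_ge0; rewrite gt_eqF// (lt_trans _ (mpos _ c_in))// ltNye.
have [p _ mu'] := mobility_ge0 mu.
have sub : `]c, u[%classic `<=` interior [set u | m u != -oo%E].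
  rewrite -open_subsetE; last exact: interval_open.
  move=> y /=; rewrite in_itv/= => /andP[cy yu].
  have cu : 0 < u - c by rewrite subr_gt0 (lt_trans cy).
  have s01 : 0 < (y - c) / (u - c) < 1.
    by apply: divr_lt01; rewrite ?subr_gt0// ltrD2r.
  have [r + _] := mobility_concave mu' mc s01.
  suff -> : (y - c) / (u - c) * u + (1 - (y - c) / (u - c)) * c = y by move=> ->.
  by field; rewrite gt_eqF.
have : `]c, u[%classic b by rewrite /= in_itv/= bu andbT; case/andP: c_in.
by move=> /sub; rewrite intE /= in_itv/= ltxx andbF.
Qed.

(** The midpoint c lies between u and the quarter point y on the other side of c. As m is
    nonnegative at y, concavity bounds m u by m c divided by the weight of u. *)
Lemma mobility_bounded : exists2 M, 0 < M & forall u r, m u = r%:E -> r <= M.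
Proof.
have [_ _ _ _ [a [b [a0 ab _ mpos]]]] := m_adm.
have [B B0 hB] := mobility_dom_bounded.
have inab c : a < c < b -> exists2 q, 0 < q & m c = q%:E.
  move=> /mpos h; have [q _ mc] : exists2 q, 0 <= q & m c = q%:E.
    by apply: mobility_ge0; rewrite gt_eqF// (lt_trans _ h)// ltNye.
  by exists q => //; rewrite -lte_fin -mc.
pose c := (a + b) / 2; pose y0 := (3 * a + b) / 4; pose y1 := (a + 3 * b) / 4.
have [q q0 mc] : exists2 q, 0 < q & m c = q%:E by apply: inab; rewrite /c; lra.
have [q1 q10 my0] : exists2 q, 0 < q & m y0 = q%:E by apply: inab; rewrite /y0; lra.
have [q2 q20 my1] : exists2 q, 0 < q & m y1 = q%:E by apply: inab; rewrite /y1; lra.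
(* The weight of u is a quotient of (b - a) / 4 by a distance of at most B + b, hence at least 1 /
   K. *)
pose K := 1 + 4 * (B + b) / (b - a).
have K1 : 1 <= K.
  by rewrite /K lerDl divr_ge0 ?subr_ge0 ?(ltW ab)// mulr_ge0// addr_ge0// (le_trans a0)// ltW.
have key y qy u r : m y = qy%:E -> 0 <= qy -> m u = r%:E ->
    0 < (c - y) / (u - y) < 1 -> K^-1 <= (c - y) / (u - y) -> r <= K * q.
  move=> my qy0 mu s01 Ks; have [r' ] := mobility_concave mu my s01.
  have uy : u - y != 0 by apply: contraTneq s01 => ->; rewrite invr0 mulr0 ltxx.
  have -> : (c - y) / (u - y) * u + (1 - (c - y) / (u - y)) * y = c by field.
  rewrite mc => -[<-] h.
  have r0 : 0 <= r by have := @mobility_ge0 u; rewrite mu => /(_ isT)[z z0 [->]].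
  have : (c - y) / (u - y) * r <= q.
    by apply: le_trans h; rewrite lerDl mulr_ge0// subr_ge0; case/andP: s01 => _ /ltW.
  move=> /(le_trans (ler_wpM2r r0 Ks)).
  by rewrite mulrC ler_pdivrMr ?(lt_le_trans _ K1)// mulrC.
exists (K * q); first by rewrite mulr_gt0// (lt_le_trans _ K1).
move=> u r mu; have /andP[u0 uB] : 0 <= u <= B by apply: hB; rewrite mu.
have Kpos : 0 < K by exact: lt_le_trans K1.
have ba : 0 < b - a by rewrite subr_gt0.
have Kba : K * (b - a) = (b - a) + 4 * (B + b) by rewrite /K; field; rewrite gt_eqF.
have [uc|uc|uc] := ltgtP u c; last first.
- by move: mu; rewrite uc mc => -[<-]; rewrite ler_peMl// ltW.
- apply: (key y0 q1 u r) => //; first exact: ltW.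
    by apply: divr_lt01; [rewrite /c /y0; lra|rewrite ltrD2r].
  have p0 : 0 < u - y0 by move: uc; rewrite /c /y0; lra.
  rewrite ler_pdivlMr// ler_pdivrMl//.
  have -> : c - y0 = (b - a) / 4 by rewrite /c /y0; field.
  by rewrite mulrA Kba /y0; lra.
- apply: (key y1 q2 u r) => //; first exact: ltW.
    have p0 : 0 < y1 - u by move: uc; rewrite /c /y1; lra.
    have -> : (c - y1) / (u - y1) = (y1 - c) / (y1 - u).
      by rewrite -opprB -[u - y1]opprB invrN mulrNN.
    by apply: divr_lt01; [rewrite /c /y1; lra|rewrite ltrD2l ltrN2].
  have p0 : 0 < y1 - u by move: uc; rewrite /c /y1; lra.
  have -> : (c - y1) / (u - y1) = (y1 - c) / (y1 - u).
    by rewrite -opprB -[u - y1]opprB invrN mulrNN.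
  rewrite ler_pdivlMr// ler_pdivrMl//.
  have -> : y1 - c = (b - a) / 4 by rewrite /c /y1; field.
  by rewrite mulrA Kba /y1; lra.
Qed.

(* The slope is a supremum of difference quotients to the right of [u]; upper
   semicontinuity at [u] bounds them when no point to the left of [u] is in
   the domain. *)
Lemma mobility_affine_majorant u x : (m u < x%:E)%E ->
  exists k, forall v r, m v = r%:E -> r <= x + k * (v - u).
Proof.
move=> mux; have [_ _ usc _ _] := m_adm; have [M M0 hM] := mobility_bounded.
have : ((- x)%:E < - m u)%E by rewrite EFinN lteN2.
move=> /usc[V /nbhs_ballP[/= e e0 eV] hV].
have near_lt v r : m v = r%:E -> `|u - v| < e -> r < x.
  move=> mv uv; have := hV _ (eV _ uv).
  by rewrite mv -EFinN lte_fin ltrN2.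
(* Closer to u than e the mobility stays below x. Farther away, difference quotients are at most (M
   + |x|) / e. *)
pose K := (M + `|x|) / e.
have K0 : 0 <= K by rewrite divr_ge0 ?(ltW e0)// addr_ge0// ltW.
have far v r : m v = r%:E -> v != u -> (r - x) / `|v - u| <= K.
  move=> mv vu; have vu0 : 0 < `|v - u| by rewrite normr_gt0 subr_eq0.
  have [h|h] := ltP `|u - v| e.
    apply: le_trans K0; rewrite ler_pdivrMr// mul0r subr_le0.
    exact/ltW/(near_lt _ _ mv).
  rewrite ler_pdivrMr// /K mulrAC ler_pdivlMr//.
  apply: (@le_trans _ _ ((M + `|x|) * e)).
    rewrite ler_pM2r//; apply: lerD; first exact: hM mv.
    by rewrite -normrN ler_norm.
  by rewrite ler_wpM2l ?addr_ge0// ?(ltW M0)// distrC.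
(* The element -K keeps the set nonempty when the domain has no point to the right of u, and it is
   an admissible slope for the points to the left. *)
pose A := [set z | z = - K \/ exists v r, [/\ u < v, m v = r%:E & z = (r - x) / (v - u)]].
have Asup : has_sup A.
  split; first by exists (- K); left.
  exists K => _ [->|[v [r [uv mv ->]]]].
    by rewrite (le_trans _ K0)// oppr_le0.
  have vu : v != u by rewrite gt_eqF.
  by have := far _ _ mv vu; rewrite gtr0_norm// subr_gt0.
exists (sup A) => v r mv; have [vu|uv|vu] := ltgtP v u; last first.
- rewrite vu subrr mulr0 addr0; apply/ltW/(near_lt _ _ mv).
  by rewrite vu subrr normr0.
- have : (r - x) / (v - u) <= sup A by apply: sup_upper_bound => //; right; exists v, r.
  by rewrite ler_pdivrMr ?subr_gt0// lerBlDl.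
- rewrite -lerBlDl -[v - u]opprB mulrN lerNr -ler_pdivlMr ?subr_gt0// opprB.
  apply: ge_sup; first by exists (- K); left.
  move=> _ [->|[w [q [uw mw ->]]]].
    have vu' : v != u by rewrite lt_eqF.
    have := far _ _ mv vu'; rewrite distrC gtr0_norm ?subr_gt0// => h.
    by rewrite lerNl -mulNr opprB.
  have uv0 : 0 < u - v by rewrite subr_gt0.
  have wu0 : 0 < w - u by rewrite subr_gt0.
  have wv0 : 0 < w - v by rewrite subr_gt0 (lt_trans vu).
  have s01 : 0 < (u - v) / (w - v) < 1.
    by apply: divr_lt01 => //; rewrite ltrD2r.
  have [p] := mobility_concave mw mv s01.
  have -> : (u - v) / (w - v) * w + (1 - (u - v) / (w - v)) * v = u.
    by field; rewrite gt_eqF.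
  move=> mup hp; have {}mux : p < x by rewrite -lte_fin -mup.
  rewrite ler_pdivrMr// mulrAC ler_pdivlMr//.
  have E : (u - v) / (w - v) * q + (1 - (u - v) / (w - v)) * r =
      ((u - v) * q + (w - u) * r) / (w - v) by field; rewrite gt_eqF.
  have : (u - v) * q + (w - u) * r <= x * (w - v).
    by rewrite -ler_pdivrMr// -E (le_trans hp)// ltW.
  lra.
Qed.

Lemma measurable_mobility : measurable_fun setT m.
Proof.
have [_ _ usc _ _] := m_adm.
rewrite (_ : m = (fun u => - (- m u))%E); last by apply/funext => u; rewrite oppeK.
by apply: measurableT_comp => //; exact: lower_semicontinuous_measurable.
Qed.

End mobility.

(** Reduced to the measurability of real powers; at 0 both expressions vanish by convention. *)
Lemma measurable_invr (R : realType) : measurable_fun setT (fun x : R => x^-1).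
Proof.
have -> : (fun x : R => x^-1) = (fun x => x * (x ^+ 2) `^ (-1)).
  apply/funext => x; rewrite powR_inv1 ?sqr_ge0//.
  have [->|x0] := eqVneq x 0; first by rewrite invr0 mul0r.
  by field.
apply: measurable_funM => //.
apply: (@measurableT_comp _ _ _ _ _ _ (@powR R ^~ (-1))); first exact: measurable_powR.
exact: measurable_funX.
Qed.

Section mobility_integrand.
Context {R : realType}.
Variables (m : R -> \bar R) (d : nat).
Hypothesis m_adm : admissible_mobility m.

(** Coordinate 0 is the density of mass and the others are those of the flux. The case d = 1 serves
    the edges and the outer vertices, with a flux or an exchange rate as second coordinate. *)
Definition mobility_integrand (z : 'I_d.+1 -> R) : \bar R :=
  Psi m (z ord0) (enorm (\row_(i < d) z (lift ord0 i))).

Let S (z : 'I_d.+1 -> R) := \sum_(i < d) z (lift ord0 i) ^+ 2.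

Let S_ge0 z : 0 <= S z.
Proof. by apply: sumr_ge0 => i _; exact: sqr_ge0. Qed.

Lemma mobility_integrandE z : mobility_integrand z =
  if (0 < m (z ord0))%E then (S z / fine (m (z ord0)))%:E
  else if (m (z ord0) == 0%E) && (S z == 0) then 0%E else +oo%E.
Proof.
have E : edot (\row_(i < d) z (lift ord0 i)) (\row_(i < d) z (lift ord0 i)) = S z.
  by apply: eq_bigr => i _; rewrite !mxE expr2.
rewrite /mobility_integrand /Psi /enorm E sqr_sqrtr//.
rewrite sqrtr_eq0; have -> // : (S z <= 0) = (S z == 0).
by rewrite eq_le S_ge0 andbT.
Qed.

(* For [p] in R^d, [t >= 0] and an affine majorant [x + k (v - u)] of the
   mobility, [2 p.w - (|p|^2 + t) (x + k (v - u))] is a minorant of the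
   integrand.  The parameter [t] is only of use where the mobility is -oo. *)
Lemma mobility_integrand_minorant (p : 'I_d -> R) t x k u z : 0 <= t ->
  (forall v r, m v = r%:E -> r <= x + k * (v - u)) ->
  ((2 * (\sum_i p i * z (lift ord0 i)) -
    (\sum_i p i ^+ 2 + t) * (x + k * (z ord0 - u)))%:E <= mobility_integrand z)%E.
Proof.
move=> t0 maj; rewrite mobility_integrandE.
have P0 : 0 <= \sum_i p i ^+ 2 by apply: sumr_ge0 => i _; exact: sqr_ge0.
case: ifPn => [m0|m0].
  have [r r0 mr] : exists2 r, 0 <= r & m (z ord0) = r%:E.
    by apply: (mobility_ge0 m_adm); rewrite gt_eqF// (lt_trans _ m0)// ltNye.
  move: m0; rewrite mr lte_fin => rp /=; rewrite lee_fin.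
  have := maj _ _ mr => h.
  apply: (@le_trans _ _ (2 * (\sum_i p i * z (lift ord0 i)) - (\sum_i p i ^+ 2) * r)).
    rewrite lerD2l lerN2; apply: (@le_trans _ _ ((\sum_i p i ^+ 2 + t) * r)).
      by rewrite ler_wpM2r// lerDl.
    by rewrite ler_wpM2l// addr_ge0.
  rewrite ler_pdivlMr// -subr_ge0.
  (* The square is completed. *)
  have -> : S z - (2 * (\sum_i p i * z (lift ord0 i)) - (\sum_i p i ^+ 2) * r) * r =
      \sum_i (z (lift ord0 i) - r * p i) ^+ 2.
    rewrite mulrBl mulr_sumr !mulr_suml -!sumrB; apply: eq_bigr => i _; ring.
  by apply: sumr_ge0 => i _; exact: sqr_ge0.
case: ifPn => [/andP[/eqP mz /eqP Sz]|_]; last by rewrite leey.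
have z0 i : z (lift ord0 i) = 0.
  apply/eqP; rewrite -sqrf_eq0; move/eqP: Sz.
  by rewrite psumr_eq0 => [/allP/(_ i)|j _]; [rewrite mem_index_enum => /(_ isT)|exact: sqr_ge0].
rewrite big1 => [|i _]; last by rewrite z0 mulr0.
rewrite mulr0 sub0r lee_fin oppr_le0; apply: mulr_ge0; first exact: addr_ge0.
exact: (maj _ _ mz).
Qed.

(** For [integrand_affine], the parameters p, t and x of the minorant are chosen according to
    whether the mobility at z is positive, zero or -oo; the slope k then comes from
    [mobility_affine_majorant]. *)
Lemma mobility_integrandP : integrand mobility_integrand.
Proof.
have [b b0 hb] := mobility_dom_bounded m_adm; have [M M0 hM] := mobility_bounded m_adm.
split.
- move=> z; rewrite mobility_integrandE; case: ifP => [m0|_]; last by case: ifP.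
  by rewrite lee_fin divr_ge0// fine_ge0// ltW.
- move=> z c cF.
  suff [p [t [x [t0 mx cx]]]] : exists (p : 'I_d -> R) t x, [/\ 0 <= t, (m (z ord0) < x%:E)%E &
      c < 2 * (\sum_i p i * z (lift ord0 i)) - (\sum_i p i ^+ 2 + t) * x].
    have [k hk] := mobility_affine_majorant m_adm mx.
    pose q := \sum_i p i ^+ 2 + t.
    pose bb (i : 'I_d.+1) := if unlift ord0 i is Some j then 2 * p j else - (q * k).
    have E z' : - q * (x - k * z ord0) + \sum_i bb i * z' i =
        2 * (\sum_i p i * z' (lift ord0 i)) - q * (x + k * (z' ord0 - z ord0)).
      rewrite big_ord_recl /bb unlift_none mulr_sumr.
      under eq_bigr do rewrite liftK -mulrA.
      ring.
    exists (- q * (x - k * z ord0)), bb; split => [z'|].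
      by rewrite E; exact: mobility_integrand_minorant.
    by rewrite E subrr mulr0 addr0.
  (* The choice p = w / x, with w the flux part of z, maximises the minorant at z for t = 0 and
     gives it the value |w| ^ 2 / x. *)
  have quad x : x != 0 -> 2 * (\sum_i z (lift ord0 i) / x * z (lift ord0 i)) -
      (\sum_i (z (lift ord0 i) / x) ^+ 2 + 0) * x = S z / x.
    move=> x0; rewrite addr0 mulr_sumr mulr_suml -sumrB mulr_suml.
    by apply: eq_bigr => i _; field.
  move: cF; rewrite mobility_integrandE; case: ifPn => [m0|m0].
    have [r r0 mr] : exists2 r, 0 <= r & m (z ord0) = r%:E.
      by apply: (mobility_ge0 m_adm); rewrite gt_eqF// (lt_trans _ m0)// ltNye.
    move: m0; rewrite mr lte_fin => rp /=; rewrite lte_fin ltr_pdivlMr// => cr.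
    (* Slightly above the mobility r, so that S / x still exceeds c; |c| + 1 keeps the denominator
       positive. *)
    pose x := r + (S z - c * r) / (2 * (`|c| + 1)).
    have c1 : 0 < 2 * (`|c| + 1) by rewrite mulr_gt0// ltr_wpDl.
    have xr : r < x by rewrite /x ltrDl divr_gt0// subr_gt0.
    have x0 : 0 < x by exact: lt_trans xr.
    exists (fun i => z (lift ord0 i) / x), 0, x; split => //.
    rewrite quad ?gt_eqF// ltr_pdivlMr// /x mulrDr.
    have : c * ((S z - c * r) / (2 * (`|c| + 1))) <= (S z - c * r) / 2.
      rewrite mulrA ler_pdivrMr//.
      have : 0 <= (S z - c * r) * (`|c| + 1 - c).
        by rewrite mulr_ge0 ?subr_ge0 ?(ltW cr)// ler_wpDr// ler_norm.
      lra.
    lra.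
  case: ifPn => [/andP[/eqP mz /eqP Sz]|ns].
    rewrite lte_fin => c0; exists (fun=> 0), 0, 1; split => //; first by rewrite mz lte_fin.
    by rewrite !big1 => [|i _|i _]; rewrite ?mul0r ?expr0n//; lra.
  move=> _; have [mz|mz] := eqVneq (m (z ord0)) (-oo)%E.
    (* Outside the domain, p = 0 and t = 1 give the minorant the value -x = c + 1 at z. *)
    exists (fun=> 0), 1, (- c - 1); split => //; first by rewrite mz ltNyr.
    by rewrite !big1 => [|i _|i _]; rewrite ?mul0r ?expr0n//; lra.
  have [r r0 mr] := mobility_ge0 m_adm mz.
  move: m0 ns; rewrite mr lte_fin -leNgt => r0'.
  have -> : r = 0 by apply/eqP; rewrite eq_le r0 r0'.
  rewrite eqxx /= => Sz; have Sp : 0 < S z by rewrite lt_neqAle eq_sym Sz S_ge0.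
  have c1 : 0 < `|c| + 1 by rewrite ltr_wpDl.
  have x0 : 0 < S z / (`|c| + 1) by rewrite divr_gt0.
  (* At mobility zero with nonzero flux, x is small enough for S / x to be |c| + 1. *)
  exists (fun i => z (lift ord0 i) / (S z / (`|c| + 1))), 0, (S z / (`|c| + 1)).
  split => //; rewrite quad ?gt_eqF//.
  rewrite invf_div mulrCA mulfV// mulr1 (le_lt_trans (ler_norm _))// ltrDl.
  exact: ltr01.
- move=> dT T D f mf mD.
  have mm : measurable_fun D (fun y => m (f ord0 y)).
    by apply: measurableT_comp => //; exact: measurable_mobility.
  have mS : measurable_fun D (fun y => S (f ^~ y)).
    by apply: measurable_sum => i; exact: measurable_funX.
  rewrite (_ : (fun y => _) = (fun y => if (0 < m (f ord0 y))%E
      then (S (f ^~ y) / fine (m (f ord0 y)))%:E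
      else if (m (f ord0 y) == 0%E) && (S (f ^~ y) == 0) then 0%E else +oo%E)); last first.
    by apply/funext => y; rewrite mobility_integrandE.
  have inner : measurable_fun D (fun y =>
      if (m (f ord0 y) == 0%E) && (S (f ^~ y) == 0) then 0%E else +oo%E : \bar R).
    apply: measurable_fun_if => //.
    apply: measurable_and; first exact: measurable_fun_eqe.
    exact: measurable_fun_eqr.
  move: (mD); apply: measurable_fun_if => //; first exact: measurable_fun_lte.
    apply: (measurable_funS mD) => //; apply/measurable_EFinP.
    apply: measurable_funM => //.
    apply: (@measurableT_comp _ _ _ _ _ _ (fun x : R => x^-1)); first exact: measurable_invr.
    by apply: measurableT_comp => //; exact: fine_measurable.
  exact: (measurable_funS mD).
(* The term b ^ 2 bounds the squared mass density on the domain; M bounds the mobility, so that |w|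
   ^ 2 <= M times the integrand. *)
- exists (b ^+ 2 + M); first by rewrite addr_ge0 ?sqr_ge0// ltW.
  move=> z i; rewrite mobility_integrandE.
  have C0 : 0 < b ^+ 2 + M by rewrite ltr_wpDl ?sqr_ge0.
  have zdom r : m (z ord0) = r%:E -> z ord0 ^+ 2 <= b ^+ 2.
    move=> mr; have /andP[h1 h2] : 0 <= z ord0 <= b by apply: hb; rewrite mr.
    by rewrite ler_sqr ?nnegrE.
  have zS j : z (lift ord0 j) ^+ 2 <= S z.
    by rewrite /S (bigD1 j)//= lerDl; apply: sumr_ge0 => k _; exact: sqr_ge0.
  case: ifPn => [m0|m0].
    have [r r0 mr] : exists2 r, 0 <= r & m (z ord0) = r%:E.
      by apply: (mobility_ge0 m_adm); rewrite gt_eqF// (lt_trans _ m0)// ltNye.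
    move: m0; rewrite mr lte_fin => rp /=; rewrite -EFinM -EFinD lee_fin.
    have q0 : 0 <= S z / r by rewrite divr_ge0.
    case: (unliftP ord0 i) => [j ->|->].
      apply: (le_trans (zS j)).
      have : S z <= M * (S z / r).
        by rewrite mulrCA ler_peMr// ler_pdivlMr// mul1r (hM _ _ mr).
      have : 0 <= b ^+ 2 * (S z / r) by rewrite mulr_ge0 ?sqr_ge0.
      rewrite mulrDl; lra.
    apply: (le_trans (zdom _ mr)).
    have : 0 <= (b ^+ 2 + M) * (S z / r) by rewrite mulr_ge0// ltW.
    lra.
  case: ifPn => [/andP[/eqP mz /eqP Sz]|_]; last first.
    by rewrite mulry gtr0_sg// mul1e addey ?leey.
  rewrite mule0 adde0 lee_fin; case: (unliftP ord0 i) => [j ->|->].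
    by apply: (le_trans (zS j)); rewrite Sz ltW.
  by apply: (le_trans (zdom _ mz)); rewrite lerDl ltW.
Qed.

End mobility_integrand.

(** The energy is the action for this integrand, so that measurability in time and the cell formula
    apply to it. The affine minorants are the tangents to the parabola. *)
Lemma square_integrandP (R : realType) :
  integrand (fun z : 'I_1 -> R => (z ord0 ^+ 2)%:E).
Proof.
split.
- by move=> z; rewrite lee_fin sqr_ge0.
- move=> z c; rewrite lte_fin => cz.
  exists (- z ord0 ^+ 2), (fun=> 2 * z ord0); split => [z'|].
    rewrite big_ord1 lee_fin -subr_ge0.
    have -> : z' ord0 ^+ 2 - (- z ord0 ^+ 2 + 2 * z ord0 * z' ord0) =
      (z' ord0 - z ord0) ^+ 2 by ring.
    exact: sqr_ge0.
  by rewrite big_ord1; lra.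
- by move=> d T D f mf; apply/measurable_EFinP; exact: measurable_funX.
- by exists 1 => // z i; rewrite mul1e (ord1 i) leeDr// lee_fin.
Qed.

(** * Convexity, semicontinuity and energy of the actions *)

Section ev_ge_sum.
Context {R : realType}.

Lemma ev_ge0 (u : nat -> \bar R) : (forall n, (0 <= u n)%E) -> ev_ge u 0%E.
Proof. by move=> u0 c c0; exists 0%N => n _; apply: le_trans (u0 n); exact: ltW. Qed.

Lemma lte_split (x y : \bar R) (c : R) : (0 <= x)%E -> (0 <= y)%E ->
  (c%:E < x + y)%E -> exists c1 c2, [/\ (c1%:E < x)%E, (c2%:E < y)%E & c <= c1 + c2].
Proof.
case: x => [x| |]//; case: y => [y| |]// x0 y0 h.
- move: h; rewrite -EFinD lte_fin => h.
  exists (x - (x + y - c) / 2), (y - (x + y - c) / 2).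
  by rewrite !lte_fin; split; lra.
- by exists (x - 1), (c - x + 1); rewrite ltry lte_fin; split => //; lra.
- by exists (c - y + 1), (y - 1); rewrite ltry lte_fin; split => //; lra.
- by exists c, 0; rewrite !ltry addr0.
Qed.

Lemma ev_geD (u v : nat -> \bar R) x y : (0 <= x)%E -> (0 <= y)%E ->
  ev_ge u x -> ev_ge v y -> ev_ge (fun n => u n + v n)%E (x + y)%E.
Proof.
move=> x0 y0 ux vy c /(lte_split x0 y0)[c1 [c2 [c1x c2y cc]]].
have [n1 h1] := ux _ c1x; have [n2 h2] := vy _ c2y.
exists (maxn n1 n2) => n; rewrite geq_max => /andP[/h1 h1' /h2 h2'].
by apply: (@le_trans _ _ (c1%:E + c2%:E)%E); [rewrite -EFinD lee_fin|exact: leeD].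
Qed.

Lemma ev_ge_sum (I : Type) (s : seq I) (u : nat -> I -> \bar R) (x : I -> \bar R) :
  (forall i, (0 <= x i)%E) -> (forall i, ev_ge (fun n => u n i) (x i)) ->
  ev_ge (fun n => \sum_(i <- s) u n i)%E (\sum_(i <- s) x i)%E.
Proof.
move=> x0 ux; elim: s => [|i s ih].
  by rewrite big_nil => c c0; exists 0%N => n _; rewrite big_nil ltW.
rewrite big_cons => c h.
have [n0 hn0] := ev_geD (x0 i) (sume_ge0 (fun i _ => x0 i) s) (ux i) ih h.
by exists n0 => n /hn0; rewrite big_cons.
Qed.

Lemma ev_geZ (u : nat -> \bar R) x (k : R) : 0 < k -> ev_ge u x ->
  ev_ge (fun n => k%:E * u n)%E (k%:E * x)%E.
Proof.
move=> k0 ux c h.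
have /ux[n0 hn0] : ((c / k)%:E < x)%E by rewrite mulrC EFinM lte_pdivrMl.
exists n0 => n /hn0; rewrite mulrC EFinM lee_pdivrMl//.
Qed.

End ev_ge_sum.

Section action_properties.
Context {d} {T : measurableType d} {R : realType}.
Variable B : nat -> set T.
Hypothesis cgB : countably_generates B.
Context {N : nat}.
Variable F : ('I_N -> R) -> \bar R.
Hypothesis HF : integrand F.
Variable l : {finite_measure set T -> \bar R}.
Implicit Types v : 'I_N -> {charge set T -> \bar R}.

Lemma total_density_action_ge0 v : (0 <= total_density_action F l v)%E.
Proof.
rewrite /total_density_action; case: ifP => // _; apply: integral_ge0 => y _.
exact: (integrand_ge0 HF).
Qed.

Lemma measurable_perspective {d'} {U : measurableType d'} (D : set U) L
    (w : 'I_N -> U -> R) : measurable D -> (forall i, measurable_fun D (w i)) ->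
  measurable_fun D (fun t => perspective F L (w ^~ t)).
Proof.
move=> mD mw; rewrite /perspective; have [L0|L0] := eqVneq L 0.
  rewrite (_ : (fun t => _) = (fun t =>
      if \sum_i w i t ^+ 2 == 0 then 0%E else +oo%E)); last first.
    apply/funext => t; congr (if _ then _ else _); apply/asboolP/idP => [h|].
      by rewrite big1// => i _; rewrite h expr0n.
    rewrite psumr_eq0 => [/allP h i|i _]; last exact: sqr_ge0.
    by apply/eqP; rewrite -sqrf_eq0; exact: (h i (mem_index_enum i)).
  apply: measurable_fun_if => //; apply: measurable_fun_eqr => //.
  by apply: measurable_sum => i; exact: measurable_funX.
apply: measurable_funeM; apply: (integrand_measurable HF) => i.
exact: measurable_funM.
Qed.

Lemma measurable_action {d'} {U : measurableType d'} (D : set U)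
    (v : U -> 'I_N -> {charge set T -> \bar R}) : measurable D ->
  (forall i A, measurable A -> measurable_fun D (fun t => v t i A)) ->
  measurable_fun D (fun t => total_density_action F l (v t)).
Proof.
move=> mD mv.
rewrite (_ : (fun t => _) = (fun t => esups (cell_action B F l (v t)) 0)); last first.
  apply/funext => t; rewrite (total_density_action_sup cgB HF) /esups.
  by congr ereal_sup; apply/seteqP; split => _ [n _ <-]; exists n.
apply: measurable_fun_esups => n; apply: emeasurable_sum => s.
apply: (@measurable_perspective _ _ _ _ (fun i t => fine (v t i (cell B s)))) => // i.
apply: measurableT_comp; first exact: fine_measurable.
by apply: mv; exact: measurable_cell.
Qed.

(** An affine minorant that exceeded the mean of the two values at the midpoint would exceed one of
    the values at its own point. *)
Lemma perspective_midpoint (L : R) (w w' : 'I_N -> R) : 0 <= L ->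
  (perspective F L (fun i => 2^-1 * w i + 2^-1 * w' i)%R <=
   (2^-1)%:E * (perspective F L w + perspective F L w'))%E.
Proof.
move=> L0.
have p0 z : (0 <= perspective F L z)%E by exact: perspective_ge0.
have h0 : 0 < 2^-1 :> R by rewrite invr_gt0.
have [/eqP wy|wy] := boolP (perspective F L w == +oo%E).
  by rewrite wy addye ?gt_eqF ?(lt_le_trans _ (p0 w'))// gt0_muley ?lte_fin// leey.
have [/eqP wy'|wy'] := boolP (perspective F L w' == +oo%E).
  by rewrite wy' addey ?gt_eqF ?(lt_le_trans _ (p0 w))// gt0_muley ?lte_fin// leey.
move: wy wy' p0; rewrite /perspective; case: ifPn => [_|Ln0].
  case: asboolP => // hw _; case: asboolP => // hw' _ _.
  rewrite ifT; first by rewrite adde0 mule0.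
  by apply/asboolP => i; rewrite hw hw' !mulr0 addr0.
have {Ln0}Lp : 0 < L by rewrite lt_neqAle eq_sym Ln0.
move=> wy wy' p0.
have fin z : (L%:E * F z)%E != +oo%E -> exists2 f : R, 0 <= f & F z = f%:E.
  have := integrand_ge0 HF z; case: (F z) => [f| |]//.
    by rewrite lee_fin => f0 _; exists f.
  by move=> _; rewrite mulry gtr0_sg// mul1e eqxx.
have [f f0 fE] := fin _ wy; have [f' f0' fE'] := fin _ wy'.
rewrite fE fE'.
have -> : ((2^-1)%:E * (L%:E * f%:E + L%:E * f'%:E))%E = (L%:E * (2^-1 * (f + f'))%:E)%E.
  have E : 2^-1 * (L * f + L * f') = L * (2^-1 * (f + f')) by ring.
  by rewrite -[RHS]EFinM -E.
rewrite lee_pmul2l//.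
rewrite leNgt; apply/negP => /(integrand_affine HF)[a [b [le lt]]].
have := le (fun i => w i / L); have := le (fun i => w' i / L).
rewrite fE fE' !lee_fin.
have E : \sum_i b i * ((2^-1 * w i + 2^-1 * w' i) / L) =
    2^-1 * (\sum_i b i * (w i / L)) + 2^-1 * (\sum_i b i * (w' i / L)).
  by rewrite !mulr_sumr -big_split/=; apply: eq_bigr => i _; ring.
rewrite E in lt; lra.
Qed.

Lemma action_midpoint v v' :
  (total_density_action F l (fun i => clin 2^-1 2^-1 (v i) (v' i)) <=
   (2^-1)%:E * (total_density_action F l v + total_density_action F l v'))%E.
Proof.
rewrite (total_density_action_sup cgB HF); apply/ereal_supP => _ [n _ <-].
apply: (@le_trans _ _ ((2^-1)%:E * (cell_action B F l v n + cell_action B F l v' n))%E).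
  rewrite -big_split/= ge0_sume_distrr; last first.
    by move=> s _; rewrite adde_ge0//; apply: perspective_ge0 => //; exact: fine_ge0.
  apply: lee_sum => s _; have mc := measurable_cell cgB s.
  rewrite (_ : (fun i => _) = (fun i => 2^-1 * fine (v i (cell B s)) +
      2^-1 * fine (v' i (cell B s)))).
    by apply: perspective_midpoint; exact: fine_ge0.
  apply/funext => i; rewrite clinE fineD ?fineM//;
    by rewrite ?fin_numM ?fin_num_measure.
apply: lee_wpmul2l; first by rewrite lee_fin invr_ge0.
by apply: leeD; exact: (cell_action_le cgB HF).
Qed.

(** Each discretisation reads finitely many values of the charges, so setwise convergence makes it
    lower semicontinuous, and a supremum of such functionals remains so. On a null cell, a nonzero
    limit value forces nonzero values eventually, hence the value +oo. *)
Lemma action_lsc (v : nat -> 'I_N -> {charge set T -> \bar R}) v' :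
  (forall i A, measurable A -> forall e : R, 0 < e -> exists n0, forall n,
    (n0 <= n)%N -> `|fine (v n i A) - fine (v' i A)| <= e) ->
  ev_ge (fun n => total_density_action F l (v n)) (total_density_action F l v').
Proof.
move=> h c; rewrite (total_density_action_sup cgB HF) => /ereal_sup_gt[_ [k _ <-]] ck.
have p0 (L : R) w : 0 <= L -> (0 <= perspective F L w)%E by exact: perspective_ge0.
have : ev_ge (fun n => cell_action B F l (v n) k) (cell_action B F l v' k).
  apply: ev_ge_sum => s; first by apply: p0; exact: fine_ge0.
  have mc := measurable_cell cgB s.
  have hs i := h i _ mc.
  have fl : 0 <= fine (l (cell B s)) by exact: fine_ge0.
  rewrite /perspective; case: ifPn => [_|Ln0].
    case: asboolP => [_|]; first by apply: ev_ge0 => n; case: ifP.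
    move=> /existsNP[i wi] c' _.
    have wi0 : 0 < `|fine (v' i (cell B s))| / 2 by rewrite divr_gt0// normr_gt0; exact/eqP.
    have [n0 hn0] := hs i _ wi0; exists n0 => n /hn0 hn.
    case: asboolP => [wn|]; last by rewrite leey.
    exfalso; move: hn; rewrite wn sub0r normrN leNgt => /negP[].
    by rewrite [X in _ < X]splitr ltrDl.
  have Lp : 0 < fine (l (cell B s)) by rewrite lt_neqAle eq_sym Ln0.
  apply: ev_geZ => //; apply: (integrand_lsc HF) => i e e0.
  have [n0 hn0] := hs i _ (mulr_gt0 e0 Lp); exists n0 => n /hn0.
  by rewrite -mulrBl normrM normfV (gtr0_norm Lp) ler_pdivrMr.
move=> /(_ _ ck)[n0 hn0]; exists n0 => n /hn0 /le_trans; apply.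
exact: (cell_action_le cgB HF).
Qed.

End action_properties.

(** * The energy: parallelogram inequality and control of the total variation *)

Section energy.
Context {d} {T : measurableType d} {R : realType}.
Variable B : nat -> set T.
Hypothesis cgB : countably_generates B.
Variable l : {finite_measure set T -> \bar R}.
Implicit Types nu : {charge set T -> \bar R}.

(** The squared L2 norm of the density with respect to l, and +oo for charges that are not
    absolutely continuous. *)
Definition energy nu : \bar R :=
  total_density_action (fun z : 'I_1 -> R => (z ord0 ^+ 2)%:E) l (fun=> nu).

Lemma energy_ge0 nu : (0 <= energy nu)%E.
Proof. exact/total_density_action_ge0/square_integrandP. Qed.

Lemma energyE nu : nu `<< l -> energy nu = (\int[l]_y (density l nu y ^+ 2)%:E)%E.
Proof. by move=> nul; rewrite /energy /total_density_action asboolT. Qed.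

Lemma energy_lty nu : (energy nu < +oo)%E -> nu `<< l.
Proof. by rewrite /energy /total_density_action; case: asboolP => // /(_ ord0). Qed.

Lemma energy_coercive N (F : ('I_N -> R) -> \bar R) : integrand F ->
  exists2 C, 0 <= C & forall (v : 'I_N -> {charge set T -> \bar R}) i,
    (energy (v i) <= C%:E * l setT + C%:E * total_density_action F l v)%E.
Proof.
move=> HF; have [C C0 hC] := integrand_coercive HF.
(* A positive factor is needed where the action is +oo, since 0 times +oo is 0. *)
exists (C + 1) => [|v i]; first by rewrite addr_ge0.
have C1 : 0 < C + 1 by rewrite ltr_wpDl.
rewrite /total_density_action; case: asboolP => [vl|_]; last first.
  rewrite gt0_muley ?lte_fin// addey ?leey//.
  by rewrite gt_eqF// (lt_le_trans (ltNyr 0))// mule_ge0// lee_fin ltW.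
have mF : measurable_fun setT (fun y => F (fun i => density l (v i) y)).
  by apply: (integrand_measurable HF) => j; exact: measurable_density.
have F0 z := integrand_ge0 HF z.
rewrite energyE// -integral_cst// -ge0_integralZl//; last by rewrite lee_fin ltW.
rewrite -ge0_integralD//; last 3 first.
- by move=> y _; rewrite lee_fin ltW.
- by move=> y _; rewrite mule_ge0// lee_fin ltW.
- exact: measurable_funeM.
apply: ge0_le_integral => //.
- by move=> y _; rewrite lee_fin sqr_ge0.
- by apply/measurable_EFinP/measurable_funX; exact: measurable_density.
- by apply: emeasurable_funD => //; exact: measurable_funeM.
- move=> y _; apply: le_trans (hC (fun i => density l (v i) y) i) _.
  apply: leeD; first by rewrite lee_fin lerDl.
  by apply: lee_wpmul2r => //; rewrite lee_fin lerDl.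
Qed.

Lemma density_clin r s nu nu' : nu `<< l -> nu' `<< l ->
  {ae l, forall y, density l (clin r s nu nu') y =
    r * density l nu y + s * density l nu' y}.
Proof.
move=> nul nul'.
have lc : clin r s nu nu' `<< l.
  by apply: dominates_cadd; exact: dominates_cscalel.
have l1 := density_L1 nul; have l2 := density_L1 nul'.
have l1' : l.-integrable setT (EFin \o (fun y => r * density l nu y)).
  rewrite (_ : _ \o _ = fun y => (r%:E * (density l nu y)%:E)%E)//.
  exact: integrableZl.
apply: density_ae => //; first exact: integrable_lin.
move=> A mA; rewrite clinE.
have iA (f : T -> R) : l.-integrable setT (EFin \o f) -> l.-integrable A (EFin \o f).
  exact: integrableS.
under eq_integral do rewrite EFinD !EFinM.
rewrite integralD//=; last 2 first.
- by apply: integrableZl => //; exact: iA.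
- by apply: integrableZl => //; exact: iA.
rewrite !integralZl//; [|exact: iA|exact: iA].
rewrite (Radon_Nikodym_integral nul mA) (Radon_Nikodym_integral nul' mA).
by congr (_ * _ + _ * _)%E; apply: eq_integral => y _; rewrite fineK// Radon_Nikodym_fin_num.
Qed.

(** The identity holds almost everywhere between densities. The inequality also covers infinite
    energies, where the right side is +oo. *)
Lemma energy_parallelogram nu nu' :
  (energy (clin 1 (-1) nu nu') + 4%:E * energy (clin 2^-1 2^-1 nu nu') <=
   2%:E * (energy nu + energy nu'))%E.
Proof.
have [e1|] := ltP (energy nu) +oo%E; last first.
  rewrite leye_eq => /eqP ->; rewrite addye ?gt0_muley ?leey ?lte_fin//.
  by rewrite gt_eqF// (lt_le_trans (ltNyr 0) (energy_ge0 _)).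
have [e2|] := ltP (energy nu') +oo%E; last first.
  rewrite leye_eq => /eqP ->; rewrite addey ?gt0_muley ?leey ?lte_fin//.
  by rewrite gt_eqF// (lt_le_trans (ltNyr 0) (energy_ge0 _)).
have nul := energy_lty e1; have nul' := energy_lty e2.
have lc r s : clin r s nu nu' `<< l.
  by apply: dominates_cadd; exact: dominates_cscalel.
have mq mu : measurable_fun setT (fun y => (density l mu y ^+ 2)%:E).
  by apply/measurable_EFinP/measurable_funX; exact: measurable_density.
have q0 mu y : (0 <= (density l mu y ^+ 2)%:E)%E by rewrite lee_fin sqr_ge0.
rewrite !energyE// -!ge0_integralZl// -!ge0_integralD//; last 2 first.
- by move=> y _; rewrite mule_ge0// lee_fin.
- exact: measurable_funeM.
rewrite -ge0_integralZl//; last 2 first.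
- exact: emeasurable_funD.
- by move=> y _; rewrite adde_ge0.
apply: ae_ge0_le_integral => //.
- by move=> y _; rewrite adde_ge0// mule_ge0// lee_fin.
- by apply: emeasurable_funD => //; exact: measurable_funeM.
- by move=> y _; rewrite mule_ge0 ?lee_fin// addr_ge0// sqr_ge0.
- by apply: measurable_funeM; exact: emeasurable_funD.
have h1 := density_clin 1 (-1) nul nul'.
have h2 := density_clin 2^-1 2^-1 nul nul'.
apply: filterS2 h1 h2 => y -> -> _.
have E (a b : R) : (1 * a + -1 * b) ^+ 2 + 4 * (2^-1 * a + 2^-1 * b) ^+ 2 =
    2 * (a ^+ 2 + b ^+ 2) by field.
suff : (1 * density l nu y + -1 * density l nu' y) ^+ 2 +
  4 * (2^-1 * density l nu y + 2^-1 * density l nu' y) ^+ 2 <=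
  2 * (density l nu y ^+ 2 + density l nu' y ^+ 2) by [].
by rewrite E.
Qed.

(** Cauchy-Schwarz on every cell, in the form weighted by h. No square root appears, so the bound
    can be integrated in time and summed. *)
Lemma total_variation_le_energy (h : R) nu : 0 < h ->
  (Defs.total_variation nu <= h%:E * energy nu + (h^-1)%:E * l setT)%E.
Proof.
move=> h0; rewrite (total_variation_sup cgB); apply/ereal_supP => _ [n _ <-].
rewrite /energy; pose F := fun z : 'I_1 -> R => (z ord0 ^+ 2)%:E.
apply: (@le_trans _ _ (h%:E * cell_action B F l (fun=> nu) n + (h^-1)%:E * l setT)%E);
  last first.
  rewrite leeD2r// lee_wpmul2l ?lee_fin ?(ltW h0)//.
  exact: (cell_action_le cgB (@square_integrandP R)).
have P0 (s : {ffun 'I_n -> bool}) : (0 <= perspective F (fine (l (cell B s)))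
    (fun=> fine (nu (cell B s))))%E.
  by apply: perspective_ge0; [exact: square_integrandP|exact: fine_ge0].
rewrite /cell_action ge0_sume_distrr// (measure_cell_sum cgB l n measurableT).
rewrite ge0_sume_distrr// -big_split/=; apply: lee_sum => s _; rewrite setTI.
have mc := measurable_cell cgB s.
have fl : l (cell B s) \is a fin_num by exact: fin_num_measure.
have fn : nu (cell B s) \is a fin_num by exact: fin_num_measure.
rewrite /perspective; case: ifPn => [/eqP l0|l0].
  case: asboolP => [/(_ ord0) nu0|_]; last first.
    rewrite gt0_muley ?lte_fin// addye ?leey// gt_eqF//.
    by rewrite (lt_le_trans (ltNyr 0))// mule_ge0// lee_fin invr_ge0 ltW.
  by rewrite -(fineK fn) nu0 abse0 mule0 add0e mule_ge0// lee_fin invr_ge0 ltW.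
have Lp : 0 < fine (l (cell B s)) by rewrite lt_neqAle eq_sym l0 fine_ge0.
rewrite /F; move: Lp; rewrite -(fineK fl) -(fineK fn) /=.
set L := fine (l _); set w := fine (nu _) => Lp.
rewrite -!EFinM -EFinD lee_fin [h^-1 * _]mulrC.
apply: norm_le_amgm => //; first exact: ltW.
  by rewrite mulr_ge0 ?sqr_ge0// ltW.
rewrite le_eqVlt; apply/orP; left; apply/eqP; field.
by rewrite gt_eqF.
Qed.

End energy.

(** * Paths of measures *)

Section rV_basis.
Context {R : realType} {d : nat}.

(** Balls with rational centres and radii 1 / (k + 1); indices that decode to nothing give the empty
    set. The family serves twice: it generates the Borel sets, and since it is a basis of the
    topology, continuity can be read on codes. *)
Definition rational_ball (j : nat) : set 'rV[R]_d :=
  if @unpickle ('rV[rat]_d * nat)%type j is Some (q, k) then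
    ball (map_mx ratr q : 'rV[R]_d) k.+1%:R^-1
  else set0.

Lemma rational_ball_basis (y : 'rV[R]_d) (e : R) : 0 < e ->
  exists2 j, rational_ball j y & rational_ball j `<=` ball y e.
Proof.
(* Two points of a ball of radius 1 / (k + 1) are at distance less than 2 / (k + 1), which is at
   most e. *)
move=> e0; pose k := Num.truncn (2 / e).
have k0 : 0 < (k.+1%:R : R) by rewrite ltr0n.
have ke : 2 * k.+1%:R^-1 <= e.
  rewrite ler_pdivrMr// -ler_pdivrMl// mulrC ltW// truncnS_gt//.
have r0 : 0 < (k.+1%:R^-1 : R) by rewrite invr_gt0.
have qs (i : 'I_d) : exists q : rat, `|ratr q - y ord0 i| < k.+1%:R^-1.
  have [|q] := @rat_in_itvoo R (y ord0 i - k.+1%:R^-1) (y ord0 i + k.+1%:R^-1).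
    by rewrite ltrBlDr -addrA ltrDl addr_gt0.
  by rewrite in_itv /= => h; exists q; rewrite ltr_distl.
have [q hq] := choice qs.
exists (pickle (\row_i q i, k)).
  rewrite /rational_ball pickleK; split => // i j; rewrite !mxE /ball /=.
  by rewrite (ord1 i) hq.
rewrite /rational_ball pickleK => z [_ hz]; split => // i j.
have := hz i j; have := hq j; rewrite (ord1 i) !mxE /ball /= => h1 h2.
rewrite distrC in h1.
have -> : y ord0 j - z ord0 j = (y ord0 j - ratr (q j)) + (ratr (q j) - z ord0 j).
  by ring.
apply: le_lt_trans (ler_normD _ _) _; apply: lt_le_trans ke.
by rewrite mulrDl !mul1r ltrD.
Qed.

Lemma countably_generates_rational_ball :
  countably_generates (rational_ball : nat -> set (borel_rV R d)).
Proof.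
split.
  move=> j; apply: sub_sigma_algebra; rewrite /rational_ball.
  case: unpickle => [[q k]|]; last exact: open0.
  by apply: ball_open; rewrite invr_gt0 ltr0n.
apply: smallest_sub; first exact: smallest_sigma_algebra.
move=> O oO.
have -> : O = \bigcup_(j in [set j | rational_ball j `<=` O]) rational_ball j.
  apply/seteqP; split => [y Oy|y [j jO jy]]; last exact: jO.
  have /nbhs_ballP[e /= e0 eO] := open_nbhs_nbhs (conj oO Oy).
  have [j jy je] := rational_ball_basis y e0.
  by exists j => //; exact: subset_trans eO.
rewrite bigcup_mkcond.
apply: sigma_algebra_bigcup => j; case: ifPn => _; last exact: sigma_algebra0.
by apply: sub_sigma_algebra; exists j.
Qed.

End rV_basis.

(** * Integrals of continuous functions against charges, measurably in time *)

Section measurable_cint.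
Context {d} {T : measurableType d} {R : realType}.
Variable B : nat -> set T.
Hypothesis cgB : countably_generates B.

Lemma measurable_code_comp n D (a : {ffun 'I_n -> bool} -> R) :
  measurable_fun D (fun y => a (code B n y)).
Proof. exact/measurable_funTS/(measurable_code_fun cgB). Qed.

Lemma cint_code (nu : {charge set T -> \bar R}) n D
    (a : {ffun 'I_n -> bool} -> R) : measurable D ->
  charge_integral nu D (fun y => a (code B n y)) =
  \sum_s a s * fine (nu (D `&` cell B s)).
Proof.
move=> mD.
have E y : a (code B n y) = 0 + \sum_s a s * \1_(cell B s) y.
  rewrite add0r (bigD1 (code B n y))//= big1 => [|s sn].
    by rewrite indicE mem_set// mulr1 addr0.
  rewrite indicE memNset ?mulr0//= => cs.
  by move: sn; rewrite cs eqxx.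
have H (k : {finite_measure set T -> \bar R}) :
    \int[k]_(y in D) a (code B n y) = \sum_s a s * fine (k (D `&` cell B s)).
  under eq_Rintegral do rewrite E.
  have [|_ ->] := @Rintegral_affine _ _ _ k _ (index_enum {ffun 'I_n -> bool})
      (fun s => \1_(cell B s)) 0 a D mD.
    move=> s; apply: integrable_indic => //; exact: measurable_cell.
  rewrite mul0r add0r; apply: eq_bigr => s _.
  rewrite /Rintegral integral_indic//; last exact: measurable_cell.
  by rewrite setIC.
rewrite cintE !H -sumrB; apply: eq_bigr => s _.
have mDs : measurable (D `&` cell B s) by apply: measurableI => //; exact: measurable_cell.
by rewrite -mulrBr charge_jordan// fineB// fin_num_measure.
Qed.

Variables (D : set T) (g : T -> R) (C : R).
Hypothesis mD : measurable D.
Hypothesis gC : forall y, D y -> `|g y| <= C.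
Hypothesis g_code : forall y, D y -> forall e, 0 < e -> exists n, forall z, D z ->
  code B n z = code B n y -> `|g z - g y| < e.
Variable pt : forall n, {ffun 'I_n -> bool} -> T.
Hypothesis ptP : forall n y, D y -> D (pt (code B n y)) /\
  code B n (pt (code B n y)) = code B n y.

(** Sampling g at one point of each cell gives functions that are constant on cells. Codes of length
    n >= n0 determine those of length n0, so the estimate of [g_code] persists. *)
Lemma code_sample_cvg y : D y -> g (pt (code B n y)) @[n --> \oo] --> g y.
Proof.
move=> Dy; apply/cvgrPdist_lt => e e0; have [n0 h] := g_code Dy e0.
exists n0 => // n /= n0n; rewrite distrC; have [Dp cp] := ptP n Dy.
apply: h => //; apply/ffunP => i.
have /ffunP/(_ (widen_ord n0n i)) := cp.
by rewrite !ffunE.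
Qed.

Lemma code_continuous_measurable : measurable_fun D g.
Proof.
apply: (measurable_fun_cvg (h := fun n y => g (pt (code B n y)))).
  by move=> n; exact: (@measurable_code_comp n D (fun s => g (pt s))).
exact: code_sample_cvg.
Qed.

Lemma cint_code_cvg (nu : {charge set T -> \bar R}) :
  charge_integral nu D (fun y => g (pt (code B n y))) @[n --> \oo] -->
  charge_integral nu D g.
Proof.
have H (k : {finite_measure set T -> \bar R}) :
    (\int[k]_(y in D) g (pt (code B n y)) : R)@[n --> \oo] --> \int[k]_(y in D) g y.
  have kf : (k setT < +oo)%E by rewrite ltey_eq fin_num_measure.
  have mg := code_continuous_measurable.
  apply: fine_cvg; rewrite fineK; last first.
    by apply: integrable_fin_num => //; exact: (integrable_bounded kf mD mg gC).
  apply: (@dominated_cvg _ _ _ k D mD _ _ (fun=> C%:E)) => //.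
  - move=> n; apply/measurable_EFinP.
    exact: (@measurable_code_comp n D (fun s => g (pt s))).
  - by move=> y Dy; apply: cvg_EFin; [exact: nearW|exact: code_sample_cvg].
  - exact: finite_measure_integrable_cst.
  - by move=> n y Dy; rewrite lee_fin; apply: gC; case: (ptP n Dy).
by rewrite cintE; under eq_fun do rewrite cintE; apply: cvgB; exact: H.
Qed.

End measurable_cint.

Section measurable_path.
Context {d} {T : measurableType d} {R : realType}.
Variable B : nat -> set T.
Hypothesis cgB : countably_generates B.
Context {d'} {U : measurableType d'}.
Variables (I : set U) (D : set T) (g : U -> T -> R) (C : R).
Hypothesis mD : measurable D.
Hypothesis mg : forall y, D y -> measurable_fun I (g ^~ y).
Hypothesis gC : forall t y, I t -> D y -> `|g t y| <= C.
Hypothesis g_code : forall t, I t -> forall y, D y -> forall e, 0 < e ->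
  exists n, forall z, D z -> code B n z = code B n y -> `|g t z - g t y| < e.

(** Cells that miss D receive an arbitrary point of D. The points do not depend on t. *)
Lemma sample_points : (exists y, D y) ->
  exists pt : forall n, {ffun 'I_n -> bool} -> T, (forall n s, D (pt n s)) /\
  forall n y, D y -> code B n (pt n (code B n y)) = code B n y.
Proof.
move=> [y0 Dy0].
have H n (s : {ffun 'I_n -> bool}) : exists z, D z /\ forall y, D y -> code B n y = s ->
    code B n z = s.
  have [[y [Dy ys]]|h] := pselect (exists y, D y /\ code B n y = s).
    by exists y; split.
  by exists y0; split => // y Dy ys; exfalso; apply: h; exists y.
have [pt hpt] : exists pt : forall n, {ffun 'I_n -> bool} -> T, forall n s,
    D (pt n s) /\ forall y, D y -> code B n y = s -> code B n (pt n s) = s.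
  exists (fun n s => projT1 (cid (H n s))) => n s; exact: (projT2 (cid (H n s))).
exists pt; split => [n s|n y Dy]; first by case: (hpt n s).
by have [_ /(_ y Dy erefl)] := hpt n (code B n y).
Qed.

(** The charge and the integrand both move with t. Sampling on cells presents the integral as a
    limit of finite sums of products of functions measurable in t. *)
Lemma measurable_fun_cint (nu : U -> {charge set T -> \bar R}) :
  (forall A, measurable A -> measurable_fun I (fun t => nu t A)) ->
  measurable_fun I (fun t => charge_integral (nu t) D (g t)).
Proof.
move=> mnu.
have [/sample_points[pt [Dpt cpt]]|D0] := pselect (exists y, D y); last first.
  have -> : D = set0 by apply/seteqP; split => // y Dy; apply: D0; exists y.
  under eq_fun do rewrite cintE !Rintegral_set0 subrr.
  exact: measurable_cst.
apply: (measurable_fun_cvg (h := fun n t =>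
  charge_integral (nu t) D (fun y => g t (pt n (code B n y))))).
  move=> n; under eq_fun do rewrite (@cint_code _ _ _ _ cgB _ _ _ (fun s => g _ (pt n s)) mD).
  apply: measurable_sum => s; apply: measurable_funM; first exact: mg.
  apply: measurableT_comp; first exact: fine_measurable.
  by apply: mnu; apply: measurableI => //; exact: measurable_cell.
move=> t It; apply: (cint_code_cvg cgB mD _ (g_code It)) => [y|n y Dy]; first exact: gC.
by split => //; exact: cpt.
Qed.

Lemma measurable_fun_code_continuous t : I t -> measurable_fun D (g t).
Proof.
move=> It; have [/sample_points[pt [Dpt cpt]]|D0] := pselect (exists y, D y).
  by apply: (code_continuous_measurable cgB (g_code It)) => n y Dy; split => //; exact: cpt.
have -> : D = set0 by apply/seteqP; split => // y Dy; apply: D0; exists y.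
exact: measurable_fun_set0.
Qed.

End measurable_path.

#[local] Instance lebesgue_ae_filter (R : realType) :
  Filter (almost_everywhere (@lebesgue_measure R)) := ae_filter_ringOfSetsType _.

Section paths.
Context {d} {T : measurableType d} {R : realType}.
Variable B : nat -> set T.
Hypothesis cgB : countably_generates B.
Local Notation signed := (charge T R).
Implicit Types (nu : signed) (w : R -> signed).

Local Notation I01 := (`[0, 1]%classic : set R).
Local Notation leb := (@lebesgue_measure R).

Definition charge_diff nu nu' : signed := clin 1 (-1) nu nu'.

Lemma total_variation_fin nu : Defs.total_variation nu \is a fin_num.
Proof. by rewrite total_variationE fin_num_measure. Qed.

Lemma total_variation_ge0 nu : (0 <= Defs.total_variation nu)%E.
Proof. by rewrite total_variationE. Qed.

(** The hypothesis is summed over the cells of each partition, which avoids comparing three Hahn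
    decompositions. *)
Lemma total_variation_le (r s : R) nu nu1 nu2 : 0 <= r -> 0 <= s ->
  (forall A, measurable A -> (`|nu A| <= r%:E * `|nu1 A| + s%:E * `|nu2 A|)%E) ->
  (Defs.total_variation nu <=
   r%:E * Defs.total_variation nu1 + s%:E * Defs.total_variation nu2)%E.
Proof.
move=> r0 s0 h; rewrite (total_variation_sup cgB); apply/ereal_supP => _ [n _ <-].
have up (mu : signed) : (\sum_(c : {ffun 'I_n -> bool}) `|mu (cell B c)| <= Defs.total_variation mu)%E.
  by rewrite (total_variation_sup cgB); apply: ereal_sup_ubound; exists n.
apply: (@le_trans _ _ (\sum_(c : {ffun 'I_n -> bool})
    (r%:E * `|nu1 (cell B c)| + s%:E * `|nu2 (cell B c)|))%E).
  by apply: lee_sum => c _; apply: h; exact: measurable_cell.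
rewrite big_split/= -!ge0_sume_distrr//; apply: leeD;
  by apply: lee_wpmul2l; rewrite ?lee_fin.
Qed.

Lemma total_variation_clin (r s : R) nu nu' :
  (Defs.total_variation (clin r s nu nu') <=
   `|r|%:E * Defs.total_variation nu + `|s|%:E * Defs.total_variation nu')%E.
Proof.
apply: total_variation_le => // A mA; rewrite clinE.
apply: le_trans (lee_abs_add _ _) _.
by rewrite !abseM.
Qed.

Lemma total_variation_diff nu nu' :
  (Defs.total_variation nu <=
   Defs.total_variation (charge_diff nu nu') + Defs.total_variation nu')%E.
Proof.
rewrite -[X in (_ <= X + _)%E]mul1e -[X in (_ <= _ + X)%E]mul1e.
apply: total_variation_le => // A mA.
rewrite !mul1e clinE.
have : nu A \is a fin_num by exact: fin_num_measure.
have : nu' A \is a fin_num by exact: fin_num_measure.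
case: (nu' A) => [b| |]// _; case: (nu A) => [a| |]// _.
have E : a = (1 * a + -1 * b) + b by ring.
suff : `|a| <= `|1 * a + -1 * b| + `|b| by [].
rewrite {1}E; exact: ler_normD.
Qed.

Lemma measurable_total_variation {d'} {U : measurableType d'} (I : set U)
    (w : U -> signed) : measurable I ->
  (forall A, measurable A -> measurable_fun I (fun t => w t A)) ->
  measurable_fun I (fun t => Defs.total_variation (w t)).
Proof.
move=> mI mw.
rewrite (_ : (fun t => _) =
    (fun t => esups (fun n => \sum_(c : {ffun 'I_n -> bool}) `|w t (cell B c)|)%E 0)).
  apply: measurable_fun_esups => n; apply: emeasurable_sum => c.
  by apply: measurableT_comp => //; apply: mw; exact: measurable_cell.
apply/funext => t; rewrite (total_variation_sup cgB) /esups.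
by congr ereal_sup; apply/seteqP; split => _ [n _ <-]; exists n.
Qed.

Lemma measure_path_bound U w w1 w2 (r s : R) :
  measure_path U w1 -> measure_path U w2 -> 0 <= r -> 0 <= s ->
  (forall t, t \in `[0, 1] -> concentrated U (w t)) ->
  (forall A, measurable A -> measurable_fun I01 (fun t => w t A)) ->
  {ae leb, forall t, I01 t -> (Defs.total_variation (w t) <=
     r%:E * Defs.total_variation (w1 t) + s%:E * Defs.total_variation (w2 t))%E} ->
  measure_path U w.
Proof.
move=> [_ _ i1] [_ _ i2] r0 s0 cw mw h; split => //.
have mT := measurable_total_variation (measurable_itv _) mw.
apply/integrableP; split => //.
have ii : leb.-integrable I01 (fun t => r%:E * Defs.total_variation (w1 t) +
    s%:E * Defs.total_variation (w2 t))%E.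
  by apply: integrableD => //; exact: integrableZl.
have p0 mu : (0 <= Defs.total_variation mu)%E := total_variation_ge0 mu.
have /integrableP[mi] := ii; apply: le_lt_trans; apply: ae_ge0_le_integral => //.
- by apply: measurableT_comp.
- by apply: measurableT_comp.
apply: filterS h => t h /h h'.
by rewrite !gee0_abs// adde_ge0// mule_ge0// lee_fin.
Qed.

Lemma measure_path_clin U (r s : R) w w' : measure_path U w -> measure_path U w' ->
  measure_path U (fun t => clin r s (w t) (w' t)).
Proof.
move=> hw hw'; have [cw mw _] := hw; have [cw' mw' _] := hw'.
apply: (measure_path_bound hw hw' (normr_ge0 r) (normr_ge0 s)).
- by move=> t tI A mA AU; rewrite clinE cw// cw'// !mule0 adde0.
- move=> A mA; rewrite (_ : (fun t => _) = (fun t => r%:E * w t A + s%:E * w' t A)%E)//.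
  by apply: emeasurable_funD; apply: measurable_funeM; [exact: mw|exact: mw'].
- by apply: aeW => t _; exact: total_variation_clin.
Qed.

Definition path_variation w : \bar R := (\int[leb]_(t in I01) Defs.total_variation (w t))%E.

Lemma path_variation_ge0 w : (0 <= path_variation w)%E.
Proof. by apply: integral_ge0 => t _; exact: total_variation_ge0. Qed.

Lemma path_variation_fin U w : measure_path U w -> path_variation w \is a fin_num.
Proof. by case=> _ _ h; exact: integrable_fin_num. Qed.

(** The increments are summable in total variation at almost every t, and there
    [charge_series_limit] provides a limit. Integrating the tails over time gives convergence of the
    whole path. *)
Lemma path_limit U (w : nat -> R -> signed) : (forall k, measure_path U (w k)) ->
  (\sum_(0 <= k <oo)
     path_variation (fun t => charge_diff (w k.+1 t) (w k t)) < +oo)%E ->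
  exists w' : R -> signed, [/\ measure_path U w',
    ev_le (fun n => path_variation (fun t => charge_diff (w' t) (w n t))) 0%E &
    {ae leb, forall t, I01 t -> forall A, measurable A -> forall e : R, 0 < e ->
      exists n0, forall n, (n0 <= n)%N -> `|fine (w n t A) - fine (w' t A)| <= e}].
Proof.
move=> pw sw.
have mw k A : measurable A -> measurable_fun I01 (fun t => w k t A).
  by move=> mA; have [_ + _] := pw k; apply.
have mI : measurable I01 by exact: measurable_itv.
pose D k t := charge_diff (w k.+1 t) (w k t).
pose V k t := Defs.total_variation (D k t).
have V0 k t : (0 <= V k t)%E by exact: total_variation_ge0.
have mV k : measurable_fun I01 (V k).
  have [_ h _] := measure_path_clin 1 (-1) (pw k.+1) (pw k).
  exact: measurable_total_variation.
pose good t := (\sum_(0 <= k <oo) V k t < +oo)%E.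
have agood : {ae leb, forall t, I01 t -> good t}.
  by apply: (@ae_summable _ _ _ leb _ V).
have mgood : measurable_fun I01 (fun t => good t).
  apply: measurable_fun_lte => //.
  exact: (@ge0_emeasurable_sum _ _ _ I01 V xpredT).
(* The zero charge at exceptional times keeps the support condition valid for every t. The limits
   are chosen separately for each t; measurability in t comes back from setwise convergence on the
   measurable set of good times. *)
pose w' t := match pselect (good t) with
  | left h => projT1 (cid (charge_series_limit h)) | right _ => czero end.
have w'P t k A : good t -> measurable A ->
    (`|charge_diff (w' t) (w k t) A| <= \sum_(k <= j <oo) cvar (D j t) A)%E.
  move=> gt; rewrite /w'; case: pselect => // h; exact: (projT2 (cid (charge_series_limit h))).
have w'0 t A : ~ good t -> w' t A = 0%E by move=> gt; rewrite /w'; case: pselect.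
have tailV t e : good t -> 0 < e -> exists n0, forall n, (n0 <= n)%N ->
    (\sum_(n <= j <oo) V j t <= e%:E)%E.
  move=> gt e0; have [n0 hn0] := nneseries_tail_ev (V0 ^~ t) gt e0.
  by exists n0 => n /hn0; rewrite add0e.
have cv t A : good t -> measurable A -> forall e : R, 0 < e ->
    exists n0, forall n, (n0 <= n)%N -> `|fine (w n t A) - fine (w' t A)| <= e.
  move=> gt mA e /(tailV t e gt)[n0 hn0]; exists n0 => n /hn0 hn.
  rewrite -lee_fin; apply: le_trans hn; rewrite distrC.
  apply: (@le_trans _ _ (`|charge_diff (w' t) (w n t) A|)%E).
    rewrite clinE; have : w n t A \is a fin_num by exact: fin_num_measure.
    have : w' t A \is a fin_num by exact: fin_num_measure.
    case: (w' t A) => [a| |]// _; case: (w n t A) => [b| |]// _.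
    by rewrite -!EFinM -EFinD /= lee_fin mul1r mulN1r.
  apply: (le_trans (w'P _ _ _ gt mA)); apply: lee_nneseries => j _ //.
  by rewrite /V total_variationE le_measure ?inE.
have TVtail t n : good t ->
    (Defs.total_variation (charge_diff (w' t) (w n t)) <= \sum_(n <= j <oo) V j t)%E.
  move=> gt; rewrite total_variationE.
  apply: (@le_trans _ _ (mseries (fun j => cvar (D j t)) n setT)).
    by apply: cvar_le => // A mA; exact: w'P.
  by apply: lee_nneseries => j _ //; rewrite /V total_variationE.
have mw' A : measurable A -> measurable_fun I01 (fun t => w' t A).
  move=> mA; apply: (@emeasurable_fun_cvg _ _ _ _
      (fun n t => if `[< good t >] then w n t A else 0%E)).
    move=> n; apply: measurable_fun_if => //.
      rewrite (_ : (fun t => `[< good t >]) = (fun t => good t : bool)) //.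
      by apply/funext => t; rewrite asboolb.
    by apply: (measurable_funS mI) => //; exact: mw.
  move=> t It; case: asboolP => gt; last by rewrite w'0//; exact: cvg_cst.
  rewrite -[w' t A]fineK ?fin_num_measure//.
  apply/fine_cvgP; split; first by apply: nearW => n; exact: fin_num_measure.
  apply/cvgrPdist_le => e /(cv _ _ gt mA)[n0 hn0]; exists n0 => // n /= /hn0.
  by rewrite distrC.
have mdiff n : measurable_fun I01 (fun t => Defs.total_variation (charge_diff (w' t) (w n t))).
  apply: measurable_total_variation => // A mA.
  rewrite (_ : (fun t => _) = (fun t => 1%:E * w' t A + (-1)%:E * w n t A)%E)//.
  by apply: emeasurable_funD; apply: measurable_funeM; [exact: mw'|exact: mw].
have tailI n : (path_variation (fun t => charge_diff (w' t) (w n t)) <=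
    \sum_(n <= j <oo) path_variation (D j))%E.
  rewrite -nneseries_addn => [|j]; last exact: path_variation_ge0.
  rewrite /path_variation.
  rewrite -(@integral_nneseries _ _ _ leb I01 mI (fun j => V (j + n)%N) (fun j => mV _)
    (fun j t _ => V0 _ _)).
  apply: ae_ge0_le_integral => //.
  - exact: mdiff.
  - by move=> t _; apply: nneseries_ge0 => j _ _; exact: V0.
  - exact: (@ge0_emeasurable_sum _ _ _ I01 (fun j => V (j + n)%N) xpredT).
  apply: filterS agood => t h /h gt; apply: (le_trans (TVtail t n gt)).
  by rewrite -(nneseries_addn _ (V0 ^~ t)).
exists w'; split.
- split=> // [t It A mA AU|].
    have [gt|/w'0 -> //] := pselect (good t).
    rewrite -[w' t A]fineK ?fin_num_measure//; congr EFin; apply/eqP.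
    rewrite -normr_le0; apply/ler_addgt0Pr => e e0.
    have [n0 /(_ n0 (leqnn _))] := cv t A gt mA e e0.
    by have [/(_ t It A mA AU) -> _ _] := pw n0; rewrite /= sub0r normrN add0r.
  apply/integrableP; split; first exact: measurable_total_variation.
  have [_ _ /integrableP[m0 i0]] := pw 0%N.
  apply: (@le_lt_trans _ _ (path_variation (fun t => charge_diff (w' t) (w 0%N t)) +
      path_variation (w 0%N))%E).
    rewrite /path_variation -ge0_integralD//; last exact: mdiff.
    apply: ge0_le_integral => //.
    - by apply: measurableT_comp => //; exact: measurable_total_variation.
    - by apply: emeasurable_funD => //; exact: mdiff.
    - move=> t _; rewrite gee0_abs ?total_variation_ge0//.
      exact: total_variation_diff.
  apply: lte_add_pinfty; first exact: le_lt_trans (tailI 0%N) _.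
  by rewrite ltey_eq (path_variation_fin (pw 0%N)).
- move=> e e0; have [n0 hn0] := nneseries_tail_ev (fun j => path_variation_ge0 (D j)) sw e0.
  by exists n0 => n /hn0; apply: le_trans.
by apply: filterS agood => t h /h gt A mA; exact: cv.
Qed.

End paths.

Section flow.
Context {d} {T : measurableType d} {R : realType}.
Variable B : nat -> set T.
Hypothesis cgB : countably_generates B.
Implicit Types w : R -> charge T R.

Local Notation I01 := (`[0, 1]%classic : set R).
Local Notation leb := (@lebesgue_measure R).

(* When B is a basis of a topology, the last clause says that the [g t] are
   continuous on D. *)
Definition test_function (D : set T) (g : R -> T -> R) := exists C, [/\ 0 <= C,
  forall y, D y -> measurable_fun I01 (g ^~ y),
  forall t y, I01 t -> D y -> `|g t y| <= C &
  forall t, I01 t -> forall y, D y -> forall e, 0 < e ->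
    exists n, forall z, D z -> code B n z = code B n y -> `|g t z - g t y| < e].

Definition flow (D : set T) (g : R -> T -> R) w : R :=
  \int[leb]_(t in I01) charge_integral (w t) D (g t).

Variables (D : set T) (g : R -> T -> R).
Hypotheses (mD : measurable D) (gtest : test_function D g).

Lemma flow_integrable U w : measure_path U w ->
  leb.-integrable I01 (fun t => (charge_integral (w t) D (g t))%:E).
Proof.
move=> [_ mw iw]; have [C [C0 mg gC g_code]] := gtest.
have mI : measurable I01 by exact: measurable_itv.
have iC : leb.-integrable I01 (fun t => (C%:E * Defs.total_variation (w t))%E).
  exact: integrableZl.
apply: (@le_integrable _ _ _ leb _ mI _ _ _ _ iC).
  by apply/measurable_EFinP; apply: (measurable_fun_cint cgB mD mg gC g_code mw).
move=> t It.
have := total_variation_ge0 (w t); have := total_variation_fin (w t).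
have mgt := measurable_fun_code_continuous cgB g_code It.
have := cint_le (w t) mD mgt (gC t ^~ It) C0.
case: (Defs.total_variation (w t)) => [v| |]//= h _ v0.
apply: (@le_trans _ _ (C * v)%:E); first by rewrite lee_fin.
by rewrite lee_fin ler_norm.
Qed.

Lemma flow_clin U (r s : R) w w' : measure_path U w -> measure_path U w' ->
  flow D g (fun t => clin r s (w t) (w' t)) = r * flow D g w + s * flow D g w'.
Proof.
move=> pw pw'; have [C [C0 mg gC g_code]] := gtest.
have mI : measurable I01 by exact: measurable_itv.
have i1 := flow_integrable pw; have i2 := flow_integrable pw'.
rewrite /flow -!RintegralZl// -RintegralD//; last 2 first.
- by rewrite (_ : _ \o _ = fun t => (r%:E * (charge_integral (w t) D (g t))%:E)%E)//; exact: integrableZl.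
- by rewrite (_ : _ \o _ = fun t => (s%:E * (charge_integral (w' t) D (g t))%:E)%E)//; exact: integrableZl.
apply: eq_Rintegral => t; rewrite inE => It.
have mgt := measurable_fun_code_continuous cgB g_code It.
by apply: cint_lin => // y Dy; exact: gC.
Qed.

Lemma flow_le : exists2 K, 0 <= K & forall U w, measure_path U w ->
  `|flow D g w| <= K * fine (path_variation w).
Proof.
have [C [C0 mg gC g_code]] := gtest; exists C => // U w pw.
have mI : measurable I01 by exact: measurable_itv.
have ii := flow_integrable pw; have [_ mw iw] := pw.
rewrite /flow; apply: le_trans (@le_normr_Rintegral _ _ _ leb I01
  (fun t => charge_integral (w t) D (g t)) mI ii) _.
rewrite -lee_fin EFinM [X in (_ <= _ * X)%E]fineK ?(path_variation_fin pw)// /path_variation.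
have mT : measurable_fun I01 (fun t => Defs.total_variation (w t)).
  exact: (measurable_total_variation cgB mI mw).
rewrite -ge0_integralZl//.
rewrite /Rintegral fineK; last first.
  by apply: integrable_fin_num => //; have := integrable_norm ii.
apply: ge0_le_integral => //.
- by apply/measurable_EFinP; apply: measurableT_comp => //; apply/measurable_EFinP; case/integrableP: ii.
- exact: measurable_funeM.
move=> t It; rewrite -[Defs.total_variation _]fineK ?total_variation_fin//.
have mgt := measurable_fun_code_continuous cgB g_code It.
rewrite -EFinM lee_fin; apply: cint_le => // y; exact: gC.
Qed.

End flow.

(** * Linear conditions on families of paths *)

Section bounded_linear.
Context {d} {T : measurableType d} {R : realType} {C : finType}.
Variable B : nat -> set T.
Hypothesis cgB : countably_generates B.
Variable U : C -> set T.
Implicit Types (w : C -> R -> charge T R) (L : (C -> R -> charge T R) -> R).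

Definition family_path w := forall c, measure_path (U c) (w c).

Definition family_lin (r s : R) w w' := fun c t => clin r s (w c t) (w' c t).

Lemma family_path_lin r s w w' : family_path w -> family_path w' ->
  family_path (family_lin r s w w').
Proof. by move=> pw pw' c; exact: (measure_path_clin cgB). Qed.

(** Linearity is required on admissible families only, where the time integrals converge. The norm
    is the total variation integrated over time, summed over the components. *)
Definition bounded_linear L :=
  (forall r s w w', family_path w -> family_path w' ->
     L (family_lin r s w w') = r * L w + s * L w') /\
  (exists2 K, 0 <= K & forall w, family_path w ->
     `|L w| <= K * \sum_c fine (path_variation (w c))).

Lemma bounded_linear_eq L L' : (forall w, family_path w -> L w = L' w) ->
  bounded_linear L' -> bounded_linear L.
Proof.
move=> E [h [K K0 hK]]; split => [r s w w' pw pw'|].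
  by rewrite !E// ?h//; exact: family_path_lin.
by exists K => // w pw; rewrite E// hK.
Qed.

Lemma bounded_linear_flow c D g : measurable D -> test_function B D g ->
  bounded_linear (fun w => flow D g (w c)).
Proof.
move=> mD tg; split => [r s w w' pw pw'|]; first exact: (flow_clin cgB mD tg r s (pw c) (pw' c)).
have [K K0 hK] := flow_le cgB mD tg; exists K => // w pw.
apply: le_trans (hK _ _ (pw c)) _; rewrite ler_wpM2l//.
rewrite (bigD1 c)//= lerDl; apply: sumr_ge0 => j _.
by rewrite fine_ge0// path_variation_ge0.
Qed.

Lemma bounded_linear0 : bounded_linear (fun=> 0).
Proof.
split=> [r s w w' _ _|]; first by rewrite !mulr0 addr0.
by exists 0 => // w _; rewrite normr0 mul0r.
Qed.

Lemma bounded_linearD L L' : bounded_linear L -> bounded_linear L' ->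
  bounded_linear (fun w => L w + L' w).
Proof.
move=> [h [K K0 hK]] [h' [K' K0' hK']]; split => [r s w w' pw pw'|].
  by rewrite h// h'//; ring.
exists (K + K') => [|w pw]; first exact: addr_ge0.
by rewrite mulrDl (le_trans (ler_normD _ _))// lerD// ?hK ?hK'.
Qed.

Lemma bounded_linearN L : bounded_linear L -> bounded_linear (fun w => - L w).
Proof.
move=> [h [K K0 hK]]; split => [r s w w' pw pw'|]; first by rewrite h//; ring.
by exists K => // w pw; rewrite normrN hK.
Qed.

Lemma bounded_linear_sum (I : Type) (s : seq I) (P : pred I)
    (L : I -> (C -> R -> charge T R) -> R) :
  (forall i, P i -> bounded_linear (L i)) ->
  bounded_linear (fun w => \sum_(i <- s | P i) L i w).
Proof.
move=> h; elim: s => [|i s ih].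
  by apply: (bounded_linear_eq _ bounded_linear0) => w _; rewrite big_nil.
have [Pi|Pi] := boolP (P i); last first.
  by apply: (bounded_linear_eq _ ih) => w _; rewrite big_cons (negbTE Pi).
apply: (bounded_linear_eq _ (bounded_linearD (h i Pi) ih)) => w _.
by rewrite big_cons Pi.
Qed.

(** L w' - c equals L at the difference of w' and [w n], which is bounded by a multiple of their
    distance. *)
Lemma bounded_linear_closed L c (w : nat -> C -> R -> charge T R) w' :
  bounded_linear L -> (forall k, family_path (w k)) -> family_path w' ->
  (forall k, L (w k) = c) ->
  (forall i, ev_le (fun n => path_variation (fun t => charge_diff (w' i t) (w n i t))) 0%E) ->
  L w' = c.
Proof.
move=> [h [K K0 hK]] pw pw' Lc cv.
apply/eqP; rewrite -subr_eq0 -normr_le0; apply/ler_addgt0Pr => e e0; rewrite add0r.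
(* The summands 1 keep the divisor positive when K is 0 or there are no components. *)
have K1 : 0 < (K + 1) * (#|C|%:R + 1) by rewrite mulr_gt0// ltr_wpDl.
pose e' := e / ((K + 1) * (#|C|%:R + 1)).
have e'0 : 0 < e' by rewrite divr_gt0.
have [n0 hn0] : exists n0, forall n, (n0 <= n)%N -> forall i,
    (path_variation (fun t => charge_diff (w' i t) (w n i t)) <= e'%:E)%E.
  have /choice[f hf] : forall i, exists n0, forall n, (n0 <= n)%N ->
      (path_variation (fun t => charge_diff (w' i t) (w n i t)) <= e'%:E)%E.
    by move=> i; have [n0 hn0] := cv i _ e'0; exists n0 => n /hn0; rewrite add0e.
  exists (\max_i f i)%N => n hn i; apply: hf; apply: leq_trans hn; exact: leq_bigmax.
have {1}-> : c = L (w n0) by rewrite Lc.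
have -> : L w' - L (w n0) = L (family_lin 1 (-1) w' (w n0)) by rewrite h//; ring.
apply: le_trans (hK _ (family_path_lin 1 (-1) pw' (pw n0))) _.
apply: (@le_trans _ _ (K * \sum_(i : C) e')).
  rewrite ler_wpM2l//; apply: ler_sum => i _.
  by rewrite -lee_fin fineK ?hn0// (path_variation_fin (family_path_lin 1 (-1) pw' (pw n0) i)).
rewrite sumr_const -[e' *+ _]mulr_natl mulrA.
apply: (@le_trans _ _ ((K + 1) * (#|C|%:R + 1) * e')).
  by rewrite ler_pM2r// ler_pM// lerDl.
by rewrite /e' mulrC mulfVK// gt_eqF.
Qed.

End bounded_linear.

(** * The continuity equations *)

Lemma Rintegral_sum {d} {T : measurableType d} {R : realType}
    (mu : {measure set T -> \bar R}) (D : set T) (I : Type) (s : seq I) (f : I -> T -> R) :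
  measurable D -> (forall i, mu.-integrable D (EFin \o f i)) ->
  mu.-integrable D (EFin \o (fun t => \sum_(i <- s) f i t)) /\
  \int[mu]_(t in D) (\sum_(i <- s) f i t) = \sum_(i <- s) \int[mu]_(t in D) f i t.
Proof.
move=> mD fi; elim: s => [|i s [ih1 ih2]].
  under eq_fun do rewrite big_nil; rewrite big_nil Rintegral_cst//.
  split; last by rewrite mul0r.
  exact: integrable0.
rewrite big_cons -ih2 -RintegralD//.
have E : (fun t => \sum_(i <- i :: s) f i t) = (fun t => f i t + \sum_(i <- s) f i t).
  by apply/funext => t; rewrite big_cons.
rewrite E; split => //.
rewrite (_ : _ \o _ = (EFin \o f i) \+ (EFin \o (fun t => \sum_(i <- s) f i t)))//.
exact: integrableD.
Qed.

Lemma pair_continuous (S T U : topologicalType) (f : S -> T) (g : S -> U) :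
  continuous f -> continuous g -> continuous (fun s => (f s, g s)).
Proof. by move=> cf cg s; exact: (cvg_pair (cf s) (cg s)). Qed.

Section test_functions.
Context {R : realType} {d : nat}.

(** The map q is the identity in the bulk and [gamma_inv] along an edge. Compactness of [0, 1] x K
    gives the bound; a rational ball inside the neighbourhood given by continuity gives the
    condition on codes. *)
Lemma test_function_continuous (V : normedModType R) (q : 'rV[R]_d -> V) (K : set V)
    (D : set (borel_rV R d)) (h : R * V -> R) :
  continuous q -> compact K -> (forall y, D y -> K (q y)) -> continuous h ->
  test_function (rational_ball : nat -> set (borel_rV R d)) D (fun t y => h (t, q y)).
Proof.
move=> cq cK DK ch.
have /compact_bounded[M [_ hM]] : compact [set h p | p in `[0, 1]%classic `*` K].
  apply: continuous_compact; first exact: continuous_subspaceT.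
  by apply: compact_setX => //; exact: segment_compact.
exists (`|M| + 1); split.
- by rewrite addr_ge0.
- move=> y _; apply: measurable_funTS; apply: continuous_measurable_fun => t.
  have ct : continuous (fun t : R => (t, q y)) by apply: pair_continuous => s; [exact: cvg_id|exact: cvg_cst].
  exact: (@continuous_comp _ _ _ (fun t => (t, q y)) h t (ct t) (ch _)).
- move=> t y It Dy; apply: hM; first by rewrite (le_lt_trans (ler_norm _))// ltrDl.
  by exists (t, q y) => //; split => //=; exact: DK.
- move=> t It y Dy e e0.
  have : continuous (fun z => h (t, q z)).
    have ct : continuous (fun z => (t, q z)).
      by apply: pair_continuous => z; [exact: cst_continuous|exact: cq].
    by move=> z; exact: (@continuous_comp _ _ _ (fun z => (t, q z)) h z (ct z) (ch _)).
  move=> /(_ y)/cvgrPdist_lt/(_ e e0)/nbhs_ballP[r /= r0 hr].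
  have [j jy jr] := rational_ball_basis y r0.
  (* Length j + 1, so that the code records the ball of index j. *)
  exists j.+1 => z Dz /ffunP/(_ ord_max); rewrite !ffunE /= => zy.
  rewrite distrC; apply: hr; apply: jr; apply/asboolP.
  by rewrite zy; apply/asboolP.
Qed.

Lemma C1_continuous (V : normedModType R) (f : V -> R) : C1 f -> continuous f.
Proof. by move=> [df _] p; exact/differentiable_continuous. Qed.

End test_functions.

HB.instance Definition _ (R : realType) (d : nat) (G : metric_graph R)
    (x : vertex G -> 'rV[R]_d) (e : edge G) :=
  isMeasurableFun.Build _ _ _ _ (gamma_inv x e) (measurable_gamma_inv x e).

Lemma gamma_inv_continuous (R : realType) (d : nat) (G : metric_graph R)
    (x : vertex G -> 'rV[R]_d) (e : edge G) : continuous (gamma_inv x e : 'rV[R]_d -> R).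
Proof.
move=> y; apply: cvgMr_tmp; first exact: nbhs_filter.
apply: (@continuous_comp _ _ _ (fun y : 'rV[R]_d => y - x (src e)) (edot^~ (tau x e)));
  last exact: edot_continuous.
by apply: cvgB; [exact: nbhs_filter|exact: cvg_id|exact: cst_continuous].
Qed.

Lemma gamma_continuous (R : realType) (d : nat) (G : metric_graph R)
    (x : vertex G -> 'rV[R]_d) (e : edge G) : continuous (gamma x e).
Proof.
move=> s; apply: cvgD; first exact: cvg_cst.
by apply: cvgZr_tmp; apply: cvgMr_tmp; exact: cvg_id.
Qed.

Lemma compact_measurable (R : realType) (d : nat) (K : set 'rV[R]_d) :
  compact K -> measurable (K : set (borel_rV R d)).
Proof.
move=> cK; rewrite -[X in measurable X]setCK; apply: measurableC.
by apply: sub_sigma_algebra; apply: closed_openC; apply: compact_closed => //; exact: norm_hausdorff.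
Qed.

Section families.
Context {R : realType} {d : nat} {G : metric_graph R}.
Variables (Omega : set 'rV[R]_d) (x : vertex G -> 'rV[R]_d).
Local Notation signed := (charge (borel_rV R d) R).
Local Notation leb := (@lebesgue_measure R).
Local Notation I01 := (`[0, 1]%classic : set R).

Definition outer_pair : finType :=
  {ve : vertex G * edge G | (ve.1 \in vout) && (ve.2 \in incident ve.1)}.

(* [None] and [Some i] stand for mu and J^i; [(e, None)], [(e, Some true)] and
   [(e, Some false)] for rho^e, V^e and f^e; an [outer_pair] for G^e(x_v). *)
Definition component : finType :=
  (option 'I_d + edge G * option bool + outer_pair)%type.

Definition state_component (z : state R d G) (c : component) : signed :=
  match c with
  | inl (inl None) => stmu z
  | inl (inl (Some i)) => stJ z i
  | inl (inr (e, None)) => strho z e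
  | inl (inr (e, Some true)) => stVs z e
  | inl (inr (e, Some false)) => stf z e
  | inr ve => stGs z (val ve).1 (val ve).2
  end.

Definition outer_component (w : component -> signed) (v : vertex G) (e : edge G) : signed :=
  if insub (v, e) is Some ve then w (inr ve) else czero.

Definition family_state (w : component -> signed) : state R d G :=
  State (w (inl (inl None))) (fun i => w (inl (inl (Some i))))
    (fun e => w (inl (inr (e, None))))
    (fun e i => cscale (tau x e 0 i) (w (inl (inr (e, Some true)))))
    (fun e => w (inl (inr (e, Some true))))
    (fun e => w (inl (inr (e, Some false))))
    (fun v e i => cscale (tau x e 0 i) (outer_component w v e))
    (outer_component w).

Definition component_support (c : component) : set (borel_rV R d) :=
  match c with
  | inl (inl _) => Omega
  | inl (inr (e, _)) => seg x e
  | inr ve => [set x (val ve).1]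
  end.

Lemma outer_componentE w v e (ve : (v \in vout) && (e \in incident v)) :
  outer_component w v e = w (inr (Sub (v, e) ve)).
Proof. by rewrite /outer_component insubT. Qed.

Lemma outer_state_component z v e : v \in vout -> e \in incident v ->
  outer_component (state_component z) v e = stGs z v e.
Proof. by move=> vo ev; rewrite outer_componentE ?vo// SubK. Qed.

Lemma Dadm_family (w : component -> R -> signed) :
  Dadm Omega x (fun t => family_state (w ^~ t)) <-> family_path component_support w.
Proof.
split=> [[[h1 h2] h3 h4 _ _] [[[i|]|[e [[|]|]]]|[[v e] ve]]|h] //=.
- exact: (h2 i).
- by case: (h3 e).
- by case: (h3 e).
- by case: (h3 e).
- have /andP[vo ev] := ve; have := h4 v e vo ev; congr measure_path.
  by apply/funext => t /=; rewrite (outer_componentE _ ve).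
split => //=.
- by split => [|i]; [exact: (h (inl (inl None)))|exact: (h (inl (inl (Some i))))].
- move=> e; split; [exact: (h (inl (inr (e, None))))|exact: (h (inl (inr (e, Some true))))|].
  exact: (h (inl (inr (e, Some false)))).
- move=> v e vo ev; have ve : (v \in vout) && (e \in incident v) by rewrite vo.
  have := h (inr (Sub (v, e) ve)); rewrite /= => h'.
  move: h'; congr measure_path => //.
  by apply/funext => t /=; rewrite (outer_componentE _ ve).
Qed.

(** The left side of [CE_bulk] as a functional of the path, as [graph_form] is for [CE_graph]. The
    right sides depend on the data only, so that for each test function an equation prescribes the
    value of a linear functional. *)
Definition bulk_form (phi : R * 'rV[R]_d -> R) (p : R -> state R d G) : R :=
  \int[leb]_(t in I01) (\cint[stmu (p t)]_(y in Omega) 'D_(1, 0) phi (t, y))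
  + \int[leb]_(t in I01) (\sum_(i < d)
      \cint[stJ (p t) i]_(y in Omega) 'D_(0, delta_mx 0 i) phi (t, y))
  - \sum_(e : edge G) \int[leb]_(t in I01)
      (\cint[tilde x e (stf (p t) e)]_(s in `[0, 1]%classic)
         phi (t, gamma x e s))
  + \sum_(v in vout) \sum_(e in incident v) \int[leb]_(t in I01)
      (\cint[stGs (p t) v e]_(y in [set x v])
         (phi (t, x v) * edge_normal e v)).

Definition graph_form (psi : edge G -> R * R -> R) (p : R -> state R d G) : R :=
  \sum_(e : edge G)
    (\int[leb]_(t in I01) (\cint[tilde x e (strho (p t) e)]_(s in `[0, 1]%classic)
                 'D_(1, 0) (psi e) (t, s))
     + \int[leb]_(t in I01) (\cint[tilde x e (stVs (p t) e)]_(s in `[0, 1]%classic)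
                 ((len e)^-1 * 'D_(0, 1) (psi e) (t, s)))
     + \int[leb]_(t in I01) (\cint[tilde x e (stf (p t) e)]_(s in `[0, 1]%classic)
                 psi e (t, s)))
  - \sum_(v in vout) \sum_(e in incident v) \int[leb]_(t in I01)
      (\cint[stGs (p t) v e]_(y in [set x v])
         (psi e (t, gamma_inv x e (x v)) * edge_normal e v)).

Hypothesis Omega_compact : compact Omega.

Local Notation bounded_linear := (bounded_linear component_support).
Local Notation test := (test_function (rational_ball : nat -> set (borel_rV R d))).
Let cg := @countably_generates_rational_ball R d.
Let mOmega := compact_measurable Omega_compact.

Lemma test_function_bulk (h : R * 'rV[R]_d -> R) : continuous h ->
  test Omega (fun t y => h (t, y)).
Proof.
by move=> ch; exact: (@test_function_continuous _ _ 'rV[R]_d id Omega _ h (fun y => cvg_id)).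
Qed.

Lemma test_function_vertex v (k : R -> R) : continuous k ->
  test [set x v] (fun t _ => k t).
Proof.
move=> ck.
apply: (@test_function_continuous _ _ 'rV[R]_d id [set x v] _ (fun p => k p.1)) => //.
- by move=> y; exact: cvg_id.
- exact: compact_set1.
- move=> p; apply: continuous_comp; [exact: cvg_fst|exact: ck].
Qed.

Lemma bounded_linear_vertex v e (k : R -> R) : v \in vout -> e \in incident v ->
  continuous k -> bounded_linear (fun w => \int[leb]_(t in I01)
    \cint[stGs (family_state (w ^~ t)) v e]_(y in [set x v]) k t).
Proof.
move=> vo ev ck; have ve : (v \in vout) && (e \in incident v) by rewrite vo.
have := bounded_linear_flow cg component_support (inr (Sub (v, e) ve))
  (measurable_point (x v)) (test_function_vertex v ck).
apply: (bounded_linear_eq cg) => w _; rewrite /flow.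
by apply: eq_Rintegral => t _ /=; rewrite (outer_componentE _ ve).
Qed.

(** The pushforward is undone: one integrates over the points of R^d whose projection falls on the
    edge. That set is in general unbounded, but the integrand factors through [0, 1]. *)
Lemma bounded_linear_edge (c : component) e (h : R * R -> R) : continuous h ->
  bounded_linear (fun w => \int[leb]_(t in I01)
    \cint[tilde x e (w c t)]_(s in `[0, 1]%classic) h (t, s)).
Proof.
move=> ch; pose D : set (borel_rV R d) := gamma_inv x e @^-1` `[0, 1]%classic.
have mD : measurable D.
  by rewrite -[D]setTI; apply: (measurable_gamma_inv x e) => //; exact: measurable_itv.
have tD : test D (fun t y => h (t, gamma_inv x e y)).
  apply: (@test_function_continuous _ _ R (gamma_inv x e) `[0, 1]%classic) => //.
    exact: gamma_inv_continuous.
  exact: segment_compact.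
apply: (bounded_linear_eq cg _ (bounded_linear_flow cg component_support c mD tD)) => w _.
apply: eq_Rintegral => t _.
have cht : continuous (fun s => h (t, s)).
  have ct : continuous (fun s : R => (t, s)) by apply: pair_continuous => s; [exact: cvg_cst|exact: cvg_id].
  by move=> s; exact: (@continuous_comp _ _ _ (fun s => (t, s)) h s (ct s) (ch _)).
have /compact_bounded[M [_ hM]] : compact [set h (t, s) | s in `[0, 1]%classic].
  apply: (@continuous_compact _ _ (fun s => h (t, s))); last exact: segment_compact.
  exact: continuous_subspaceT.
rewrite /tilde (@cint_pushforward _ _ _ _ _ (gamma_inv x e) _ _ _ (fun s => h (t, s)) (`|M| + 1))//.
- exact: continuous_measurable_fun.
- move=> s s01; apply: hM; first by rewrite (le_lt_trans (ler_norm _))// ltrDl.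
  by exists s.
Qed.

Lemma bounded_linear_bulk_form phi : C1 phi ->
  bounded_linear (fun w => bulk_form phi (fun t => family_state (w ^~ t))).
Proof.
move=> phi1; have [_ dphi] := phi1; have cphi := C1_continuous phi1.
rewrite /bulk_form; apply: bounded_linearD.
  apply: bounded_linearD.
    apply: bounded_linearD.
      apply: (bounded_linear_flow cg component_support (inl (inl None)) mOmega).
      exact: (@test_function_bulk ('D_(1, 0) phi) (dphi _)).
    (* The flux term sums over coordinates inside the time integral; the exchange with the integral
       needs integrability, available on admissible families. *)
    have h : bounded_linear (fun w => \sum_(i < d) flow (Omega : set (borel_rV R d))
        (fun t y => 'D_(0, delta_mx 0 i) phi (t, y)) (w (inl (inl (Some i))))).
      apply: (bounded_linear_sum cg) => i _.
      apply: (bounded_linear_flow cg component_support (inl (inl (Some i))) mOmega).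
      exact: (@test_function_bulk ('D_(0, delta_mx 0 i) phi) (dphi _)).
    apply: (bounded_linear_eq cg _ h) => w pw /=; rewrite /flow.
    have [|_ ->] := @Rintegral_sum _ _ _ leb I01 _ (index_enum 'I_d)
        (fun i t => \cint[w (inl (inl (Some i))) t]_(y in Omega)
          'D_(0, delta_mx 0 i) phi (t, y)) (measurable_itv _); last by [].
    move=> i; apply: (flow_integrable cg mOmega _ (pw (inl (inl (Some i))))).
    exact: (@test_function_bulk ('D_(0, delta_mx 0 i) phi) (dphi _)).
  apply: bounded_linearN; apply: (bounded_linear_sum cg) => e _.
  apply: (@bounded_linear_edge (inl (inr (e, Some false))) e (fun p => phi (p.1, gamma x e p.2))).
  have ct : continuous (fun p : R * R => (p.1, gamma x e p.2)).
    apply: pair_continuous => p; first exact: cvg_fst.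
    by apply: (@continuous_comp _ _ _ snd (gamma x e)); [exact: cvg_snd|exact: gamma_continuous].
  by move=> p; exact: (@continuous_comp _ _ _ _ phi p (ct p) (cphi _)).
apply: (bounded_linear_sum cg) => v vo; apply: (bounded_linear_sum cg) => e ev.
apply: bounded_linear_vertex => // t.
apply: cvgMr_tmp.
have ct : continuous (fun t : R => (t, x v)).
  by apply: pair_continuous => s; [exact: cvg_id|exact: cvg_cst].
exact: (@continuous_comp _ _ _ _ phi t (ct t) (cphi _)).
Qed.

Lemma bounded_linear_graph_form psi : (forall e, C1 (psi e)) ->
  bounded_linear (fun w => graph_form psi (fun t => family_state (w ^~ t))).
Proof.
move=> psi1; have cpsi e := C1_continuous (psi1 e).
rewrite /graph_form; apply: bounded_linearD.
  apply: (bounded_linear_sum cg) => e _; have [_ dpsi] := psi1 e.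
  apply: bounded_linearD; [apply: bounded_linearD|].
  - exact: (@bounded_linear_edge (inl (inr (e, None))) e ('D_(1, 0) (psi e)) (dpsi _)).
  - apply: (@bounded_linear_edge (inl (inr (e, Some true))) e
      (fun p => (len e)^-1 * 'D_(0, 1) (psi e) p)).
    by move=> p; apply: cvgMl_tmp; exact: dpsi.
  - exact: (@bounded_linear_edge (inl (inr (e, Some false))) e (psi e) (cpsi e)).
apply: bounded_linearN; apply: (bounded_linear_sum cg) => v vo.
apply: (bounded_linear_sum cg) => e ev; apply: bounded_linear_vertex => // t.
apply: cvgMr_tmp.
have ct : continuous (fun t : R => (t, gamma_inv x e (x v))).
  by apply: pair_continuous => s; [exact: cvg_id|exact: cvg_cst].
exact: (@continuous_comp _ _ _ _ (psi e) t (ct t) (cpsi e _)).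
Qed.

End families.

(** * The action on the graph *)

Section lower_semicontinuous_actions.
Context {d} {T : measurableType d} {R : realType} {C : Type}.
Variable B : nat -> set T.
Hypothesis cgB : countably_generates B.
Implicit Types w : C -> charge T R.

Definition setwise_cvg (w : nat -> C -> charge T R) w' :=
  forall c A, measurable A -> forall e : R, 0 < e -> exists n0, forall n,
    (n0 <= n)%N -> `|fine (w n c A) - fine (w' c A)| <= e.

(** What the minimisation needs from the action, in a form stable under sums and positive multiples,
    so that it can be checked term by term. *)
Record convex_lsc_action (A : (C -> charge T R) -> \bar R) : Prop := ConvexLscAction {
  action_ge0 : forall w, (0 <= A w)%E;
  action_measurable : forall {d'} {U : measurableType d'} (D : set U)
    (w : U -> C -> charge T R), measurable D ->
    (forall c X, measurable X -> measurable_fun D (fun t => w t c X)) ->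
    measurable_fun D (fun t => A (w t));
  action_mid : forall w w',
    (A (fun c => clin 2^-1 2^-1 (w c) (w' c)) <= (2^-1)%:E * (A w + A w'))%E;
  action_ev_ge : forall (w : nat -> C -> charge T R) w', setwise_cvg w w' ->
    ev_ge (fun n => A (w n)) (A w') }.

Lemma convex_lsc_actionD A A' : convex_lsc_action A -> convex_lsc_action A' ->
  convex_lsc_action (fun w => A w + A' w)%E.
Proof.
move=> [p m c l] [p' m' c' l']; split => [w|d' U D w mD mw|w w'|w w' ww].
- exact: adde_ge0.
- by apply: emeasurable_funD; [exact: m|exact: m'].
- apply: le_trans (leeD (c w w') (c' w w')) _.
  by rewrite -ge0_muleDr ?adde_ge0// addeACA.
- by apply: ev_geD => //; [exact: l|exact: l'].
Qed.

Lemma convex_lsc_action0 : convex_lsc_action (fun=> 0%E).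
Proof.
split=> // [w w'|w w' _]; first by rewrite adde0 mule0.
exact: ev_ge0.
Qed.

Lemma convex_lsc_actionZ (r : R) A : 0 < r -> convex_lsc_action A ->
  convex_lsc_action (fun w => r%:E * A w)%E.
Proof.
move=> r0 [p m c l]; split => [w|d' U D w mD mw|w w'|w w' ww].
- by rewrite mule_ge0// lee_fin ltW.
- by apply: measurable_funeM; exact: m.
- apply: (@le_trans _ _ (r%:E * ((2^-1)%:E * (A w + A w')))%E).
    by apply: lee_wpmul2l; [rewrite lee_fin ltW|exact: c].
  by rewrite -ge0_muleDr// muleCA.
- by apply: ev_geZ => //; exact: l.
Qed.

Lemma convex_lsc_action_sum (I : Type) (s : seq I) (P : pred I)
    (A : I -> (C -> charge T R) -> \bar R) :
  (forall i, P i -> convex_lsc_action (A i)) ->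
  convex_lsc_action (fun w => \sum_(i <- s | P i) A i w)%E.
Proof.
move=> h; elim: s => [|i s ih].
  by under [X in convex_lsc_action X]eq_fun do rewrite big_nil; exact: convex_lsc_action0.
have [Pi|Pi] := boolP (P i).
  under [X in convex_lsc_action X]eq_fun do rewrite big_cons Pi.
  exact: convex_lsc_actionD (h i Pi) ih.
by under [X in convex_lsc_action X]eq_fun do rewrite big_cons (negbTE Pi).
Qed.

(** The vertex terms contain the restriction of rho^e to a point, a component tested on the sets A &
    X; plain components have the whole space as X. *)
Definition restricted_component (s : (C -> charge T R) -> charge T R) :=
  exists c X, measurable X /\ forall w A, measurable A -> s w A = w c (A `&` X).

(** Densities are chosen, so those of charges that agree on measurable sets need not be the same
    functions; the discretisations read only values on cells. *)
Lemma total_density_action_eq N (F : ('I_N -> R) -> \bar R)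
    (l : {finite_measure set T -> \bar R}) (v v' : 'I_N -> charge T R) : integrand F ->
  (forall i A, measurable A -> v i A = v' i A) ->
  total_density_action F l v = total_density_action F l v'.
Proof.
move=> HF E; rewrite !(total_density_action_sup cgB HF).
suff -> : cell_action B F l v = cell_action B F l v' by [].
apply/funext => n; apply: eq_bigr => s _; congr perspective.
by apply/funext => i; rewrite E//; exact: measurable_cell.
Qed.

Lemma convex_lsc_total_density_action N (F : ('I_N -> R) -> \bar R)
    (l : {finite_measure set T -> \bar R}) (s : 'I_N -> (C -> charge T R) -> charge T R) :
  integrand F -> (forall i, restricted_component (s i)) ->
  convex_lsc_action (fun w => total_density_action F l (fun i => s i w)).
Proof.
move=> HF hs; split => [w|d' U D w mD mw|w w'|w w' ww].
- exact: total_density_action_ge0.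
- have ms i A : measurable A -> measurable_fun D (fun t => s i (w t) A).
    move=> mA; have [c [X [mX E]]] := hs i; under eq_fun do rewrite E//.
    by apply: mw; exact: measurableI.
  exact: (measurable_action cgB HF l (v := fun t i => s i (w t)) mD ms).
- apply: le_trans (action_midpoint cgB HF l (s ^~ w) (s ^~ w')).
  rewrite le_eqVlt; apply/orP; left; apply/eqP; apply: total_density_action_eq => // i A mA.
  by have [c [X [mX E]]] := hs i; rewrite E// !clinE !E.
- apply: (action_lsc cgB HF) => i A mA e e0.
  have [c [X [mX E]]] := hs i.
  have [n0 hn0] := ww c _ (measurableI _ _ mA mX) e e0.
  by exists n0 => n /hn0; rewrite !E.
Qed.

End lower_semicontinuous_actions.

Section graph_actions.
Context {R : realType} {d : nat} {G : metric_graph R}.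
Variables (mO mG : R -> \bar R) (a1 a2 a3 : R) (x : vertex G -> 'rV[R]_d).
Variable Omega : set 'rV[R]_d.
Local Notation T := (borel_rV R d).
Local Notation finite := (FiniteMeasure.type T R).
Local Notation signed := (charge T R).
Variables (lO : finite) (lE : edge G -> finite) (lV : vertex G -> finite).
Hypotheses (mO_adm : admissible_mobility mO) (mG_adm : admissible_mobility mG).
Hypotheses (a1_gt0 : 0 < a1) (a2_gt0 : 0 < a2) (a3_gt0 : 0 < a3).
Hypothesis Omega_compact : compact Omega.
Hypothesis lO_conc : concentrated (Omega : set T) lO.
Hypothesis lE_conc : forall e, concentrated (seg x e : set T) (lE e).
Hypothesis lV_conc : forall v, v \in vout -> concentrated ([set x v] : set T) (lV v).
Implicit Types (l : finite) (nu : signed) (z : state R d G).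
Let cg := @countably_generates_rational_ball R d.

Definition pair_family (nu nu' : signed) (i : 'I_2) : signed :=
  if unlift ord0 i is Some _ then nu' else nu.

Definition bulk_action (w : @component R d G -> signed) : \bar R :=
  total_density_action (mobility_integrand mO (d := d)) lO (fun i =>
    w (inl (inl (if unlift ord0 i is Some j then Some j else None)))).

Definition edge_action (l : finite) (nu nu' : signed) : \bar R :=
  total_density_action (mobility_integrand mG (d := 1)) l (pair_family nu nu').

Definition component_action (w : @component R d G -> signed) : \bar R :=
  (bulk_action w
   + \sum_(e : edge G)
       (a1%:E * edge_action (lE e) (w (inl (inr (e, None)))) (w (inl (inr (e, Some true))))
        + a2%:E * edge_action (lE e) (w (inl (inr (e, None)))) (w (inl (inr (e, Some false)))))
   + \sum_(v in vout) \sum_(e in incident v)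
       a3%:E * edge_action (lV v) (crestr0 (w (inl (inr (e, None)))) (measurable_point (x v)))
         (outer_component w v e))%E.

Lemma compact_seg e : compact (seg x e).
Proof.
rewrite -gamma_segment; apply: continuous_compact; last exact: segment_compact.
exact/continuous_subspaceT/gamma_continuous.
Qed.

Lemma integral_concentrated (l : finite) (D : set T) (f : T -> \bar R) :
  measurable D -> concentrated D l -> measurable_fun setT f -> (forall y, (0 <= f y)%E) ->
  (\int[l]_(y in D) f y = \int[l]_y f y)%E.
Proof.
move=> mD lD mf f0; rewrite [RHS](@ge0_negligible_integral _ _ _ _ _ (~` D))//.
- by rewrite setDE setCK setTI.
- exact: measurableC.
- by apply: lD; [exact: measurableC|rewrite setICl].
Qed.

Lemma mobility_integrand1 (z : 'I_2 -> R) :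
  mobility_integrand mG (d := 1) z = Psi mG (z ord0) `|z ord_max|.
Proof.
rewrite /mobility_integrand /enorm /edot big_ord1 !mxE -expr2 sqrtr_sqr.
by congr (Psi _ _ `|z _|); exact: val_inj.
Qed.

Lemma edge_action_dominates l nu nu' : (edge_action l nu nu' < +oo)%E ->
  nu `<< l /\ nu' `<< l.
Proof.
rewrite /edge_action /total_density_action; case: asboolP => // h _.
by split; [have := h ord0|have := h ord_max]; rewrite /pair_family;
  [rewrite unlift_none|rewrite (_ : ord_max = lift ord0 ord0) ?liftK//; exact: val_inj].
Qed.

Let edge_integrand l nu nu' (y : T) :=
  Psi mG (density l nu y) `|density l nu' y|.

Lemma edge_integrand_ge0 l nu nu' y : (0 <= edge_integrand l nu nu' y)%E.
Proof.
have := integrand_ge0 (mobility_integrandP 1 mG_adm)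
  (fun i => density l (pair_family nu nu' i) y).
rewrite mobility_integrand1 /pair_family unlift_none.
by rewrite (_ : ord_max = lift ord0 ord0) ?liftK//; exact: val_inj.
Qed.

Lemma edge_actionE l nu nu' : nu `<< l -> nu' `<< l ->
  edge_action l nu nu' = (\int[l]_y edge_integrand l nu nu' y)%E.
Proof.
move=> nul nul'; rewrite /edge_action /total_density_action asboolT; last first.
  by move=> i; rewrite /pair_family; case: unlift.
apply: eq_integral => y _; rewrite mobility_integrand1 /pair_family unlift_none.
by rewrite (_ : ord_max = lift ord0 ord0) ?liftK//; exact: val_inj.
Qed.

Lemma measurable_edge_integrand l nu nu' : nu `<< l -> nu' `<< l ->
  measurable_fun setT (edge_integrand l nu nu').
Proof.
move=> nul nul'.
have := integrand_measurable (mobility_integrandP 1 mG_adm)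
  (f := fun i y => density l (pair_family nu nu' i) y).
rewrite (_ : (fun y => mobility_integrand _ _) = edge_integrand l nu nu'); last first.
  apply/funext => y; rewrite mobility_integrand1 /pair_family unlift_none.
  by rewrite (_ : ord_max = lift ord0 ord0) ?liftK//; exact: val_inj.
by apply => i; exact: measurable_density.
Qed.

Let bulk_integrand (z : state R d G) (y : T) :=
  Psi mO (density lO (stmu z) y) (enorm (\row_(i < d) density lO (stJ z i) y)).

Lemma bulk_integrandE z y : bulk_integrand z y = mobility_integrand mO (fun i =>
  density lO (state_component z
    (inl (inl (if unlift ord0 i is Some j then Some j else None)))) y).
Proof.
rewrite /mobility_integrand unlift_none /bulk_integrand; congr (Psi _ _ (enorm _)).
by apply/rowP => i; rewrite !mxE liftK.
Qed.

Lemma measurable_bulk_integrand z : measurable_fun setT (bulk_integrand z).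
Proof.
have -> : bulk_integrand z = fun y => mobility_integrand mO (fun i =>
    density lO (state_component z
      (inl (inl (if unlift ord0 i is Some j then Some j else None)))) y).
  by apply/funext => y; exact: bulk_integrandE.
apply: (integrand_measurable (mobility_integrandP d mO_adm)) => i.
exact: measurable_density.
Qed.

Lemma bulk_integrand_ge0 z y : (0 <= bulk_integrand z y)%E.
Proof. rewrite bulk_integrandE; exact: (integrand_ge0 (mobility_integrandP d mO_adm)). Qed.

Lemma bulk_actionE z :
  (forall i : 'I_d.+1, state_component z
     (inl (inl (if unlift ord0 i is Some j then Some j else None))) `<< lO) ->
  bulk_action (state_component z) = (\int[lO]_y bulk_integrand z y)%E.
Proof.
move=> ac; rewrite /bulk_action /total_density_action asboolT; last exact: ac.
by apply: eq_integral => y _; rewrite bulk_integrandE.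
Qed.

Lemma integral_concentratedD l (D : set T) (f g : T -> \bar R) (r s : R) :
  measurable D -> concentrated D l -> 0 < r -> 0 < s ->
  measurable_fun setT f -> measurable_fun setT g ->
  (forall y, (0 <= f y)%E) -> (forall y, (0 <= g y)%E) ->
  (\int[l]_(y in D) (r%:E * f y + s%:E * g y) =
   r%:E * \int[l]_y f y + s%:E * \int[l]_y g y)%E.
Proof.
move=> mD lD r0 s0 mf mg f0 g0.
have rf y : (0 <= r%:E * f y)%E by rewrite mule_ge0// lee_fin ltW.
have sg y : (0 <= s%:E * g y)%E by rewrite mule_ge0// lee_fin ltW.
have mrf : measurable_fun setT (fun y => r%:E * f y)%E by exact: measurable_funeM.
have msg : measurable_fun setT (fun y => s%:E * g y)%E by exact: measurable_funeM.
rewrite (@integral_concentrated l D (fun y => r%:E * f y + s%:E * g y)%E mD lD).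
- by rewrite ge0_integralD// !ge0_integralZl// lee_fin ltW.
- exact: emeasurable_funD.
- by move=> y; exact: adde_ge0.
Qed.

(** With absolute continuity, the integrals over Omega, the edges and the vertices extend to the
    whole space because the reference measures are concentrated there. *)
Lemma graph_actionE z :
  graph_action mO mG a1 a2 a3 x Omega lO lE lV z = component_action (state_component z).
Proof.
have p0 l nu nu' : (0 <= edge_action l nu nu')%E.
  exact: (total_density_action_ge0 (mobility_integrandP 1 mG_adm)).
have b0 w : (0 <= bulk_action w)%E.
  exact: (total_density_action_ge0 (mobility_integrandP d mO_adm)).
rewrite /graph_action; case: asboolP => [[hmu hJ hE hV]|nac].
  rewrite /component_action; congr (_ + _ + _)%E.
  - rewrite bulk_actionE; last by move=> i; case: unlift.
    exact: (@integral_concentrated lO Omega (bulk_integrand z)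
      (compact_measurable Omega_compact) lO_conc (measurable_bulk_integrand z)
      (bulk_integrand_ge0 z)).
  - apply: eq_bigr => e _ /=; have [h1 h2 h3] := hE e.
    rewrite (edge_actionE h1 h2) (edge_actionE h1 h3).
    apply: (@integral_concentratedD (lE e) (seg x e)
      (edge_integrand (lE e) (strho z e) (stVs z e))
      (edge_integrand (lE e) (strho z e) (stf z e))) => //.
    + exact: (compact_measurable (@compact_seg e)).
    + exact: measurable_edge_integrand.
    + exact: measurable_edge_integrand.
    + exact: edge_integrand_ge0.
    + exact: edge_integrand_ge0.
  - have E v e : v \in vout -> e \in incident v ->
        (\int[lV v]_(y in [set x v])
           Psi mG (fine (Radon_Nikodym (restr_vertex x z v e) (lV v) y))
             `|fine (Radon_Nikodym (stGs z v e) (lV v) y)|)%E =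
        edge_action (lV v) (restr_vertex x z v e) (stGs z v e).
      move=> vo ev; have [h1 h2] := hV v e vo ev; rewrite (edge_actionE h1 h2).
      apply: (@integral_concentrated (lV v) [set x v]
        (edge_integrand (lV v) (restr_vertex x z v e) (stGs z v e)) (measurable_point (x v))).
      + exact: lV_conc.
      + exact: measurable_edge_integrand.
      + exact: edge_integrand_ge0.
    transitivity (a3%:E * (\sum_(v in vout) \sum_(e in incident v)
        edge_action (lV v) (restr_vertex x z v e) (stGs z v e)))%E.
      by congr (_ * _)%E; apply: eq_bigr => v vo; apply: eq_bigr => e ev; exact: E.
    rewrite ge0_sume_distrr => [|v _]; last exact: sume_ge0.
    apply: eq_bigr => v vo; rewrite ge0_sume_distrr => [|e _]; last exact: p0.
    apply: eq_bigr => e ev; congr (_ * edge_action _ _ _)%E.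
    by rewrite (outer_state_component _ vo ev).
(* Otherwise the left side is +oo. A finite right side would make each term finite, as the weights
   are positive, and so would give absolute continuity. *)
apply/esym/eqP; rewrite -leye_eq leNgt; apply/negP => fin; apply: nac.
have e0 r l nu nu' : 0 < r -> (0 <= r%:E * edge_action l nu nu')%E.
  by move=> r0; rewrite mule_ge0// lee_fin ltW.
have s1 : (0 <= \sum_(e : edge G)
    (a1%:E * edge_action (lE e) (strho z e) (stVs z e)
     + a2%:E * edge_action (lE e) (strho z e) (stf z e)))%E.
  by apply: sume_ge0 => e _; rewrite adde_ge0// e0.
have s2 : (0 <= \sum_(v in vout) \sum_(e in incident v)
    a3%:E * edge_action (lV v) (crestr0 (strho z e) (measurable_point (x v)))
         (outer_component (state_component z) v e))%E.
  by apply: sume_ge0 => v _; apply: sume_ge0 => e _; exact: e0.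
have fZ (r : R) (u : \bar R) : 0 < r -> (0 <= u)%E -> (r%:E * u < +oo)%E -> (u < +oo)%E.
  by case: u => [u| |] // r0 _; rewrite ?ltry// gt0_muley ?lte_fin.
have fD (u v : \bar R) : (0 <= u)%E -> (0 <= v)%E -> (u + v < +oo)%E ->
    (u < +oo)%E /\ (v < +oo)%E.
  move=> u0 v0 h; split; apply: le_lt_trans h; [exact: leeDl|exact: leeDr].
have [|fin12 fin3] := fD _ _ _ s2 fin; first exact: adde_ge0.
have [fin1 fin2] := fD _ _ (b0 _) s1 fin12.
have ac : forall i : 'I_d.+1, state_component z
    (inl (inl (if unlift ord0 i is Some j then Some j else None))) `<< lO.
  by move: fin1; rewrite /bulk_action /total_density_action; case: asboolP.
split.
- by have := ac ord0; rewrite unlift_none.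
- by move=> i; have := ac (lift ord0 i); rewrite liftK.
- move=> e; move: fin2; rewrite (bigD1 e)//= => /fD[||fe _].
  + by rewrite adde_ge0// e0.
  + by apply: sume_ge0 => e' _; rewrite adde_ge0// e0.
  have [f1 f2] := fD _ _ (e0 _ _ _ _ a1_gt0) (e0 _ _ _ _ a2_gt0) fe.
  have [h1 h2] := edge_action_dominates (fZ _ _ a1_gt0 (p0 _ _ _) f1).
  by have [_ h3] := edge_action_dominates (fZ _ _ a2_gt0 (p0 _ _ _) f2).
- move=> v e vo ev; move: fin3; rewrite (bigD1 v)//= => /fD[||fv _].
  + by apply: sume_ge0 => e' _; exact: e0.
  + by apply: sume_ge0 => v' _; apply: sume_ge0 => e' _; exact: e0.
  move: fv; rewrite (bigD1 e)//= => /fD[||fe _].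
  + exact: e0.
  + by apply: sume_ge0 => e' _; exact: e0.
  rewrite outer_state_component// in fe.
  exact: edge_action_dominates (fZ _ _ a3_gt0 (p0 _ _ _) fe).
Qed.

Lemma component_action_convex_lsc : convex_lsc_action component_action.
Proof.
have rc (c : @component R d G) :
    restricted_component (fun w : @component R d G -> signed => w c).
  by exists c, setT; split => // w A _; rewrite setIT.
have pair_rc l (s s' : (@component R d G -> signed) -> signed) :
    restricted_component s -> restricted_component s' ->
    convex_lsc_action (fun w => edge_action l (s w) (s' w)).
  move=> hs hs'; apply: (convex_lsc_total_density_action cg l (mobility_integrandP 1 mG_adm)
    (s := fun i w => pair_family (s w) (s' w) i)) => i.
  by rewrite /pair_family; case: unlift.
apply: convex_lsc_actionD; first apply: convex_lsc_actionD.
- apply: (convex_lsc_total_density_action cg lO (mobility_integrandP d mO_adm)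
    (s := fun i w => w (inl (inl (if unlift ord0 i is Some j then Some j else None))))) => i.
  exact: rc.
- apply: convex_lsc_action_sum => e _; apply: convex_lsc_actionD;
    by apply: convex_lsc_actionZ => //; apply: pair_rc; exact: rc.
- apply: convex_lsc_action_sum => v vo; apply: convex_lsc_action_sum => e ev.
  apply: convex_lsc_actionZ => //; apply: pair_rc.
    exists (inl (inr (e, None))), [set x v]; split; first exact: measurable_point.
    by move=> w A mA; rewrite /= /crestr0 mem_set.
  have ve : (v \in vout) && (e \in incident v) by rewrite vo.
  exists (inr (Sub (v, e) ve)), setT; split => // w A _.
  by rewrite setIT (outer_componentE _ ve).
Qed.

Definition component_reference (c : @component R d G) : finite :=
  match c with
  | inl (inl _) => lO
  | inl (inr (e, _)) => lE e
  | inr ve => lV (val ve).1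
  end.

(** The energies in one term of the action are at most C l(T) + (C / r) A, where r is the weight of
    the term; K is large enough for both coefficients. *)
Lemma energy_le_action (A : (@component R d G -> signed) -> \bar R) N
    (F : ('I_N -> R) -> \bar R) l (s : 'I_N -> (@component R d G -> signed) -> signed) (r : R) :
  integrand F -> 0 < r ->
  (forall w, (r%:E * total_density_action F l (s ^~ w) <= A w)%E) ->
  forall i, exists2 K, 0 <= K & forall w, (energy l (s i w) <= K%:E + K%:E * A w)%E.
Proof.
move=> HF r0 h i; have [C C0 hC] := energy_coercive l HF.
have L0 : 0 <= fine (l setT) by exact: fine_ge0.
have Cr : 0 <= C / r by rewrite divr_ge0// ltW.
have K0 : 0 <= C * fine (l setT) + C / r by rewrite addr_ge0// mulr_ge0.
exists (C * fine (l setT) + C / r) => // w; apply: le_trans (hC (s ^~ w) i) _.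
have t0 : (0 <= total_density_action F l (s ^~ w))%E by exact: total_density_action_ge0.
have A0 : (0 <= A w)%E by apply: le_trans (h w); rewrite mule_ge0// lee_fin ltW.
apply: leeD.
  by rewrite -[l setT]fineK ?fin_num_measure// -EFinM lee_fin lerDl.
apply: (@le_trans _ _ ((C / r)%:E * A w)%E).
  apply: (@le_trans _ _ ((C / r)%:E * (r%:E * total_density_action F l (s ^~ w)))%E).
    by rewrite muleA -EFinM mulfVK// gt_eqF.
  by apply: lee_wpmul2l; rewrite ?lee_fin.
by apply: lee_wpmul2r => //; rewrite lee_fin lerDr mulr_ge0.
Qed.

Lemma component_action_terms w :
  [/\ (bulk_action w <= component_action w)%E,
    forall e, (a1%:E * edge_action (lE e) (w (inl (inr (e, None))))
      (w (inl (inr (e, Some true)))) <= component_action w)%E,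
    forall e, (a2%:E * edge_action (lE e) (w (inl (inr (e, None))))
      (w (inl (inr (e, Some false)))) <= component_action w)%E &
    forall v e, v \in vout -> e \in incident v -> (a3%:E * edge_action (lV v)
      (crestr0 (w (inl (inr (e, None)))) (measurable_point (x v)))
      (outer_component w v e) <= component_action w)%E].
Proof.
have b0 : (0 <= bulk_action w)%E.
  exact: (total_density_action_ge0 (mobility_integrandP d mO_adm)).
have e0 r l nu nu' : 0 < r -> (0 <= r%:E * edge_action l nu nu')%E.
  move=> r0; rewrite mule_ge0 ?lee_fin ?(ltW r0)//.
  exact: (total_density_action_ge0 (mobility_integrandP 1 mG_adm)).
have s2 e : (0 <= a1%:E * edge_action (lE e) (w (inl (inr (e, None))))
      (w (inl (inr (e, Some true)))) + a2%:E * edge_action (lE e) (w (inl (inr (e, None))))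
      (w (inl (inr (e, Some false)))))%E by rewrite adde_ge0// e0.
have s3 v : (0 <= \sum_(e in incident v) a3%:E * edge_action (lV v)
      (crestr0 (w (inl (inr (e, None)))) (measurable_point (x v)))
      (outer_component w v e))%E by apply: sume_ge0 => e _; exact: e0.
have S2 := sume_ge0 (fun e (_ : true) => s2 e) (index_enum (edge G)).
have S3 : (0 <= \sum_(v in vout) \sum_(e in incident v) a3%:E * edge_action (lV v)
      (crestr0 (w (inl (inr (e, None)))) (measurable_point (x v)))
      (outer_component w v e))%E by apply: sume_ge0 => v _; exact: s3.
have wpD (u v t : \bar R) : (0 <= u)%E -> (t <= v)%E -> (t <= u + v)%E.
  by move=> u0 /le_trans; apply; exact: leeDr.
split.
- by rewrite /component_action -addeA leeDl// adde_ge0.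
- move=> e; rewrite /component_action addeAC; apply: wpD; first exact: adde_ge0.
  rewrite (bigD1 e)//= -addeA leeDl// adde_ge0 ?e0//.
  by apply: sume_ge0 => e' _; exact: s2.
- move=> e; rewrite /component_action addeAC; apply: wpD; first exact: adde_ge0.
  rewrite (bigD1 e)//= addeAC leeDr// adde_ge0 ?e0//.
  by apply: sume_ge0 => e' _; exact: s2.
- move=> v e vo ev; rewrite /component_action; apply: wpD; first exact: adde_ge0.
  rewrite (bigD1 v)//= (bigD1 e)//= -addeA leeDl// adde_ge0//.
    by apply: sume_ge0 => e' _; exact: e0.
  by apply: sume_ge0 => v' _; exact: s3.
Qed.

(** Each component occurs in some term of the action. The mass rho^e occurs in several; the term
    with V^e is used. *)
Lemma component_energy c : exists2 K, 0 <= K & forall w,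
  (energy (component_reference c) (w c) <= K%:E + K%:E * component_action w)%E.
Proof.
pose HO := mobility_integrandP d mO_adm; pose HG := mobility_integrandP 1 mG_adm.
have om : ord_max = lift ord0 ord0 :> 'I_2 by exact: val_inj.
case: c => [[b|[e b]]|ve] /=.
- have [|K K0 hK] := @energy_le_action component_action _ _ lO (fun i w =>
      w (inl (inl (if unlift ord0 i is Some j then Some j else None)))) 1 HO ltr01 _
      (if b is Some j then lift ord0 j else ord0).
    by move=> w; rewrite mul1e; have [+ _ _ _] := component_action_terms w.
  case: b hK => [j|] hK; exists K => // w; have := hK w;
    by rewrite ?liftK ?unlift_none.
- have H1 := @energy_le_action component_action _ _ (lE e) (fun i w => pair_family
      (w (inl (inr (e, None)))) (w (inl (inr (e, Some true)))) i) a1 HG a1_gt0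
      (fun w => let: And4 _ h _ _ := component_action_terms w in h e).
  have H2 := @energy_le_action component_action _ _ (lE e) (fun i w => pair_family
      (w (inl (inr (e, None)))) (w (inl (inr (e, Some false)))) i) a2 HG a2_gt0
      (fun w => let: And4 _ _ h _ := component_action_terms w in h e).
  case: b => [[|]|].
  + by have := H1 ord_max; rewrite /pair_family om liftK.
  + by have := H2 ord_max; rewrite /pair_family om liftK.
  + by have := H1 ord0; rewrite /pair_family unlift_none.
- have /andP[vo ev] := valP ve.
  have H3 := @energy_le_action component_action _ _ (lV (val ve).1) (fun i w => pair_family
      (crestr0 (w (inl (inr ((val ve).2, None)))) (measurable_point (x (val ve).1)))
      (outer_component w (val ve).1 (val ve).2) i) a3 HG a3_gt0
      (fun w => let: And4 _ _ _ h := component_action_terms w in h _ _ vo ev).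
  have [K K0 hK] := H3 ord_max; exists K => // w; apply: le_trans (hK w).
  rewrite /pair_family om liftK outer_componentE ?vo// => h.
  by rewrite (_ : Sub _ _ = ve)//; apply: val_inj; rewrite SubK; case: (val ve).
Qed.

End graph_actions.

(** * Minimizing sequences *)

(* Along a decreasing sequence of midpoint-convex sets, almost minimisers of a
   uniformly convex functional form a Cauchy sequence, as fast as desired. *)
Lemma uniformly_convex_minimizers (R : realType) (X : Type) (S : nat -> X -> Prop)
    (mid : X -> X -> X) (E : X -> R) (dist : X -> X -> R) (M : R) (eta : nat -> R) :
  (forall n, exists p, S n p) ->
  (forall m n p, (m <= n)%N -> S n p -> S m p) ->
  (forall n p q, S n p -> S n q -> S n (mid p q)) ->
  (forall p, S 0%N p -> 0 <= E p <= M) ->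
  (forall p q, S 0%N p -> S 0%N q -> dist p q + 4 * E (mid p q) <= 2 * (E p + E q)) ->
  (forall k, 0 < eta k) ->
  exists g : nat -> X, forall k, S k (g k) /\ dist (g k.+1) (g k) <= eta k.
Proof.
move=> S0 Sdec Smid E0 par eta0.
pose A := [set r : R | exists n, forall p, S n p -> r <= E p].
have hA : has_sup A.
  split; first by exists 0, 0%N => p /E0 /andP[].
  exists M => r [n hr]; have [p Sp] := S0 n.
  by apply: le_trans (hr p Sp) _; have /E0/andP[] := Sdec 0%N n p (leq0n n) Sp.
(* Four times eta / 8 comes from the two energies and four times eta / 8 from the midpoint, which
   adds up to eta. *)
have lo k : exists n, forall p, S n p -> sup A - eta k / 8 <= E p.
  have e0 : 0 < eta k / 8 by rewrite divr_gt0.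
  have [r [n hr] rA] := sup_adherent e0 hA.
  by exists n => p /hr; apply: le_trans; exact: ltW.
have [N hN] := choice lo.
have hi e n : 0 < e -> exists p, S n p /\ E p <= sup A + e.
  move=> e0; apply: contrapT => /forallNP h.
  have : A (sup A + e).
    exists n => p Sp; rewrite leNgt; apply/negP => lt.
    by apply: (h p); split => //; exact: ltW.
  by move=> /(sup_upper_bound hA); rewrite leNgt ltrDl e0.
(* Each [g k] is compared with both of its neighbours, so it has to meet the requirements of the
   indices k - 1 and k. *)
have /choice[g hg] k : exists p, S (maxn k (maxn (N k) (N k.-1))) p /\
    E p <= sup A + Num.min (eta k / 8) (eta k.-1 / 8).
  by apply: hi; rewrite lt_min !divr_gt0.
exists g => k; have [Sk Ek] := hg k; have [Sk1 Ek1] := hg k.+1.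
split; first by apply: Sdec Sk; exact: leq_maxl.
have Sgk : S (N k) (g k).
  by apply: Sdec Sk; rewrite leq_max leq_max leqnn orbT.
have Sgk1 : S (N k) (g k.+1).
  by apply: Sdec Sk1; rewrite leq_max leq_max leqnn !orbT.
have := par _ _ (Sdec _ _ _ (leq0n _) Sk1) (Sdec _ _ _ (leq0n _) Sk).
have := hN k _ (Smid _ _ _ Sgk1 Sgk).
have : E (g k) <= sup A + eta k / 8.
  by apply: le_trans Ek _; rewrite lerD2l ge_min lexx.
have : E (g k.+1) <= sup A + eta k / 8.
  by apply: le_trans Ek1 _; rewrite lerD2l ge_min lexx orbT.
lra.
Qed.

Lemma parallelogram_fin_num {R : realType} (a b p q : \bar R) :
  (0 <= a)%E -> (0 <= b)%E -> p \is a fin_num -> q \is a fin_num ->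
  (a + 4%:E * b <= 2%:E * (p + q))%E -> a \is a fin_num.
Proof.
move=> a0 b0 pf qf h; rewrite ge0_fin_numE//.
apply: (@le_lt_trans _ _ (2%:E * (p + q))%E).
  by apply: le_trans h; rewrite leeDl// mule_ge0.
by rewrite ltey_eq fin_numM// fin_numD pf qf.
Qed.

Lemma parallelogram_fine {R : realType} (a b p q : \bar R) :
  a \is a fin_num -> b \is a fin_num -> p \is a fin_num -> q \is a fin_num ->
  (a + 4%:E * b <= 2%:E * (p + q))%E ->
  fine a + 4 * fine b <= 2 * (fine p + fine q).
Proof.
by move=> af bf pf qf; rewrite -(fineK af) -(fineK bf) -(fineK pf) -(fineK qf).
Qed.

Lemma integral_parallelogram {d} {T : measurableType d} {R : realType}
    (mu : {measure set T -> \bar R}) (D : set T) (a b p q : T -> \bar R) :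
  measurable D -> measurable_fun D a -> measurable_fun D b ->
  measurable_fun D p -> measurable_fun D q ->
  (forall t, 0 <= a t)%E -> (forall t, 0 <= b t)%E ->
  (forall t, 0 <= p t)%E -> (forall t, 0 <= q t)%E ->
  (forall t, a t + 4%:E * b t <= 2%:E * (p t + q t))%E ->
  (\int[mu]_(t in D) a t + 4%:E * \int[mu]_(t in D) b t <=
   2%:E * (\int[mu]_(t in D) p t + \int[mu]_(t in D) q t))%E.
Proof.
move=> mD ma mb mp mq a0 b0 p0 q0 h.
rewrite -ge0_integralZl// -!ge0_integralD//; last 2 first.
- by move=> t _; rewrite mule_ge0.
- exact: measurable_funeM.
rewrite -ge0_integralZl//; last 2 first.
- exact: emeasurable_funD.
- by move=> t _; rewrite adde_ge0.
apply: ge0_le_integral => //.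
- by move=> t _; rewrite adde_ge0// mule_ge0.
- by apply: emeasurable_funD => //; exact: measurable_funeM.
- by apply: measurable_funeM; exact: emeasurable_funD.
Qed.

Lemma sume_parallelogram {R : realType} (I : finType) (a b p q : I -> \bar R) :
  (forall i, 0 <= b i)%E -> (forall i, 0 <= p i)%E -> (forall i, 0 <= q i)%E ->
  (forall i, a i + 4%:E * b i <= 2%:E * (p i + q i))%E ->
  (\sum_i a i + 4%:E * \sum_i b i <= 2%:E * (\sum_i p i + \sum_i q i))%E.
Proof.
move=> b0 p0 q0 h; rewrite ge0_sume_distrr// -!big_split/= ge0_sume_distrr.
  by apply: lee_sum => i _; exact: h.
by move=> i _; exact: adde_ge0.
Qed.

(** * Families of paths satisfying the continuity equations *)

Section paths_of_families.
Context {R : realType} {d : nat} {G : metric_graph R}.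
Variables (Omega : set 'rV[R]_d) (x : vertex G -> 'rV[R]_d) (z0 z1 : datum R d G).
Local Notation T := (borel_rV R d).
Local Notation signed := (charge T R).
Local Notation component := (@component R d G).
Local Notation support := (@component_support R d G Omega x).
Local Notation family_state := (@family_state R d G x).
Local Notation leb := (@lebesgue_measure R).
Local Notation I01 := (`[0, 1]%classic : set R).
Hypothesis Omega_compact : compact Omega.
Let cg := @countably_generates_rational_ball R d.

Definition family_CE (w : component -> R -> signed) : Prop :=
  CE Omega x z0 z1 (fun t => family_state (w ^~ t)).

Lemma state_componentK (w : component -> signed) : state_component (family_state w) = w.
Proof.
apply/funext => -[[[i|]|[e [[|]|]]]|ve] //=.
have /andP[vo ev] := valP ve; rewrite outer_componentE ?vo// => h.
by congr (w (inr _)); apply: val_inj => /=; case: (sval ve).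
Qed.

(** Passing through components resets [stGs] off the outer pairs and recomputes the vector fields;
    the form reads neither. *)
Lemma bulk_form_state p :
  bulk_form Omega x ^~ (fun t => family_state (state_component (p t))) =
  bulk_form Omega x ^~ (p : R -> state R d G).
Proof.
apply/funext => phi; rewrite /bulk_form; congr (_ + _).
apply: eq_bigr => v vo; apply: eq_bigr => e ev.
by apply: eq_Rintegral => t _ /=; rewrite outer_state_component.
Qed.

Lemma graph_form_state p :
  graph_form x ^~ (fun t => family_state (state_component (p t))) =
  graph_form x ^~ (p : R -> state R d G).
Proof.
apply/funext => psi; rewrite /graph_form; congr (_ - _).
apply: eq_bigr => v vo; apply: eq_bigr => e ev.
by apply: eq_Rintegral => t _ /=; rewrite outer_state_component.
Qed.

Lemma family_CE_state p : CE Omega x z0 z1 p ->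
  family_CE (fun c t => state_component (p t) c).
Proof.
move=> [[[hmu hJ] hE hV _ _] hb hg]; split.
- apply/Dadm_family => -[[[i|]|[e [[|]|]]]|ve] //=.
  + by case: (hE e).
  + by case: (hE e).
  + by case: (hE e).
  + by have /andP[vo ev] := valP ve; exact: hV.
- move=> phi phi1; rewrite -(hb phi phi1).
  exact: (congr1 (fun f => f phi) (bulk_form_state p)).
- move=> psi psi1 cpsi; rewrite -(hg psi psi1 cpsi).
  exact: (congr1 (fun f => f psi) (graph_form_state p)).
Qed.

(** Both families have the same data on the right side, and the weights 1/2 add up to 1. *)
Lemma family_CE_mid w w' : family_CE w -> family_CE w' ->
  family_CE (family_lin 2^-1 2^-1 w w').
Proof.
move=> [hw hb hg] [hw' hb' hg'].
have pw : family_path support w by exact/Dadm_family.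
have pw' : family_path support w' by exact/Dadm_family.
have half (r : R) : 2^-1 * r + 2^-1 * r = r by field.
split.
- by apply/Dadm_family; exact: (family_path_lin cg).
- move=> phi phi1; have [lin _] := bounded_linear_bulk_form x Omega_compact phi1.
  have := lin 2^-1 2^-1 _ _ pw pw'.
  by rewrite (hb phi phi1 : bulk_form _ _ _ _ = _)
    (hb' phi phi1 : bulk_form _ _ _ _ = _) half.
- move=> psi psi1 cpsi; have [lin _] := bounded_linear_graph_form Omega x psi1.
  have := lin 2^-1 2^-1 _ _ pw pw'.
  by rewrite (hg psi psi1 cpsi : graph_form _ _ _ = _)
    (hg' psi psi1 cpsi : graph_form _ _ _ = _) half.
Qed.

Lemma family_CE_closed (w : nat -> component -> R -> signed) w' :
  (forall k, family_CE (w k)) -> family_path support w' ->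
  (forall i, ev_le (fun n => path_variation (fun t => charge_diff (w' i t) (w n i t))) 0%E) ->
  family_CE w'.
Proof.
move=> hw pw' cv.
have pw k : family_path support (w k) by have [/Dadm_family] := hw k.
split; first exact/Dadm_family.
- move=> phi phi1.
  apply: (bounded_linear_closed cg (bounded_linear_bulk_form x Omega_compact phi1) pw pw' _ cv).
  by move=> k; have [_ h _] := hw k; exact: h.
- move=> psi psi1 cpsi.
  apply: (bounded_linear_closed cg (bounded_linear_graph_form Omega x psi1) pw pw' _ cv).
  by move=> k; have [_ _ h] := hw k; exact: h.
Qed.

Lemma family_path_limit (w : nat -> component -> R -> signed) :
  (forall k, family_path support (w k)) ->
  (forall c, \sum_(0 <= k <oo)
     path_variation (fun t => charge_diff (w k.+1 c t) (w k c t)) < +oo)%E ->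
  exists w', [/\ family_path support w',
    forall c, ev_le (fun n => path_variation (fun t => charge_diff (w' c t) (w n c t))) 0%E &
    {ae leb, forall t, I01 t -> setwise_cvg (fun n => w n ^~ t) (w' ^~ t)}].
Proof.
move=> pw sw.
have /choice[w' hw'] c := path_limit cg (fun k => pw k c) (sw c).
exists w'; split=> [c|c|]; [by case: (hw' c)|by case: (hw' c)|].
have H c : {ae leb, forall t, I01 t -> forall A, measurable A -> forall e : R, 0 < e ->
    exists n0, forall n, (n0 <= n)%N -> `|fine (w n c t A) - fine (w' c t A)| <= e}.
  by case: (hw' c).
have := @filter_forall _ _ _ _ (lebesgue_ae_filter R) H.
by apply: filterS => t h It c A mA e e0; exact: h.
Qed.

Variable reference : component -> FiniteMeasure.type T R.

Definition family_energy (w : component -> R -> signed) : \bar R :=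
  (\sum_c \int[leb]_(t in I01) energy (reference c) (w c t))%E.

Lemma measurable_energy c w : measure_path (support c) w ->
  measurable_fun I01 (fun t => energy (reference c) (w t)).
Proof.
move=> [_ mw _].
exact: (measurable_action cg (@square_integrandP R) (reference c) (v := fun t _ => w t)
  (measurable_itv _) (fun _ A mA => mw A mA)).
Qed.

Lemma family_energy_parallelogram w w' : family_path support w -> family_path support w' ->
  (family_energy (family_lin 1 (-1) w w') + 4%:E * family_energy (family_lin 2^-1 2^-1 w w')
   <= 2%:E * (family_energy w + family_energy w'))%E.
Proof.
move=> pw pw'.
pose I (u : component -> R -> signed) c :=
  (\int[leb]_(t in I01) energy (reference c) (u c t))%E.
have I0 u c : (0 <= I u c)%E by apply: integral_ge0 => t _; exact: energy_ge0.
have pl r s : family_path support (family_lin r s w w') by exact: (family_path_lin cg).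
have key c : (I (family_lin 1 (-1) w w') c + 4%:E * I (family_lin 2^-1 2^-1 w w') c <=
    2%:E * (I w c + I w' c))%E.
  apply: (@integral_parallelogram _ _ _ leb I01
    (fun t => energy (reference c) (family_lin 1 (-1) w w' c t))
    (fun t => energy (reference c) (family_lin 2^-1 2^-1 w w' c t))
    (fun t => energy (reference c) (w c t)) (fun t => energy (reference c) (w' c t))).
  - exact: measurable_itv.
  - exact: measurable_energy (pl _ _ c).
  - exact: measurable_energy (pl _ _ c).
  - exact: measurable_energy (pw c).
  - exact: measurable_energy (pw' c).
  - by move=> t; exact: energy_ge0.
  - by move=> t; exact: energy_ge0.
  - by move=> t; exact: energy_ge0.
  - by move=> t; exact: energy_ge0.
  - by move=> t; exact: energy_parallelogram.
apply: (@sume_parallelogram _ _ (I (family_lin 1 (-1) w w'))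
  (I (family_lin 2^-1 2^-1 w w')) (I w) (I w')) => // c; exact: I0.
Qed.

(** The bound for one charge, integrated over an interval of length 1, which leaves the term with
    the reference mass unchanged. *)
Lemma path_variation_le_energy (h : R) w c : 0 < h -> family_path support w ->
  (path_variation (w c) <= h%:E * family_energy w + (h^-1)%:E * reference c setT)%E.
Proof.
move=> h0 pw.
have e0 c' nu : (0 <= energy (reference c') nu)%E by exact: energy_ge0.
have mI : measurable I01 by exact: measurable_itv.
have me := measurable_energy (pw c).
apply: (@le_trans _ _ (h%:E * \int[leb]_(t in I01) energy (reference c) (w c t) +
    (h^-1)%:E * reference c setT)%E).
  have leb1 : leb I01 = 1%E by rewrite /= lebesgue_measure_itv/= lte_fin ltr01 oppr0 adde0.
  have -> : ((h^-1)%:E * reference c setT =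
      \int[leb]_(t in I01) ((h^-1)%:E * reference c setT))%E.
    apply/esym; apply: (etrans (@integral_cst _ _ _ leb I01 mI _)).
    transitivity ((h^-1)%:E * reference c setT * 1)%E; last by rewrite mule1.
    by congr (_ * _)%E; exact: leb1.
  have r0 : (0 <= (h^-1)%:E * reference c setT)%E.
    by rewrite mule_ge0// lee_fin invr_ge0 ltW.
  rewrite -ge0_integralZl//; last by rewrite lee_fin ltW.
  rewrite -ge0_integralD//; last 2 first.
  - by move=> t _; rewrite mule_ge0// lee_fin ltW.
  - exact: measurable_funeM.
  apply: ge0_le_integral => //.
  - by apply: (measurable_total_variation cg) => //; have [] := pw c.
  - by apply: emeasurable_funD => //; exact: measurable_funeM.
  by move=> t _; exact: (total_variation_le_energy cg).
rewrite leeD2r// lee_wpmul2l ?lee_fin ?(ltW h0)//.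
rewrite /family_energy (bigD1 c)//= leeDl//; apply: sume_ge0 => c' _.
by apply: integral_ge0 => t _; exact: e0.
Qed.

Variable A : (component -> signed) -> \bar R.
Hypothesis A_lsc : convex_lsc_action A.
Hypothesis A_energy : forall c, exists2 K, 0 <= K & forall w,
  (energy (reference c) (w c) <= K%:E + K%:E * A w)%E.

Definition path_action (w : component -> R -> signed) : \bar R :=
  (\int[leb]_(t in I01) A (w ^~ t))%E.

Lemma measurable_path_action w : family_path support w ->
  measurable_fun I01 (fun t => A (w ^~ t)).
Proof.
move=> pw; apply: (action_measurable A_lsc (w := fun t => w ^~ t)).
  exact: measurable_itv.
by move=> c X mX; have [_ + _] := pw c; apply.
Qed.

Lemma path_action_mid w w' : family_path support w -> family_path support w' ->
  (path_action (family_lin 2^-1 2^-1 w w') <=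
   (2^-1)%:E * (path_action w + path_action w'))%E.
Proof.
move=> pw pw'; have mI : measurable I01 by exact: measurable_itv.
have A0 := action_ge0 A_lsc.
have m := measurable_path_action pw; have m' := measurable_path_action pw'.
have ml := measurable_path_action (family_path_lin cg 2^-1 2^-1 pw pw').
rewrite /path_action -ge0_integralD// -ge0_integralZl//; last 2 first.
- exact: emeasurable_funD.
- by move=> t _; exact: adde_ge0.
apply: ge0_le_integral => //.
- by apply: measurable_funeM; exact: emeasurable_funD.
- by move=> t _; exact: (action_mid A_lsc).
Qed.

Lemma family_energy_bound (r : R) : exists M, forall w, family_path support w ->
  (path_action w <= r%:E)%E -> (family_energy w <= M%:E)%E.
Proof.
have /choice[K hK] c : exists K, 0 <= K /\ forall w,
    (energy (reference c) (w c) <= K%:E + K%:E * A w)%E.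
  by have [K K0 hK] := A_energy c; exists K.
exists (\sum_c (K c + K c * r)) => w pw hr.
have mI : measurable I01 by exact: measurable_itv.
have A0 := action_ge0 A_lsc; have mA := measurable_path_action pw.
rewrite /family_energy -sumEFin; apply: lee_sum => c _.
have [K0 hKc] := hK c.
apply: (@le_trans _ _ (\int[leb]_(t in I01) ((K c)%:E + (K c)%:E * A (w ^~ t)))%E).
  apply: ge0_le_integral => //.
  - by move=> t _; exact: energy_ge0.
  - exact: measurable_energy (pw c).
  - by apply: emeasurable_funD => //; exact: measurable_funeM.
  - by move=> t _; exact: (hKc (w ^~ t)).
rewrite ge0_integralD//; last 2 first.
- by move=> t _; rewrite mule_ge0// lee_fin.
- exact: measurable_funeM.
rewrite ge0_integralZl// EFinD EFinM; apply: leeD.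
  rewrite [leLHS](@integral_cst _ _ _ leb I01 mI (K c)%:E).
  have leb1 : leb I01 = 1%E by rewrite /= lebesgue_measure_itv/= lte_fin ltr01 oppr0 adde0.
  by rewrite [X in (_ * X <= _)%E]leb1 mule1.
by apply: lee_wpmul2l; rewrite ?lee_fin.
Qed.

(** The energy serves only to select a convergent sequence; no minimality of the limit for the
    energy is claimed. *)
Lemma family_CE_minimizer (i : R) :
  (forall n : nat, exists w, family_CE w /\ (path_action w <= (i + n.+1%:R^-1)%:E)%E) ->
  exists w, family_CE w /\ (path_action w <= i%:E)%E.
Proof.
move=> ne.
pose S n w := family_CE w /\ (path_action w <= (i + n.+1%:R^-1)%:E)%E.
have Spath n w : S n w -> family_path support w by case=> -[/Dadm_family].
have Smid n w w' : S n w -> S n w' -> S n (family_lin 2^-1 2^-1 w w').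
  move=> Sw Sw'; have pw := Spath _ _ Sw; have pw' := Spath _ _ Sw'.
  case: Sw Sw' => cw aw [cw' aw']; split; first exact: family_CE_mid.
  apply: le_trans (path_action_mid pw pw') _.
  apply: (@le_trans _ _ ((2^-1)%:E * ((i + n.+1%:R^-1)%:E + (i + n.+1%:R^-1)%:E))%E).
    by apply: lee_wpmul2l; [rewrite lee_fin invr_ge0|exact: leeD].
  have E : 2^-1 * ((i + n.+1%:R^-1) + (i + n.+1%:R^-1)) = i + n.+1%:R^-1 by field.
  suff : 2^-1 * ((i + n.+1%:R^-1) + (i + n.+1%:R^-1)) <= i + n.+1%:R^-1 by [].
  by rewrite E.
have Sdec m n w : (m <= n)%N -> S n w -> S m w.
  move=> mn [cw aw]; split => //; apply: le_trans aw _.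
  by rewrite lee_fin lerD2l lef_pV2 ?posrE ?ltr0n// ler_nat.
have [M hM] := family_energy_bound (i + 1).
have fe0 w : (0 <= family_energy w)%E.
  by apply: sume_ge0 => c _; apply: integral_ge0 => t _; exact: energy_ge0.
have SM w : S 0%N w -> (family_energy w <= M%:E)%E.
  by move=> Sw; apply: hM (Spath _ _ Sw) _; have [_] := Sw; rewrite invr1.
have Sfin w : S 0%N w -> family_energy w \is a fin_num.
  by move=> /SM h; rewrite ge0_fin_numE// (le_lt_trans h)// ltry.
have Sdiff w w' : S 0%N w -> S 0%N w' ->
    family_energy (family_lin 1 (-1) w w') \is a fin_num.
  move=> Sw Sw'.
  apply: (parallelogram_fin_num (fe0 _) (fe0 _) (Sfin _ Sw) (Sfin _ Sw')).
  exact: family_energy_parallelogram (Spath _ _ Sw) (Spath _ _ Sw').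
(* The weight for the k-th increment; energies of increments will be at most h ^ -2. *)
pose h k : R := 2 ^+ k.+1.
have h0 k : 0 < h k by rewrite exprn_gt0.
have bound w : S 0%N w -> 0 <= fine (family_energy w) <= M.
  move=> Sw; rewrite fine_ge0 ?fe0//=.
  by rewrite -lee_fin fineK ?SM// Sfin.
have par w w' : S 0%N w -> S 0%N w' ->
    fine (family_energy (family_lin 1 (-1) w w')) +
    4 * fine (family_energy (family_lin 2^-1 2^-1 w w')) <=
    2 * (fine (family_energy w) + fine (family_energy w')).
  move=> Sw Sw'; apply: (parallelogram_fine (Sdiff _ _ Sw Sw')
    (Sfin _ (Smid _ _ _ Sw Sw')) (Sfin _ Sw) (Sfin _ Sw')).
  exact: family_energy_parallelogram (Spath _ _ Sw) (Spath _ _ Sw').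
have eta0 k : 0 < (h k ^+ 2)^-1 by rewrite invr_gt0 exprn_gt0.
have [g hg] : exists g : nat -> component -> R -> signed, forall k, S k (g k) /\
    fine (family_energy (family_lin 1 (-1) (g k.+1) (g k))) <= (h k ^+ 2)^-1.
  exact: (uniformly_convex_minimizers
    (dist := fun w w' => fine (family_energy (family_lin 1 (-1) w w')))
    ne Sdec Smid bound par eta0).
have Sg k : S k (g k) by case: (hg k).
have S0g k : S 0%N (g k) by exact: Sdec (Sg k).
have pg k : family_path support (g k) by exact: Spath (Sg k).
have sg c : (\sum_(0 <= k <oo)
    path_variation (fun t => charge_diff (g k.+1 c t) (g k c t)) < +oo)%E.
  (* The k-th increment has variation at most h h^-2 + l(T) / h = L / 2 ^ (k + 1), and these bounds
     add up to L. *)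
  pose L := 1 + fine (reference c setT).
  have L0 : 0 <= L by rewrite addr_ge0// fine_ge0.
  apply: (@le_lt_trans _ _ L%:E); last exact: ltry.
  apply: le_trans (epsilon_trick0 xpredT L0); apply: lee_nneseries.
    by move=> k _ _; exact: path_variation_ge0.
  move=> k _.
  apply: (le_trans (path_variation_le_energy c (h0 k)
    (family_path_lin cg 1 (-1) (pg k.+1) (pg k)))).
  rewrite -(fineK (Sdiff _ _ (S0g k.+1) (S0g k))).
  rewrite -[reference c setT]fineK ?fin_num_measure//.
  have [_ hgk] := hg k; move: hgk.
  move: (fine _) (fine _) @L L0 => r e L L0 er.
  rewrite -!EFinM -EFinD lee_fin natrX -/(h k) /L mulrDl mul1r [_^-1 * _]mulrC lerD2r.
  have hk := h0 k; rewrite -ler_pdivlMl// -invfM -expr2.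
  exact: er.
have [w [pw cw ew]] := family_path_limit pg sg.
exists w; split; first by apply: (family_CE_closed _ pw cw) => k; case: (Sg k).
apply: (@fatou_ev _ _ _ leb I01 (fun n t => A (g n ^~ t))).
- exact: measurable_itv.
- by move=> n; exact: measurable_path_action.
- by move=> n t _; exact: (action_ge0 A_lsc).
- exact: measurable_path_action.
- by move=> t _; exact: (action_ge0 A_lsc).
- by apply: filterS ew => t ht It; apply: (action_ev_ge A_lsc); exact: ht.
(* From this index on, 1 / (n + 1) <= e. *)
move=> e e0; exists (Num.truncn e^-1) => n hn.
have [_ /le_trans] := Sg n; apply; rewrite -EFinD lee_fin lerD2l.
rewrite -[e]invrK lef_pV2 ?posrE ?ltr0n ?invr_gt0//.
by apply: (le_trans (ltW (truncnS_gt _))); rewrite ler_nat.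
Qed.

End paths_of_families.

Theorem theorem3p9 (R : realType) (d : nat) (Omega : set 'rV[R]_d)
    (G : metric_graph R) (x : vertex G -> 'rV[R]_d)
    (z0 z1 : datum R d G) (mO mG : R -> \bar R) (a1 a2 a3 : R)
    (lO : {finite_measure set (borel_rV R d) -> \bar R})
    (lE : edge G -> {finite_measure set (borel_rV R d) -> \bar R})
    (lV : vertex G -> {finite_measure set (borel_rV R d) -> \bar R})
    (Omega_compact : compact Omega)
    (Omega_convex : convex_set (Omega : set (convex_lmodType 'rV[R]_d)))
    (x_embedded : embedded x Omega)
    (z0_adm : Padm Omega x z0) (z1_adm : Padm Omega x z1)
    (mO_adm : admissible_mobility mO) (mG_adm : admissible_mobility mG)
    (a1_gt0 : 0 < a1) (a2_gt0 : 0 < a2) (a3_gt0 : 0 < a3)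
    (lO_conc : concentrated (Omega : set (borel_rV R d)) lO)
    (lE_conc : forall e,
       concentrated (seg x e : set (borel_rV R d)) (lE e))
    (lV_conc : forall v, v \in vout ->
       concentrated ([set x v] : set (borel_rV R d)) (lV v)) :
  (ereal_inf [set total_action mO mG a1 a2 a3 x Omega lO lE lV p
             | p in CE Omega x z0 z1] < +oo)%E ->
  exists2 p, CE Omega x z0 z1 p &
    total_action mO mG a1 a2 a3 x Omega lO lE lV p =
    ereal_inf [set total_action mO mG a1 a2 a3 x Omega lO lE lV q
              | q in CE Omega x z0 z1].
Proof.
pose A := component_action mO mG a1 a2 a3 x lO lE lV.
pose act := total_action mO mG a1 a2 a3 x Omega lO lE lV.
have actE p : act p = path_action A (fun c t => state_component (p t) c).
  apply: eq_integral => t _.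
  exact: (graph_actionE mO_adm mG_adm a1_gt0 a2_gt0 a3_gt0 Omega_compact lO_conc lE_conc lV_conc).
have A_lsc := component_action_convex_lsc x lO lE lV mO_adm mG_adm a1_gt0 a2_gt0 a3_gt0.
have A_energy := component_energy x lO lE lV mO_adm mG_adm a1_gt0 a2_gt0 a3_gt0.
rewrite -/act; set I := ereal_inf _ => Ifin.
have I0 : (0 <= I)%E.
  apply/ereal_infP => _ [p _ <-]; rewrite actE.
  by apply: integral_ge0 => t _; exact: (action_ge0 A_lsc).
(* Finiteness of the infimum gives a meaning to the real levels I + 1 / (n + 1). *)
have If : I \is a fin_num by rewrite ge0_fin_numE.
have near n : exists w, family_CE Omega x z0 z1 w /\
    (path_action A w <= (fine I + n.+1%:R^-1)%:E)%E.
  have n0 : 0 < n.+1%:R^-1 :> R by rewrite invr_gt0 ltr0n.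
  have [_ [p CEp <-] lt] := lb_ereal_inf_adherent n0 If.
  exists (fun c t => state_component (p t) c); split; first exact: family_CE_state.
  by rewrite -actE EFinD fineK//; exact: ltW.
have [w [CEw aw]] := family_CE_minimizer Omega_compact A_lsc A_energy near.
exists (fun t => family_state x (w ^~ t)); first exact: CEw.
apply/eqP; rewrite eq_le; apply/andP; split.
  rewrite (fineK If) in aw; apply: le_trans aw.
  (* The components of the rebuilt state are those of [w], so its action is the action of [w]. *)
  rewrite actE le_eqVlt; apply/orP; left; apply/eqP.
  by apply: eq_integral => t _; congr A; apply/funext => c; rewrite state_componentK.
by apply: ereal_inf_lbound; exists (fun t => family_state x (w ^~ t)).
Qed.
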